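(* The reduced C*-algebra $C^*_r(T)$ of Thompson's group $T$ has a unique maximal ideal.
   Context: Thompson's group $T$ is the (discrete) group of homeomorphisms of $\mathbb{R}/\mathbb{Z}$ that are piecewise linear, with finitely many breakpoints, all at points of $\Omega=[0,1)\cap\mathbb{Z}[1/2]$, with slopes in $2^{\mathbb{Z}}$, and that map dyadic rationals to dyadic rationals. ''Ideal'' means closed two-sided ideal; ''maximal ideal'' means maximal among proper ideals (the zero ideal is allowed). No assumption is made on the amenability of Thompson's group $F$. *)

(* Defs.v *)
From HB Require Import structures.
From mathcomp Require Import all_boot all_order all_algebra.
From mathcomp Require Import complex ring lra.
From mathcomp Require Import all_classical all_reals all_analysis.
Import Order.TTheory GRing.Theory Num.Theory.
Import numFieldNormedType.Exports.

Set Implicit Arguments.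
Unset Strict Implicit.
Unset Printing Implicit Defensive.

Local Open Scope classical_set_scope.
Local Open Scope quotient_scope.
Local Open Scope ring_scope.

Section circle.
Variable R : realType.

Let eqmodZ' (x y : R) := x - y \is a Num.int.

Local Lemma eqmodZ_refl : reflexive eqmodZ'.
Proof. by move=> x; rewrite /eqmodZ' subrr. Qed.

Local Lemma eqmodZ_sym : symmetric eqmodZ'.
Proof. by move=> x y; rewrite /eqmodZ' -rpredN opprB. Qed.

Local Lemma eqmodZ_trans : transitive eqmodZ'.
Proof.
move=> y x z xy yz; rewrite /eqmodZ' -(subrK y x) -addrA; exact: rpredD.
Qed.

Definition eqmodZ := EquivRel eqmodZ' eqmodZ_refl eqmodZ_sym eqmodZ_trans.

Definition circle := {eq_quot eqmodZ}.

HB.instance Definition _ := Topological.copy circle (quotient_topology circle).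
HB.instance Definition _ := Quotient.on circle.

Lemma eq_circle (x y : R) :
  \pi_circle x = \pi_circle y <-> x - y \is a Num.int.
Proof. by split=> /(@eqmodP _ eqmodZ x y). Qed.

End circle.

Section thompsonT.
Variable R : realType.
Local Notation circle := (circle R).
Local Notation pi := (\pi_circle : R -> circle).
Implicit Types f g : circle -> circle.

Definition dyadic : set R :=
  [set x | exists (m : int) (n : nat), x = m%:~R / 2 ^+ n].

Definition homeomorphism f := exists g,
  [/\ cancel f g, cancel g f, continuous f & continuous g].

(* `B` contains all breakpoints; away from them `f` lifts locally to an affine
   map whose slope is a power of 2 with exponent in `int`. *)
Definition dyadic_piecewise_linear f := exists B : seq R,
  (forall b, b \in B -> dyadic b /\ 0 <= b < 1) /\
  (forall x : R, pi x \notin map pi B ->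
     exists (k : int) (c : R), \forall y \near x, f (pi y) = pi (2 ^ k * y + c)).

Definition in_thompsonT : set (circle -> circle) := [set f |
  [/\ homeomorphism f, dyadic_piecewise_linear f &
      forall x, dyadic x -> exists2 y, dyadic y & f (pi x) = pi y]].

Definition thompsonT := set_type in_thompsonT.

Lemma dyadic_int (x : R) : x \is a Num.int -> dyadic x.
Proof. by move=> /intrP[m ->]; exists m, 0%N; rewrite expr0 divr1. Qed.

Lemma dyadicD x y : dyadic x -> dyadic y -> dyadic (x + y).
Proof.
move=> [m [n ->]] [m' [n' ->]].
exists (m * 2 ^+ n' + m' * 2 ^+ n), (n + n')%N.
rewrite rmorphD !rmorphM !rmorphXn /= exprD; field.
by rewrite !expf_neq0 ?pnatr_eq0.
Qed.

Lemma dyadicN x : dyadic x -> dyadic (- x).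
Proof. by move=> [m [n ->]]; exists (- m), n; rewrite rmorphN mulNr. Qed.

Lemma dyadicMz (k : int) x : dyadic x -> dyadic (2 ^ k * x).
Proof.
move=> [m [n ->]]; case: k => k.
- exists (2 ^+ k * m), n.
  by rewrite rmorphM rmorphXn /= -exprnP mulrA.
- exists m, (k.+1 + n)%N.
  by rewrite NegzE -exprnN exprD invfM mulrCA.
Qed.

Lemma dyadic_pi x y : pi x = pi y -> dyadic y -> dyadic x.
Proof.
by move=> /eq_circle /dyadic_int xy /(dyadicD xy); rewrite subrK.
Qed.

Lemma dyadic_dense (x : R) (P : set R) :
  (\forall y \near x, P y) -> exists2 y, dyadic y & P y.
Proof.
move=> /nbhs_ballP[e /= e0 eP].
pose n := Num.bound e^-1.
have ne : e^-1 < 2 ^+ n by apply: upper_nthrootP.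
have p0 : 0 < 2 ^+ n :> R by rewrite exprn_gt0.
pose m := Num.floor (x * 2 ^+ n).
exists (m%:~R / 2 ^+ n); first by exists m, n.
apply: eP; rewrite /ball /=.
have /andP[m1 m2] := floor_itv (x * 2 ^+ n).
rewrite -(ltr_pM2r p0) -[X in _ * X < _](gtr0_norm p0) -normrM mulrBl.
rewrite divfK ?gt_eqF// ger0_norm ?subr_ge0//.
apply: (@lt_trans _ _ 1); first by rewrite ltrBlDl -intrD1.
by rewrite -[ltLHS](mulfV (lt0r_neq0 e0)) ltr_pM2l.
Qed.

Let dyadicc (z : circle) := exists2 y, dyadic y & z = pi y.

Lemma dyadic_piecewise_linearP f : (exists B : seq circle,
    (forall z, z \in B -> dyadicc z) /\
    (forall x : R, pi x \notin B ->
     exists (k : int) (c : R), \forall y \near x, f (pi y) = pi (2 ^ k * y + c)))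
  <-> dyadic_piecewise_linear f.
Proof.
split=> [[B [dB fB]]|[B [dB fB]]]; last first.
  exists (map pi B); split => // z /mapP[b /dB[db _] ->]; by exists b.
pose r (z : circle) := repr z - (Num.floor (repr z))%:~R.
have rK z : pi (r z) = z.
  rewrite -[RHS]reprK; apply/eq_circle.
  by rewrite /r addrAC subrr add0r rpredN intr_int.
have rB : map pi (map r B) = B.
  by rewrite -map_comp -[RHS]map_id; apply: eq_map => z /=.
exists (map r B); rewrite rB; split => // _ /mapP[z zB ->]; split.
  have [y dy zy] := dB z zB; apply: dyadic_pi dy; by rewrite rK.
have /andP[m1 m2] := floor_itv (repr z).
by rewrite /r subr_ge0 m1 ltrBlDl -intrD1.
Qed.

Lemma in_thompsonT_id : in_thompsonT id.
Proof.
split.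
- by exists id; split=> // x.
- exists [::]; split=> // x _; exists 0, 0; near=> y.
  by rewrite expr0z mul1r addr0.
- by move=> x dx; exists x.
Unshelve. all: by end_near.
Qed.

Lemma affine_near (a c x : R) (P : set R) :
  (\forall z \near a * x + c, P z) -> \forall y \near x, P (a * y + c).
Proof.
have : a * y + c @[y --> x] --> a * x + c.
  by apply: cvgD; [apply: cvgMr; exact: cvg_id|exact: cvg_cst].
by move=> /(_ P).
Qed.

Lemma in_thompsonT_inv f g : cancel f g -> cancel g f ->
  in_thompsonT f -> in_thompsonT g.
Proof.
move=> fK gK [[g' [fK' gK' fc gc]] /dyadic_piecewise_linearP[B [dB fB]] fd].
have Eg : g' = g by apply/funext => x; rewrite -{1}(gK x) fK'.
rewrite {}Eg {fK' gK'} in gc.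
have fdc z : dyadicc z -> dyadicc (f z).
  by move=> [y dy ->]; have [w dw ->] := fd y dy; exists w.
have gB x y (k : int) c : f (pi x) = pi (2 ^ k * x + c) -> g (pi y) = pi x ->
    exists2 n, n \is a Num.int & x = 2 ^ (- k) * (y - c - n).
  move=> fx gx; exists (y - (2 ^ k * x + c)).
    by apply/eq_circle; rewrite -fx -gx gK.
  rewrite -invr_expz.
  have E : 2 ^ k != 0 :> R by rewrite expfz_eq0 pnatr_eq0 andbF.
  by rewrite -[LHS](mulKf E); congr (_ * _); ring.
have k0 (k : int) : 2 ^ k * 2 ^ (- k) = 1 :> R.
  by rewrite -invr_expz mulfV// expfz_eq0 pnatr_eq0 andbF.
split; first by exists f.
- apply/dyadic_piecewise_linearP; exists (map f B).
  split=> [_ /mapP[z zB ->]|y yB]; first exact/fdc/dB.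
  pose x := repr (g (pi y)).
  have gx : g (pi y) = pi x by rewrite reprK.
  have xB : pi x \notin B.
    by apply: contra yB => xB; apply/mapP; exists (pi x) => //; rewrite -gx gK.
  have [k [c fk]] := fB x xB.
  have [n ni xE] := gB x y k c (nbhs_singleton fk) gx.
  exists (- k), (2 ^ (- k) * (- c - n)).
  have {}fk : \forall u \near 2 ^ (- k) * y + 2 ^ (- k) * (- c - n),
     f (pi u) = pi (2 ^ k * u + c).
    by rewrite -mulrDr addrA -xE.
  have := affine_near fk; apply: filterS => z fz.
  rewrite -[RHS]fK fz; congr g; apply/eq_circle.
  by rewrite -mulrDr mulrA k0 mul1r; rewrite (_ : _ - _ = n)//; ring.
- move=> y dy; pose x := repr (g (pi y)).
  have gx : g (pi y) = pi x by rewrite reprK.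
  exists x => //; have [xB|xB] := boolP (pi x \in B).
    by have [w dw xw] := dB _ xB; apply: dyadic_pi dw.
  have [k [c fk]] := fB x xB.
  have [n ni ->] := gB x y k c (nbhs_singleton fk) gx.
  apply: dyadicMz; apply: dyadicD; last exact/dyadicN/dyadic_int.
  apply: dyadicD => //; apply: dyadicN.
  have [u du fu] := dyadic_dense fk.
  have [w dw fw] := fd _ du.
  have dc : dyadic (2 ^ k * u + c) by apply: dyadic_pi dw; rewrite -fu.
  rewrite (_ : c = (2 ^ k * u + c) + - (2 ^ k * u)); last by ring.
  by apply: dyadicD => //; apply: dyadicN; apply: dyadicMz.
Qed.

Lemma in_thompsonT_comp f g :
  in_thompsonT f -> in_thompsonT g -> in_thompsonT (f \o g).
Proof.
move=> Tf Tg.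
case: (Tf) => [[f' [fK fK' fc f'c]] /dyadic_piecewise_linearP[B [dB fB]] fd].
case: (Tg) => [[g' [gK gK' gc g'c]] /dyadic_piecewise_linearP[C [dC gC]] gd].
have [_ _ g'd] := in_thompsonT_inv gK gK' Tg.
split.
- exists (g' \o f'); split; [exact: can_comp|exact: can_comp| |].
    by move=> x; apply: continuous_comp; [exact: gc|exact: fc].
  by move=> x; apply: continuous_comp; [exact: f'c|exact: g'c].
- apply/dyadic_piecewise_linearP; exists (C ++ map g' B); split.
    move=> z; rewrite mem_cat => /orP[/dC//|/mapP[w /dB[v dv ->] ->]].
    by have [u du ->] := g'd v dv; exists u.
  move=> x; rewrite mem_cat negb_or => /andP[xC xB].
  have [k [c gk]] := gC x xC.
  have xB' : pi (2 ^ k * x + c) \notin B.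
    apply: contra xB => xB; apply/mapP; exists (pi (2 ^ k * x + c)) => //.
    by rewrite -(nbhs_singleton gk) gK.
  have [l [e fl]] := fB _ xB'.
  exists (l + k), (2 ^ l * c + e).
  have := affine_near fl; apply: filterS2 gk => y /= -> ->.
  by rewrite expfzDr ?pnatr_eq0//; congr pi; ring.
- by move=> x /gd[y /fd[z dz fz] gy]; exists z; rewrite //= gy.
Qed.

HB.instance Definition _ := Choice.on thompsonT.

Implicit Types s t : thompsonT.

Definition thompson_one : thompsonT := SigSub (mem_set in_thompsonT_id).

Definition thompson_mul s t : thompsonT :=
  SigSub (mem_set (in_thompsonT_comp (set_mem (valP s)) (set_mem (valP t)))).

Lemma thompson_inv_ex s :
  {t : thompsonT | cancel (val s) (val t) /\ cancel (val t) (val s)}.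
Proof.
apply: cid; have /set_mem fT := valP s; have [[g [fK gK _ _]] _ _] := fT.
by exists (SigSub (mem_set (in_thompsonT_inv fK gK fT))).
Qed.

Definition thompson_inv s : thompsonT := sval (thompson_inv_ex s).

Lemma thompson_mulA : associative thompson_mul.
Proof. by move=> s t u; apply: val_inj. Qed.

Lemma thompson_mul1 : left_id thompson_one thompson_mul.
Proof. by move=> s; apply: val_inj. Qed.

Lemma thompson_mulr1 : right_id thompson_one thompson_mul.
Proof. by move=> s; apply: val_inj. Qed.

Lemma thompson_mulV : left_inverse thompson_one thompson_inv thompson_mul.
Proof.
move=> s; apply: val_inj; apply/funext => x /=.
by have [sK _] := svalP (thompson_inv_ex s); exact: sK.
Qed.

Lemma thompson_mulrV : right_inverse thompson_one thompson_inv thompson_mul.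
Proof.
move=> s; apply: val_inj; apply/funext => x /=.
by have [_ sK] := svalP (thompson_inv_ex s); exact: sK.
Qed.

HB.instance Definition _ := isGroup.Build thompsonT
  thompson_mulA thompson_mul1 thompson_mulr1 thompson_mulV thompson_mulrV.

End thompsonT.

Section ell2.
Variables (R : realType) (G : choiceType).
Local Notation C := R[i].
Local Notation normc := ComplexField.Normc.normc.
Implicit Types x y : G -> C.

Definition sqnorm x : \bar R := \esum_(g in [set: G]) (normc (x g) ^+ 2)%:E.

Definition in_ell2 : {pred (G -> C)} := fun x => `[< (sqnorm x < +oo)%E >].

Lemma in_ell2P x : reflect (sqnorm x < +oo)%E (x \in in_ell2).
Proof. exact: asboolP. Qed.

Lemma sqnormZ_le (a : C) x :
  (sqnorm (a *: x) <= (normc a ^+ 2)%:E * sqnorm x)%E.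
Proof.
apply: ge_ereal_sup => /= _ [X XT <-].
under eq_fsbigr do rewrite ComplexField.Normc.normcM exprMn EFinM.
rewrite -ge0_mule_fsumr; last by move=> g; rewrite lee_fin sqr_ge0.
apply: lee_wpmul2l; first by rewrite lee_fin sqr_ge0.
by apply: ereal_sup_ubound; exists X.
Qed.

Lemma ell2_submod_closed : submod_closed in_ell2.
Proof.
split.
  apply/in_ell2P; rewrite /sqnorm esum1 ?ltry// => g _.
  by rewrite ComplexField.Normc.normc0 expr0n.
have ge0 z g : (0 <= (normc (z g) ^+ 2)%:E :> \bar R)%E.
  by rewrite lee_fin sqr_ge0.
move=> a x y /in_ell2P fx /in_ell2P fy; apply/in_ell2P.
have fax : (sqnorm (a *: x) < +oo)%E.
  apply: le_lt_trans (sqnormZ_le _ _) _.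
  by rewrite lte_mul_pinfty// lee_fin sqr_ge0.
pose u : G -> C := a *: x.
have le2 : (sqnorm (u + y)%R <= (sqnorm u + sqnorm y) + (sqnorm u + sqnorm y))%E.
  rewrite /sqnorm -!esumD//; [|by move=> *; exact: adde_ge0..].
  apply: le_esum => g _; rewrite -!EFinD lee_fin.
  have n0 (z : C) : 0 <= normc z by case: z => ? ?; exact: sqrtr_ge0.
  have := le_normcD (u g) (y g); rewrite -[u g + y g]/((u + y) g).
  move: (n0 (u g)) (n0 (y g)) (n0 ((u + y) g)).
  move: (normc (u g)) (normc (y g)) (normc ((u + y) g)) => p q r p0 q0 r0 rpq.
  have : r ^+ 2 <= (p + q) ^+ 2 by rewrite lerXn2r// nnegrE addr_ge0.
  have := sqr_ge0 (p - q); nra.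
by apply: le_lt_trans le2 _; rewrite !lte_add_pinfty.
Qed.

HB.instance Definition _ :=
  GRing.isSubmodClosed.Build C (G -> C) in_ell2 ell2_submod_closed.

Definition ell2 := {x : G -> C | in_ell2 x}.

HB.instance Definition _ := Choice.on ell2.
HB.instance Definition _ := SubType.on ell2.
HB.instance Definition _ := [SubChoice_isSubLmodule of ell2 by <:].

Definition ell2norm (x : ell2) : R := Num.sqrt (fine (sqnorm (val x))).

End ell2.

Section operators.
Variables (R : realType) (G : choiceType).
Local Notation H := (ell2 R G).
Local Notation norm := (@ell2norm R G).
Implicit Types (S T : H -> H) (A I J : set (H -> H)).

Definition bounded_operator S :=
  linear S /\ exists M : R, forall x, norm (S x) <= M * norm x.

(* Meaningful for bounded operators only, as the supremum of an unbounded set is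
   0 by convention. *)
Definition opnorm S : R := sup [set norm (S x) | x in [set x | norm x <= 1]].

Definition norm_closure A : set (H -> H) := [set S | bounded_operator S /\
  forall e : R, 0 < e -> exists2 T, A T & opnorm (S - T) < e].

Definition closed_ideal A I :=
  [/\ I `<=` A,
      (I 0 /\ forall (a : R[i]) S T, I S -> I T -> I (a *: S + T)),
      (forall S T, A S -> I T -> I (S \o T) /\ I (T \o S)) &
      norm_closure I `<=` I].

Definition maximal_ideal A I :=
  [/\ closed_ideal A I, I <> A &
      forall J, closed_ideal A J -> J <> A -> I `<=` J -> J = I].

End operators.

Section reduced.
Variables (R : realType) (G : groupType).
Local Notation H := (ell2 R G).

Lemma sqnorm_translate (g : G) (x : G -> R[i]) :
  sqnorm (fun h => x (g^-1 * h)%g) = sqnorm x.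
Proof.
rewrite /sqnorm [RHS](reindex_esum [set: G] _ (fun h => (g^-1 * h)%g))//.
rewrite setTT_bijective; exists (fun h => (g * h)%g) => h.
  by rewrite mulgA mulgV mul1g.
by rewrite mulgA mulVg mul1g.
Qed.

Lemma left_regular_subproof (g : G) (x : H) :
  in_ell2 (fun h => val x (g^-1 * h)%g).
Proof.
by apply/in_ell2P; rewrite sqnorm_translate; apply/in_ell2P; exact: (valP x).
Qed.

Definition left_regular (g : G) (x : H) : H :=
  exist _ (fun h => val x (g^-1 * h)%g) (left_regular_subproof g x).

Definition reduced_group_ring : set (H -> H) := [set S |
  exists (n : nat) (c : 'I_n -> R[i]) (g : 'I_n -> G),
    S = \sum_(i < n) c i *: left_regular (g i)].

Definition reduced_Cstar : set (H -> H) := norm_closure reduced_group_ring.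

End reduced.

Arguments reduced_Cstar R G : clear implicits.

(* Main.v *)
Require Import Defs.
From mathcomp Require Import all_boot all_order all_algebra.
From mathcomp Require Import complex ring lra zify.
From mathcomp Require Import all_classical all_reals all_analysis.

(** The unique maximal ideal is the greatest proper ideal: it is enough that any
    two proper closed ideals I and J lie in a third one, for then the union of
    all of them is an ideal, whose closure is still proper because its elements
    stay at distance at least 1 from the unit.  The zero ideal aside, this means
    that a + b is never close to the unit, for a in I and b in J.

    The proof uses the action on the circle, which is extremely proximal: some
    element sends the complement of any given arc into any other given arc.  Let
    I be nonzero and proper, let t move an arc W off itself, and average the
    unitaries of k t k^-1 t^-1 over finite lists of elements k supported in W.
    If such averages are always small modulo I for suitable lists, then
    averages of conjugates kill all nontrivial group elements modulo I, and the
    unit belongs to I ([vanishing_averages_full]).  Hence, for some t and W, all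
    the averages have norm almost 1 modulo I ([persistent_averages]): this
    dichotomy replaces any knowledge about amenability.  By uniform convexity,
    there are unit vectors y, almost annihilated by given elements of I, on
    which k and t k t^-1 act in almost the same way ([almost_equal_copies]).
    As these two copies commute, commutators of elements k almost fix y.  The
    elements of T that are the identity near a point form a perfect group;
    after conjugation into W, all of them almost fix y.  Therefore the sum of
    the coefficients of a combination of such elements is bounded by its norm
    modulo I ([augmentation_bound]), and a ping-pong argument extends this to
    combinations of arbitrary elements, if only the elements fixing a small arc
    pointwise are counted ([partial_augmentation_bound]).  This partial sum is
    then almost 0 on approximations of a and of b, whereas it is 1 on the unit:
    a + b is not close to the unit ([not_comaximal]).

    Perfectness is a matter of subdivisions.  An element that is the identity near
    the base point maps the arcs of a dyadic subdivision of the circle onto those of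
    another one, with the same number of arcs.  Up to refinement, any two such
    subdivisions are connected by moves replacing, inside some arc, the widths 1/2, 1/4, 1/4 by
    1/4, 1/4, 1/2 ([all_null]).  The elements g performing one move are all
    conjugate, and the relation g g = g3 g g1 between three of them shows that
    g vanishes in the abelianization ([null_basic]). *)

Import Order.TTheory GRing.Theory Num.Theory.
Import numFieldNormedType.Exports.

Set Implicit Arguments.
Unset Strict Implicit.
Unset Printing Implicit Defensive.

Local Open Scope classical_set_scope.
Local Open Scope ring_scope.

(** * Square-summable families *)

Section SquareSummable.
Variables (R : realType) (G : choiceType).
Local Notation C := R[i].
Local Notation H := (ell2 R G).
Local Notation normc := ComplexField.Normc.normc.
Local Notation norm := (@ell2norm R G).
Implicit Types x y : H.

Definition sqabs (z : C) : R := normc z ^+ 2.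

Lemma sqabsE (z : C) : sqabs z = complex.Re z ^+ 2 + complex.Im z ^+ 2.
Proof. by case: z => a b; rewrite /sqabs /= sqr_sqrtr// addr_ge0// sqr_ge0. Qed.

Lemma sqabs_ge0 z : 0 <= sqabs z.
Proof. exact: sqr_ge0. Qed.

Definition entry x (g : G) : C := val x g.
Arguments entry : simpl never.

Definition nsq x : R := fine (sqnorm (val x)).

Lemma sqnormE x : sqnorm (val x) = (nsq x)%:E.
Proof.
have /in_ell2P fx := valP x.
rewrite /nsq fineK// ge0_fin_numE// esum_ge0// => g _.
by rewrite lee_fin sqr_ge0.
Qed.

Lemma nsq_ge0 x : 0 <= nsq x.
Proof.
by rewrite -lee_fin -sqnormE esum_ge0// => g _; rewrite lee_fin sqr_ge0.
Qed.

Lemma normE x : norm x ^+ 2 = nsq x.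
Proof. by rewrite /ell2norm sqr_sqrtr ?nsq_ge0. Qed.

Lemma norm_ge0 x : 0 <= norm x.
Proof. exact: sqrtr_ge0. Qed.

Lemma esumZ_le (c : R) (f : G -> R) : 0 <= c -> (forall g, 0 <= f g) ->
  (\esum_(g in [set: G]) (c * f g)%:E <= c%:E * \esum_(g in [set: G]) (f g)%:E)%E.
Proof.
move=> c0 f0; apply: ge_ereal_sup => /= _ [X XT <-].
under eq_fsbigr do rewrite EFinM.
rewrite -ge0_mule_fsumr; last by move=> g; rewrite lee_fin.
apply: lee_wpmul2l; first by rewrite lee_fin.
by apply: ereal_sup_ubound; exists X.
Qed.

Lemma esumZ (c : R) (f : G -> R) : 0 <= c -> (forall g, 0 <= f g) ->
  (\esum_(g in [set: G]) (c * f g)%:E = c%:E * \esum_(g in [set: G]) (f g)%:E)%E.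
Proof.
move=> c0 f0; apply/eqP; rewrite eq_le esumZ_le//=.
have [->|cn0] := eqVneq c 0.
  by rewrite mul0e esum_ge0// => g _; rewrite mul0r.
have cp : 0 < c by rewrite lt_def cn0.
have := @esumZ_le c^-1 (fun g => c * f g).
rewrite invr_ge0 => /(_ c0 (fun g => mulr_ge0 c0 (f0 g))).
under eq_esum do rewrite mulKf//.
move=> h; have := @lee_wpmul2l _ c%:E _ _ _ h.
by rewrite muleA -EFinM mulfV// mul1e; apply.
Qed.

Lemma esum_nsq (l : seq (R * H)) : all (fun p => 0 <= p.1) l ->
  (\esum_(g in [set: G]) (\sum_(p <- l) p.1 * sqabs (entry p.2 g))%:E =
   (\sum_(p <- l) p.1 * nsq p.2)%:E)%E.
Proof.
elim: l => [_|[c x] l IH /= /andP[c0 l0]].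
  by rewrite big_nil esum1// => g _; rewrite big_nil.
rewrite big_cons EFinD -(IH l0) EFinM -sqnormE.
rewrite -esumZ//; last by move=> g; exact: sqabs_ge0.
rewrite -esumD.
- by apply: eq_esum => g _; rewrite big_cons EFinD.
- by move=> g _; rewrite lee_fin mulr_ge0// sqabs_ge0.
- move=> g _; rewrite lee_fin big_seq sumr_ge0// => p pl.
  by rewrite mulr_ge0// ?sqabs_ge0//; exact: (allP l0).
Qed.

(** Numerical inequalities between squared norms are inherited from the scalar
    ones, as long as every coefficient is nonnegative; this is how the geometry
    of the Hilbert space is reduced to identities between complex numbers. *)
Lemma nsq_le (l m : seq (R * H)) :
  all (fun p => 0 <= p.1) l -> all (fun p => 0 <= p.1) m ->
  (forall g, \sum_(p <- l) p.1 * sqabs (entry p.2 g) <=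
             \sum_(p <- m) p.1 * sqabs (entry p.2 g)) ->
  \sum_(p <- l) p.1 * nsq p.2 <= \sum_(p <- m) p.1 * nsq p.2.
Proof.
move=> l0 m0 lm; rewrite -lee_fin -!esum_nsq//.
by apply: le_esum => g _; rewrite lee_fin.
Qed.

Lemma nsq_eq (l m : seq (R * H)) :
  all (fun p => 0 <= p.1) l -> all (fun p => 0 <= p.1) m ->
  (forall g, \sum_(p <- l) p.1 * sqabs (entry p.2 g) =
             \sum_(p <- m) p.1 * sqabs (entry p.2 g)) ->
  \sum_(p <- l) p.1 * nsq p.2 = \sum_(p <- m) p.1 * nsq p.2.
Proof.
move=> l0 m0 lm; apply/eqP; rewrite eq_le; apply/andP.
by split; apply: nsq_le => // g; rewrite lm.
Qed.

Lemma entryD x y g : entry (x + y) g = entry x g + entry y g.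
Proof. by []. Qed.
Lemma entryN x g : entry (- x) g = - entry x g. Proof. by []. Qed.
Lemma entryZ (a : C) x g : entry (a *: x) g = a * entry x g. Proof. by []. Qed.

Lemma parallelogram x y :
  nsq (x + y) + nsq (x - y) = 2 * nsq x + 2 * nsq y.
Proof.
have := @nsq_eq [:: (1, x + y); (1, x - y)] [:: (2, x); (2, y)].
rewrite !big_cons !big_nil/= !mul1r !addr0; apply.
- by rewrite !ler01.
- by rewrite !ler0n.
move=> g; rewrite !big_cons !big_nil/= !mul1r !addr0.
rewrite !sqabsE !entryD entryN; case: (entry x g) => a b; case: (entry y g) => c d /=; ring.
Qed.

Lemma nsqZ (a : C) x : nsq (a *: x) = sqabs a * nsq x.
Proof.
have := @nsq_eq [:: (1, a *: x)] [:: (sqabs a, x)].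
rewrite !big_cons !big_nil/= !mul1r !addr0; apply.
- by rewrite ler01.
- by rewrite sqabs_ge0.
move=> g; rewrite !big_cons !big_nil/= !mul1r !addr0.
by rewrite entryZ /sqabs ComplexField.Normc.normcM exprMn.
Qed.

Lemma normZ (a : C) x : norm (a *: x) = normc a * norm x.
Proof.
apply/eqP; rewrite -(eqrXn2 (n := 2))// ?norm_ge0 ?mulr_ge0 ?norm_ge0//; last first.
  by case: a => *; exact: sqrtr_ge0.
by rewrite exprMn !normE nsqZ.
Qed.

Lemma nsqD_weight (s : R) x y : 0 < s ->
  nsq (x + y) <= (1 + s) * nsq x + (1 + s^-1) * nsq y.
Proof.
move=> s0.
have := @nsq_le [:: (1, x + y)] [:: (1 + s, x); (1 + s^-1, y)].
rewrite !big_cons !big_nil/= !mul1r !addr0; apply.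
- by rewrite ler01.
- by rewrite andbT !addr_ge0// ?invr_ge0 ltW.
move=> g; rewrite !big_cons !big_nil/= !mul1r !addr0.
rewrite !sqabsE !entryD; case: (entry x g) => a b; case: (entry y g) => c d /=.
rewrite -subr_ge0.
have -> : (1 + s) * (a ^+ 2 + b ^+ 2) + (1 + s^-1) * (c ^+ 2 + d ^+ 2) -
   ((a + c) ^+ 2 + (b + d) ^+ 2) =
   s^-1 * ((s * a - c) ^+ 2 + (s * b - d) ^+ 2).
  by field; rewrite gt_eqF.
by rewrite mulr_ge0// ?invr_ge0 ?(ltW s0)// addr_ge0// sqr_ge0.
Qed.

Lemma normD x y : norm (x + y) <= norm x + norm y.
Proof.
have nx := norm_ge0 x; have ny := norm_ge0 y.
rewrite -(ler_pXn2r (n := 2))// ?nnegrE ?norm_ge0 ?addr_ge0//.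
have [y0|y0] := eqVneq (norm y) 0.
  apply/ler_addgt0Pr => e e0.
  have e1 : 0 < e / (norm x ^+ 2 + 1).
    by rewrite divr_gt0// ltr_wpDl// sqr_ge0.
  rewrite normE; apply: le_trans (nsqD_weight _ _ e1) _.
  rewrite -!normE y0 expr0n /= mulr0 !addr0 mulrDl mul1r lerD2l.
  rewrite mulrAC ler_pdivrMr ?ltr_wpDl ?sqr_ge0//.
  by rewrite mulrDr mulr1 mulrC lerDl ltW.
have [x0|x0] := eqVneq (norm x) 0.
  apply/ler_addgt0Pr => e e0.
  have e1 : 0 < e / (norm y ^+ 2 + 1).
    by rewrite divr_gt0// ltr_wpDl// sqr_ge0.
  rewrite normE addrC; apply: le_trans (nsqD_weight _ _ e1) _.
  rewrite -!normE x0 expr0n /= mulr0 !add0r addr0 mulrDl mul1r lerD2l.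
  rewrite mulrAC ler_pdivrMr ?ltr_wpDl ?sqr_ge0//.
  by rewrite mulrDr mulr1 mulrC lerDl ltW.
have xp : 0 < norm x by rewrite lt_def x0.
have yp : 0 < norm y by rewrite lt_def y0.
rewrite normE; apply: le_trans (nsqD_weight _ _ (divr_gt0 yp xp)) _.
rewrite -!normE le_eqVlt; apply/orP; left; apply/eqP.
by field; rewrite x0 y0.
Qed.

Lemma norm0 : norm 0 = 0.
Proof.
by rewrite -(scale0r (0 : H)) normZ ComplexField.Normc.normc0 mul0r.
Qed.

Lemma normN x : norm (- x) = norm x.
Proof.
by rewrite -scaleN1r normZ normcN ComplexField.Normc.normc1 mul1r.
Qed.

Lemma normB x y : norm (x - y) <= norm x + norm y.
Proof. by rewrite -(normN y); exact: normD. Qed.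

Lemma distC x y : norm (x - y) = norm (y - x).
Proof. by rewrite -normN opprB. Qed.

Lemma norm_sum (I : Type) (r : seq I) (F : I -> H) :
  norm (\sum_(i <- r) F i) <= \sum_(i <- r) norm (F i).
Proof.
elim: r => [|i r IH]; first by rewrite !big_nil norm0.
by rewrite !big_cons (le_trans (normD _ _))// lerD2l.
Qed.

Lemma nsq_coords x (s : seq G) : uniq s -> \sum_(g <- s) sqabs (entry x g) <= nsq x.
Proof.
move=> us; rewrite -lee_fin -sqnormE.
have fin : finite_set [set` s] by exact: finite_seq.
apply: esum_ge; exists [set` s] => //.
rewrite -fsbig_seq//= -sumEFin; exact: lexx.
Qed.

End SquareSummable.

(** * Bounded operators and closed ideals *)

Section Operators.
Variables (R : realType) (G : choiceType).
Local Notation C := R[i].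
Local Notation H := (ell2 R G).
Local Notation normc := ComplexField.Normc.normc.
Local Notation norm := (@ell2norm R G).
Implicit Types (x y z : H) (S T : H -> H) (A I J : set (H -> H)).

(** Twice the real part of the inner product, by polarization. *)
Definition dot x y : R := nsq (x + y) - nsq x - nsq y.

Lemma dotC x y : dot x y = dot y x.
Proof. by rewrite /dot [y + x]addrC addrAC. Qed.

Lemma nsqD x y : nsq (x + y) = nsq x + nsq y + dot x y.
Proof. by rewrite /dot; ring. Qed.

Lemma dotDr x y z : dot x (y + z) = dot x y + dot x z.
Proof.
have := @nsq_eq R G [:: (1, x + (y + z)); (1, x); (1, y); (1, z)]
                [:: (1, x + y); (1, x + z); (1, y + z)].
rewrite !big_cons !big_nil/= !mul1r !addr0 !ler01 => /(_ isT isT) h.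
suff : nsq (x + (y + z)) + (nsq x + (nsq y + nsq z)) =
       nsq (x + y) + (nsq (x + z) + nsq (y + z)) by rewrite /dot; lra.
apply: h => g; rewrite !big_cons !big_nil/= !mul1r !addr0.
rewrite !sqabsE !entryD.
case: (entry x g) => a b; case: (entry y g) => c d; case: (entry z g) => e f /=.
ring.
Qed.

Lemma dotNr x y : dot x (- y) = - dot x y.
Proof.
have : dot x (y - y) = dot x y + dot x (- y) by rewrite dotDr.
by rewrite subrr /dot addr0 -[nsq 0]normE norm0; lra.
Qed.

Lemma dotxx x : dot x x = 2 * nsq x.
Proof.
rewrite /dot; have := nsqZ 2 x; rewrite scaler_nat mulr2n => ->.
rewrite sqabsE /=; lra.
Qed.

Lemma dotZ (a : C) x y : dot (a *: x) y = dot x (conjc a *: y).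
Proof.
have := @nsq_eq R G [:: (1, a *: x + y); (1, x); (1, conjc a *: y)]
                [:: (1, x + conjc a *: y); (1, a *: x); (1, y)].
rewrite !big_cons !big_nil/= !mul1r !addr0 !ler01 => /(_ isT isT) h.
suff : nsq (a *: x + y) + (nsq x + nsq (conjc a *: y)) =
       nsq (x + conjc a *: y) + (nsq (a *: x) + nsq y) by rewrite /dot; lra.
apply: h => g; rewrite !big_cons !big_nil/= !mul1r !addr0.
rewrite !sqabsE !entryD !entryZ.
case: (entry x g) => e f; case: (entry y g) => c d; case: a => a b /=.
ring.
Qed.

Lemma dot_le x y : dot x y <= 2 * norm x * norm y.
Proof.
rewrite /dot -!normE.
have : norm (x + y) ^+ 2 <= (norm x + norm y) ^+ 2.
  by rewrite lerXn2r ?nnegrE ?norm_ge0 ?addr_ge0 ?norm_ge0 ?normD.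
by rewrite sqrrD; lra.
Qed.

Definition bounded_by (e : R) S := forall x, norm (S x) <= e * norm x.

Lemma linopD S x y : linear S -> S (x + y) = S x + S y.
Proof. by move=> Sl; rewrite -[x]scale1r Sl !scale1r. Qed.

Lemma linop0 S : linear S -> S 0 = 0.
Proof.
move=> Sl; have := linopD 0 0 Sl; rewrite addr0 => /eqP.
by rewrite -subr_eq subrr => /eqP.
Qed.

Lemma linopZ S a x : linear S -> S (a *: x) = a *: S x.
Proof. by move=> Sl; rewrite -[_ *: x]addr0 Sl linop0// addr0. Qed.

Lemma linopN S x : linear S -> S (- x) = - S x.
Proof. by move=> Sl; rewrite -scaleN1r linopZ// scaleN1r. Qed.

Lemma linopB S x y : linear S -> S (x - y) = S x - S y.
Proof. by move=> Sl; rewrite linopD// linopN. Qed.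

Lemma linop_sum S (J : Type) (r : seq J) (F : J -> H) : linear S ->
  S (\sum_(j <- r) F j) = \sum_(j <- r) S (F j).
Proof.
move=> Sl; elim: r => [|j r IH]; first by rewrite !big_nil linop0.
by rewrite !big_cons linopD// IH.
Qed.

Lemma opD S T x : (S + T) x = S x + T x. Proof. by []. Qed.
Lemma opB S T x : (S - T) x = S x - T x. Proof. by []. Qed.
Lemma opZ (a : C) S x : (a *: S) x = a *: S x. Proof. by []. Qed.
Lemma op_sum (J : Type) (r : seq J) (F : J -> H -> H) x :
  (\sum_(j <- r) F j) x = \sum_(j <- r) F j x.
Proof. by elim: r => [|j r IH]; rewrite ?big_nil// !big_cons opD IH. Qed.

Lemma bounded_by_le e f S : e <= f -> bounded_by e S -> bounded_by f S.
Proof.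
by move=> ef Se x; rewrite (le_trans (Se x))// ler_wpM2r// norm_ge0.
Qed.

Lemma bounded_byD e f S T :
  bounded_by e S -> bounded_by f T -> bounded_by (e + f) (S + T).
Proof.
by move=> Se Tf x; rewrite mulrDl (le_trans (normD _ _))// lerD.
Qed.

Lemma bounded_byZ e (a : C) S :
  bounded_by e S -> bounded_by (normc a * e) (a *: S).
Proof.
move=> Se x; rewrite normZ -mulrA ler_wpM2l//.
by case: a => *; exact: sqrtr_ge0.
Qed.

Lemma bounded_byM e f S T : 0 <= e ->
  bounded_by e S -> bounded_by f T -> bounded_by (e * f) (S \o T).
Proof.
move=> e0 Se Tf x /=; rewrite (le_trans (Se _))// -mulrA ler_wpM2l//.
Qed.

Lemma bounded_byC e S T : bounded_by e (S - T) -> bounded_by e (T - S).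
Proof. by move=> ST x; rewrite distC; exact: ST. Qed.

Lemma bounded_operatorD S T :
  bounded_operator S -> bounded_operator T -> bounded_operator (S + T).
Proof.
move=> [Sl [M SM]] [Tl [N TN]]; split.
  by move=> a x y; rewrite !opD Sl Tl scalerDr addrACA.
by exists (M + N); exact: bounded_byD.
Qed.

Lemma bounded_operatorZ (a : C) S : bounded_operator S -> bounded_operator (a *: S).
Proof.
move=> [Sl [M SM]]; split; last by exists (normc a * M); exact: bounded_byZ.
by move=> b x y; rewrite !opZ Sl scalerDr !scalerA mulrC.
Qed.

Lemma bounded_operatorB S T :
  bounded_operator S -> bounded_operator T -> bounded_operator (S - T).
Proof.
move=> Sb Tb; rewrite -scaleN1r; apply: bounded_operatorD => //.
exact: bounded_operatorZ.
Qed.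

Lemma bounded_operatorM S T :
  bounded_operator S -> bounded_operator T -> bounded_operator (S \o T).
Proof.
move=> [Sl [M SM]] [Tl [N TN]]; split; first by move=> a x y /=; rewrite Tl Sl.
exists (`|M| * N); apply: bounded_byM => //.
exact: bounded_by_le (ler_norm M) SM.
Qed.

Lemma bounded_operator0 : bounded_operator (0 : H -> H).
Proof.
split; first by move=> a x y; rewrite [RHS]addr0 scaler0.
by exists 0 => x; rewrite mul0r norm0.
Qed.

(** The operator norm is a supremum over the unit ball, which controls the other
    vectors by scaling. *)
Lemma opnorm_bounded_by S e :
  bounded_operator S -> opnorm S < e -> bounded_by e S.
Proof.
move=> [Sl [M SM]] Se x.
have ub : has_sup [set norm (S x) | x in [set x | norm x <= 1]].
  split; first by exists (norm (S 0)), 0 => //=; rewrite norm0.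
  exists `|M| => _ [y /= y1 <-]; rewrite (le_trans (SM y))//.
  rewrite (le_trans (y := `|M| * norm y))//.
    by rewrite ler_wpM2r ?norm_ge0 ?ler_norm.
  by rewrite ler_piMr.
have [x0|x0] := eqVneq (norm x) 0.
  by rewrite x0 mulr0; have := SM x; rewrite x0 mulr0.
have xp : 0 < norm x by rewrite lt_def x0 norm_ge0.
have nx : normc ((norm x)^-1)%:C%C = (norm x)^-1.
  by rewrite /= expr0n /= addr0 sqrtr_sqr ger0_norm// invr_ge0 ltW.
set x1 := (norm x)^-1%:C%C *: x.
have Sx1 : norm (S x1) <= opnorm S.
  apply: (ub_le_sup ub.2); exists x1 => //.
  by rewrite /= normZ nx mulVf.
have := le_trans Sx1 (ltW Se).
by rewrite linopZ// normZ nx mulrC ler_pdivrMr.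
Qed.

Lemma opnorm_le S e : 0 <= e -> bounded_by e S -> opnorm S <= e.
Proof.
move=> e0 Se; apply: ge_sup.
  by exists (norm (S 0)), 0 => //=; rewrite norm0.
move=> _ [x /= x1 <-]; rewrite (le_trans (Se x))//.
by rewrite ler_piMr.
Qed.

Lemma norm_closureP A S : A `<=` @bounded_operator R G ->
  norm_closure A S <-> bounded_operator S /\
    forall e, 0 < e -> exists2 T, A T & bounded_by e (S - T).
Proof.
move=> Ab; split=> -[Sb SA]; split=> // e e0.
  have [T AT Te] := SA _ e0; exists T => //; apply: opnorm_bounded_by => //.
  exact: bounded_operatorB (Ab _ AT).
have [|T AT Te] := SA (e / 2); first by rewrite divr_gt0.
exists T => //; apply: le_lt_trans (opnorm_le _ Te) _; first by rewrite divr_ge0// ltW.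
by rewrite ltr_pdivrMr// ltr_pMr// ltr1n.
Qed.

Lemma sub_norm_closure A : A `<=` @bounded_operator R G -> A `<=` norm_closure A.
Proof.
move=> Ab S AS; apply/norm_closureP => //; split; first exact: Ab.
move=> e e0; exists S => // x; rewrite [(S - S) x]subrr norm0.
by rewrite mulr_ge0 ?norm_ge0 ?ltW.
Qed.

Lemma norm_closure_bounded A : norm_closure A `<=` @bounded_operator R G.
Proof. by move=> S []. Qed.

Lemma norm_closure_idem A : A `<=` @bounded_operator R G ->
  norm_closure (norm_closure A) `<=` norm_closure A.
Proof.
move=> Ab S /(norm_closureP _ (@norm_closure_bounded A))[Sb SA].
apply/norm_closureP => //; split=> // e e0.
have e2 : 0 < e / 2 by rewrite divr_gt0.
have [T /(norm_closureP _ Ab)[Tb TA] ST] := SA _ e2.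
have [U AU TU] := TA _ e2; exists U => //.
rewrite (_ : S - U = (S - T) + (T - U)); last by rewrite addrA subrK.
by rewrite [e]splitr; exact: bounded_byD.
Qed.

Lemma norm_closureS A B : A `<=` B -> norm_closure A `<=` norm_closure B.
Proof.
move=> AB S [Sb SA]; split=> // e /SA[T AT Te]; exists T => //; exact: AB.
Qed.

Definition closed_algebra A :=
  [/\ A `<=` @bounded_operator R G, norm_closure A `<=` A, A 0,
      forall (a : C) S T, A S -> A T -> A (a *: S + T) &
      forall S T, A S -> A T -> A (S \o T)].

Definition two_sided_ideal A I :=
  [/\ I `<=` A, I 0, forall (a : C) S T, I S -> I T -> I (a *: S + T) &
      forall S T, A S -> I T -> I (S \o T) /\ I (T \o S)].

Lemma closed_ideal_closure A I : closed_algebra A ->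
  two_sided_ideal A I -> closed_ideal A (norm_closure I).
Proof.
move=> [Ab Acl A0 AD AM] [IA I0 ID IM].
have Ib : I `<=` @bounded_operator R G by move=> S /IA/Ab.
have P S := norm_closureP S Ib.
split.
- by move=> S /(norm_closureS IA)/Acl.
- split; first exact: sub_norm_closure.
  move=> a S T /P[Sb SI] /P[Tb TI]; apply/P; split.
    by apply: bounded_operatorD => //; exact: bounded_operatorZ.
  move=> e e0; have d0 : 0 < e / 2 / (normc a + 1).
    by rewrite !divr_gt0// ltr_wpDl//; case: a => *; exact: sqrtr_ge0.
  have [S' IS' SS'] := SI _ d0.
  have e2 : 0 < e / 2 by rewrite divr_gt0.
  have [T' IT' TT'] := TI _ e2.
  exists (a *: S' + T'); first exact: ID.
  rewrite (_ : _ - _ = a *: (S - S') + (T - T')); last first.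
    by rewrite scalerBr opprD addrACA.
  apply: bounded_by_le (bounded_byD (bounded_byZ a SS') TT').
  rewrite [leRHS]splitr lerD2r mulrA ler_pdivrMr; last first.
    by rewrite ltr_wpDl//; case: (a) => *; exact: sqrtr_ge0.
  by rewrite mulrDr mulr1 mulrC lerDl ltW.
- move=> S T AS /P[Tb TI]; have Sb := Ab _ AS; have [Sl [M SM]] := Sb.
  have M1 : 0 < `|M| + 1 by rewrite ltr_wpDl.
  have SM' : bounded_by (`|M| + 1) S.
    by apply: bounded_by_le SM; rewrite (le_trans (ler_norm _))// lerDl.
  split; apply/P; (split; first exact: bounded_operatorM) => e e0;
    have [T' IT' TT'] := TI _ (divr_gt0 e0 M1).
  + exists (S \o T'); first by have [] := IM _ _ AS IT'.
    rewrite (_ : _ - _ = S \o (T - T')); last first.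
      by apply/funext => x /=; rewrite linopB.
    apply: bounded_by_le (bounded_byM (ltW M1) SM' TT').
    by rewrite mulrC divfK// gt_eqF.
  + exists (T' \o S); first by have [] := IM _ _ AS IT'.
    apply: bounded_by_le (bounded_byM _ TT' SM').
      by rewrite divfK// gt_eqF.
    by rewrite divr_ge0// ltW.
- exact: norm_closure_idem.
Qed.

End Operators.

(** * The reduced algebra of a group *)

Section GroupOperators.
Variables (R : realType) (G : groupType).
Local Notation C := R[i].
Local Notation H := (ell2 R G).
Local Notation normc := ComplexField.Normc.normc.
Local Notation norm := (@ell2norm R G).
Local Notation lam := (@left_regular R G).
Local Notation A := (reduced_Cstar R G).
Implicit Types (x y z : H) (S T : H -> H) (I J : set (H -> H)) (g h k : G).

Lemma normc_ge0 (a : C) : 0 <= normc a.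
Proof. by case: a => *; exact: sqrtr_ge0. Qed.

Lemma normc_real (r : R) : 0 <= r -> normc (r%:C)%C = r.
Proof. by move=> r0; rewrite /= expr0n /= addr0 sqrtr_sqr ger0_norm. Qed.

Lemma ell2_eqP x y : (forall g, entry x g = entry y g) -> x = y.
Proof. by move=> xy; apply/val_inj/funext. Qed.

Lemma entry_lam g x h : entry (lam g x) h = entry x (g^-1 * h)%g.
Proof. by []. Qed.

Lemma linear_lam g : linear (lam g).
Proof. by move=> a x y; apply: ell2_eqP. Qed.

Lemma norm_lam g x : norm (lam g x) = norm x.
Proof. by rewrite /ell2norm sqnorm_translate. Qed.

Lemma nsq_lam g x : nsq (lam g x) = nsq x.
Proof. by rewrite -!normE norm_lam. Qed.

Lemma lamM g h x : lam (g * h)%g x = lam g (lam h x).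
Proof. by apply: ell2_eqP => k; rewrite !entry_lam invgM mulgA. Qed.

Lemma lam1 x : lam 1%g x = x.
Proof. by apply: ell2_eqP => k; rewrite entry_lam invg1 mul1g. Qed.

Lemma lam1E : lam 1%g = id.
Proof. by apply/funext => x; exact: lam1. Qed.

Lemma lamME g h : lam (g * h)%g = lam g \o lam h.
Proof. by apply/funext => x; exact: lamM. Qed.

Lemma lamK g x : lam g^-1%g (lam g x) = x.
Proof. by rewrite -lamM mulVg lam1. Qed.

Lemma dot_lam g x y : dot (lam g x) y = dot x (lam g^-1%g y).
Proof.
rewrite /dot nsq_lam -(nsq_lam g^-1%g (lam g x + y)) nsq_lam.
by rewrite -(nsq_lam g^-1%g (lam g x + y)) (linopD _ _ (linear_lam _)) lamK nsq_lam.
Qed.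

Lemma bounded_by_lam g : bounded_by 1 (lam g).
Proof. by move=> x; rewrite norm_lam mul1r. Qed.

Lemma bounded_operator_lam g : bounded_operator (lam g).
Proof. split; [exact: linear_lam|exists 1; exact: bounded_by_lam]. Qed.

(** ** The group ring *)

(** Elements of the group ring are handled as lists of terms, which need neither
    be sorted nor have distinct supports: products, adjoints and conjugates are
    then computed term by term. *)
Definition gr (l : seq (C * G)) : H -> H := \sum_(p <- l) p.1 *: lam p.2.

Lemma grE l x : gr l x = \sum_(p <- l) p.1 *: lam p.2 x.
Proof. by rewrite /gr op_sum. Qed.

Lemma gr_nil : gr [::] = 0.
Proof. by rewrite /gr big_nil. Qed.

Lemma gr_cons p l : gr (p :: l) = p.1 *: lam p.2 + gr l.
Proof. by rewrite /gr big_cons. Qed.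

Lemma gr_cat l m : gr (l ++ m) = gr l + gr m.
Proof. by rewrite /gr big_cat. Qed.

Lemma gr_lam g : gr [:: (1, g)] = lam g.
Proof. by rewrite gr_cons gr_nil addr0 scale1r. Qed.

Lemma gr_scale (a : C) l : gr [seq (a * p.1, p.2) | p <- l] = a *: gr l.
Proof. by rewrite /gr big_map scaler_sumr; apply: eq_bigr => p _; rewrite scalerA. Qed.

Lemma bounded_operator_gr l : bounded_operator (gr l).
Proof.
elim: l => [|p l IH]; first by rewrite gr_nil; exact: bounded_operator0.
rewrite gr_cons; apply: bounded_operatorD => //.
by apply: bounded_operatorZ; exact: bounded_operator_lam.
Qed.

Lemma linear_gr l : linear (gr l).
Proof. by have [] := bounded_operator_gr l. Qed.

Definition grmul (l m : seq (C * G)) : seq (C * G) :=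
  [seq (p.1 * q.1, (p.2 * q.2)%g) | p <- l, q <- m].

Lemma grM l m : gr (grmul l m) = gr l \o gr m.
Proof.
apply/funext => x; rewrite /= !grE.
rewrite big_allpairs_dep /=; apply: eq_bigr => p _.
rewrite linop_sum; last exact: linear_lam.
rewrite scaler_sumr; apply: eq_bigr => q _.
by rewrite linopZ ?scalerA ?lamM//; exact: linear_lam.
Qed.

Definition gradj (l : seq (C * G)) : seq (C * G) :=
  [seq (conjc p.1, p.2^-1%g) | p <- l].

Lemma dotDl x y z : dot (x + y) z = dot x z + dot y z.
Proof. by rewrite dotC dotDr !(dotC z). Qed.

Lemma dot_gr l x y : dot (gr l x) y = dot x (gr (gradj l) y).
Proof.
rewrite !grE big_map; elim: l => [|p l IH].
  by rewrite !big_nil /dot add0r addr0 -(normE 0) norm0; lra.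
by rewrite !big_cons dotDl dotDr IH dotZ dot_lam (linopZ _ _ (linear_lam _)).
Qed.

Lemma gradjK l : gradj (gradj l) = l.
Proof.
rewrite /gradj -map_comp -[RHS]map_id; apply: eq_map => -[c g] /=.
by rewrite conjcK invgK.
Qed.

Lemma reduced_group_ringP S : reduced_group_ring S <-> exists l, S = gr l.
Proof.
split=> [[n [c [g ->]]]|[l ->]].
  exists [seq (c i, g i) | i <- enum 'I_n].
  by rewrite /gr big_map big_enum.
exists (size l), (fun i => (nth (0, 1%g) l i).1), (fun i => (nth (0, 1%g) l i).2).
by rewrite /gr (big_nth (0, 1%g)) big_mkord.
Qed.

Lemma group_ring_bounded : @reduced_group_ring R G `<=` @bounded_operator R G.
Proof. by move=> S /reduced_group_ringP[l ->]; exact: bounded_operator_gr. Qed.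

Lemma reduced_CstarP S : A S <-> bounded_operator S /\
  forall e, 0 < e -> exists l, bounded_by e (S - gr l).
Proof.
rewrite /reduced_Cstar; split.
  move=> /(norm_closureP _ group_ring_bounded)[Sb SA]; split=> // e /SA[T].
  by move=> /reduced_group_ringP[l ->]; exists l.
move=> [Sb SA]; apply/(norm_closureP _ group_ring_bounded); split=> // e /SA[l Sl].
by exists (gr l) => //; apply/reduced_group_ringP; exists l.
Qed.

Lemma reduced_Cstar_bounded S : A S -> bounded_operator S.
Proof. by move=> /reduced_CstarP[]. Qed.

Lemma reduced_Cstar_linear S : A S -> linear S.
Proof. by move=> /reduced_Cstar_bounded[]. Qed.

Lemma reduced_Cstar_gr l : A (gr l).
Proof.
apply/reduced_CstarP; split; first exact: bounded_operator_gr.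
move=> e e0; exists l => x; rewrite opB subrr norm0.
by rewrite mulr_ge0 ?norm_ge0 ?ltW.
Qed.

Lemma reduced_Cstar_lam g : A (lam g).
Proof. by rewrite -gr_lam; exact: reduced_Cstar_gr. Qed.

Lemma reduced_Cstar_id : A id.
Proof. by rewrite -lam1E; exact: reduced_Cstar_lam. Qed.

Lemma reduced_CstarM S T : A S -> A T -> A (S \o T).
Proof.
move=> /reduced_CstarP[Sb SA] /reduced_CstarP[Tb TA]; apply/reduced_CstarP.
split; first exact: bounded_operatorM.
move=> e e0; have [Sl [M SM]] := Sb.
have M0 : 0 < `|M| + 1 by rewrite ltr_wpDl.
have SM' : bounded_by (`|M| + 1) S.
  by apply: bounded_by_le SM; rewrite (le_trans (ler_norm _))// lerDl.
have e2 : 0 < e / 2 by rewrite divr_gt0.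
have [m Tm] := TA _ (divr_gt0 e2 M0).
have [_ [N mN]] := bounded_operator_gr m.
have N0 : 0 < `|N| + 1 by rewrite ltr_wpDl.
have mN' : bounded_by (`|N| + 1) (gr m).
  by apply: bounded_by_le mN; rewrite (le_trans (ler_norm _))// lerDl.
have [l Sl'] := SA _ (divr_gt0 e2 N0).
exists (grmul l m); rewrite grM.
rewrite (_ : _ - _ = (S \o (T - gr m)) + ((S - gr l) \o gr m)); last first.
  apply/funext => x; rewrite opB opD /= !opB (linopB _ _ Sl).
  by rewrite addrA subrK.
have := bounded_byD (bounded_byM (ltW M0) SM' Tm)
                    (bounded_byM (ltW (divr_gt0 e2 N0)) Sl' mN').
apply: bounded_by_le; rewrite [leRHS]splitr.
by rewrite divfK ?gt_eqF// mulrC divfK// gt_eqF.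
Qed.

Lemma reduced_Cstar_algebra : closed_algebra A.
Proof.
split.
- exact: reduced_Cstar_bounded.
- by apply: norm_closure_idem; exact: group_ring_bounded.
- by rewrite -gr_nil; exact: reduced_Cstar_gr.
- move=> a S T /reduced_CstarP[Sb SA] /reduced_CstarP[Tb TA]; apply/reduced_CstarP.
  split; first by apply: bounded_operatorD => //; exact: bounded_operatorZ.
  move=> e e0; have a0 : 0 < normc a + 1 by rewrite ltr_wpDl// normc_ge0.
  have e2 : 0 < e / 2 by rewrite divr_gt0.
  have [l Sl] := SA _ (divr_gt0 e2 a0); have [m Tm] := TA _ e2.
  exists ([seq (a * p.1, p.2) | p <- l] ++ m); rewrite gr_cat gr_scale.
  rewrite (_ : _ - _ = a *: (S - gr l) + (T - gr m)); last first.
    by rewrite scalerBr opprD addrACA.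
  apply: bounded_by_le (bounded_byD (bounded_byZ a Sl) Tm).
  rewrite [leRHS]splitr lerD2r mulrA ler_pdivrMr//.
  by rewrite mulrDr mulr1 mulrC lerDl ltW.
- exact: reduced_CstarM.
Qed.

(** ** Distance to an ideal *)

(** Bounds on the norm in the quotient by I, without the quotient algebra. *)
Definition near_ideal I S (e : R) := exists2 T, I T & bounded_by e (S - T).

Section Ideal.
Variables (I : set (H -> H)) (Iid : closed_ideal A I).

Lemma ideal_sub S : I S -> A S.
Proof. by have [IA _ _ _] := Iid; exact: IA. Qed.

Lemma in_ideal0 : I 0. Proof. by have [_ []] := Iid. Qed.

Lemma ideal_comb (a : C) S T : I S -> I T -> I (a *: S + T).
Proof. by have [_ [_ +] _ _] := Iid; apply. Qed.

Lemma in_idealD S T : I S -> I T -> I (S + T).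
Proof. by move=> IS; rewrite -[S]scale1r; exact: ideal_comb. Qed.

Lemma in_idealZ (a : C) S : I S -> I (a *: S).
Proof. by move=> IS; rewrite -[_ *: _]addr0; apply: ideal_comb => //; exact: in_ideal0. Qed.

Lemma in_idealN S : I S -> I (- S).
Proof. by rewrite -scaleN1r; exact: in_idealZ. Qed.

Lemma in_idealMl S T : A S -> I T -> I (S \o T).
Proof. by move=> AS IT; have [_ _ /(_ S T AS IT)[]] := Iid. Qed.

Lemma in_idealMr S T : A S -> I T -> I (T \o S).
Proof. by move=> AS IT; have [_ _ /(_ S T AS IT)[]] := Iid. Qed.

Lemma near_ideal_le e f S : e <= f -> near_ideal I S e -> near_ideal I S f.
Proof. by move=> ef [T IT Se]; exists T => //; exact: bounded_by_le Se. Qed.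

Lemma near_ideal_bounded e S : bounded_by e S -> near_ideal I S e.
Proof. by exists 0; [exact: in_ideal0|rewrite subr0]. Qed.

Lemma near_idealD e f S T :
  near_ideal I S e -> near_ideal I T f -> near_ideal I (S + T) (e + f).
Proof.
move=> [S' IS Se] [T' IT Tf]; exists (S' + T'); first exact: in_idealD.
by rewrite opprD addrACA; exact: bounded_byD.
Qed.

Lemma near_idealZ e (a : C) S :
  near_ideal I S e -> near_ideal I (a *: S) (normc a * e).
Proof.
move=> [S' IS Se]; exists (a *: S'); first exact: in_idealZ.
by rewrite -scalerBr; exact: bounded_byZ.
Qed.

Lemma near_ideal_sum (Q : eqType) (r : seq Q) (F : Q -> H -> H) (e : Q -> R) :
  (forall q, q \in r -> near_ideal I (F q) (e q)) ->
  near_ideal I (\sum_(q <- r) F q) (\sum_(q <- r) e q).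
Proof.
elim: r => [_|k r IH Fe].
  rewrite !big_nil; apply: near_ideal_bounded => x.
  by rewrite mul0r norm0.
rewrite !big_cons; apply: near_idealD.
  by apply: Fe; rewrite mem_head.
by apply: IH => j jr; apply: Fe; rewrite in_cons jr orbT.
Qed.

Lemma near_idealM e f S T : A S -> A T -> 0 <= e ->
  near_ideal I S e -> near_ideal I T f -> near_ideal I (S \o T) (e * f).
Proof.
move=> AS AT e0 [S' IS Se] [T' IT Tf].
have [Sl S'l] := (reduced_Cstar_linear AS, reduced_Cstar_linear (ideal_sub IS)).
have ASS' : A (S - S').
  have [_ _ _ AD _] := reduced_Cstar_algebra.
  by rewrite addrC -scaleN1r; exact: AD (ideal_sub IS) AS.
exists ((S' \o T) + ((S - S') \o T')).
  exact: in_idealD (in_idealMr AT IS) (in_idealMl ASS' IT).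
rewrite (_ : _ - _ = (S - S') \o (T - T')); first exact: bounded_byM.
apply/funext => x; rewrite !(opB, opD) /= !opB !(linopB _ _ Sl) !(linopB _ _ S'l).
by rewrite !opprD !opprK !addrA; congr (_ + _); rewrite addrAC.
Qed.

Lemma ideal_properP : I <> A <-> ~ I id.
Proof.
split=> [IA I1|I1 IA]; last by apply: I1; rewrite IA; exact: reduced_Cstar_id.
apply: IA; apply/seteqP; split=> S; first exact: ideal_sub.
by move=> AS; exact: (in_idealMl AS I1).
Qed.

Lemma ideal_closed S : A S -> (forall e, 0 < e -> near_ideal I S e) -> I S.
Proof.
move=> AS Se; have [IA _ _ Icl] := Iid; apply: Icl.
apply/norm_closureP; first by move=> T /IA; exact: reduced_Cstar_bounded.
split; first exact: reduced_Cstar_bounded.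
by move=> e /Se[T IT ST]; exists T.
Qed.

(** The quotient norm of the unit is at most its own square, so that it vanishes
    as soon as it is less than 1. *)
Lemma near_ideal_id e : e < 1 -> near_ideal I id e -> I id.
Proof.
move=> e1 Ie; have e0 : 0 <= `|e| by [].
wlog : e e1 e0 Ie / 0 <= e.
  move=> wl; have [e0'|/ltW e0'] := leP 0 e; first exact: (wl e).
  apply: (wl 0) => //; exact: near_ideal_le Ie.
move=> {}e0; have pow n : near_ideal I id (e ^+ n).
  elim: n => [|n IH].
    by apply: near_ideal_bounded => x; rewrite expr0 mul1r.
  by rewrite exprS; apply: (near_idealM (S := id) (T := id)) => //; exact: reduced_Cstar_id.
apply: ideal_closed; first exact: reduced_Cstar_id.
move=> d d0.
have /cvgrPdist_lt/(_ d d0)[n _ /(_ n (leqnn n))] : (fun n => e ^+ n) @ \oo --> 0.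
  by apply: cvg_expr; rewrite ger0_norm.
rewrite sub0r normrN ger0_norm ?exprn_ge0// => nd.
exact: near_ideal_le (ltW nd) (pow n).
Qed.

End Ideal.

(** ** Averages *)

Definition avg (ks : seq G) (F : G -> H -> H) : H -> H :=
  ((size ks)%:R^-1 : R)%:C%C *: \sum_(k <- ks) F k.

Lemma avgE ks F x : avg ks F x = ((size ks)%:R^-1 : R)%:C%C *: \sum_(k <- ks) F k x.
Proof. by rewrite /avg opZ op_sum. Qed.

Lemma near_avg I ks F e : closed_ideal A I -> ks != [::] ->
  (forall k, k \in ks -> near_ideal I (F k) e) -> near_ideal I (avg ks F) e.
Proof.
move=> Iid ks0 Fe.
have := near_idealZ Iid ((size ks)%:R^-1 : R)%:C%C (near_ideal_sum Iid Fe).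
rewrite normc_real ?invr_ge0// big_const_seq count_predT iter_addr addr0.
rewrite -[e *+ _]mulr_natl.
by rewrite mulKf// pnatr_eq0 size_eq0.
Qed.

Definition conj_op (p : G) (S : H -> H) : H -> H := lam p \o S \o lam p^-1%g.

Lemma conj_op_lam p g : conj_op p (lam g) = lam (p * g * p^-1)%g.
Proof. by rewrite !lamME. Qed.

Lemma conj_op_gr p l :
  conj_op p (gr l) = gr [seq (q.1, (p * q.2 * p^-1)%g) | q <- l].
Proof.
apply/funext => x; rewrite /conj_op /= !grE big_map.
rewrite linop_sum; last exact: linear_lam.
by apply: eq_bigr => q _; rewrite !lamM (linopZ _ _ (linear_lam _)).
Qed.

Lemma near_conj I p S e : closed_ideal A I -> A S ->
  near_ideal I S e -> near_ideal I (conj_op p S) e.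
Proof.
move=> Iid AS [T IT ST]; exists (conj_op p T).
  exact: (in_idealMr Iid (reduced_Cstar_lam p^-1%g) (in_idealMl Iid (reduced_Cstar_lam p) IT)).
move=> x; rewrite opB /conj_op /= -(linopB _ _ (linear_lam p)) norm_lam.
by have := ST (lam p^-1%g x); rewrite norm_lam.
Qed.

End GroupOperators.

(** * Vectors almost annihilated by an ideal *)

Section ApproximateVectors.
Variables (R : realType) (G : groupType).
Local Notation C := R[i].
Local Notation H := (ell2 R G).
Local Notation normc := ComplexField.Normc.normc.
Local Notation norm := (@ell2norm R G).
Local Notation lam := (@left_regular R G).
Local Notation A := (reduced_Cstar R G).
Implicit Types (x y z : H) (S T : H -> H) (I J : set (H -> H)) (g h k : G).

Lemma gradj_contraction l :
  bounded_by 1 (gr l : H -> H) -> bounded_by 1 (gr (gradj l) : H -> H).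
Proof.
move=> l1 z; rewrite mul1r; set u := gr _ z.
have nu := norm_ge0 u; have [->|u0] := eqVneq (norm u) 0; first exact: norm_ge0.
have : 2 * nsq u <= 2 * norm u * norm z.
  rewrite -dotxx {2}/u -dot_gr; apply: le_trans (dot_le _ _) _.
  rewrite ler_wpM2r ?norm_ge0// ler_wpM2l//.
  by have := l1 u; rewrite mul1r.
by rewrite -normE expr2 mulrA ler_pM2l// mulr_gt0// lt_def u0.
Qed.

(** The operator 1 - b^* b, for b = gr l.  When b is a contraction, the
    powers of this operator tend to the projection onto the kernel of b. *)
Definition damp (l : seq (C * G)) x : H := x - gr (gradj l) (gr l x).

Lemma linear_damp l : linear (damp l).
Proof.
move=> a x y; rewrite /damp !linear_gr scalerBr opprD addrACA //.
Qed.

Lemma nsq_damp l x : bounded_by 1 (gr l : H -> H) ->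
  nsq (damp l x) <= nsq x - nsq (gr l x).
Proof.
move=> l1; rewrite /damp nsqD dotNr -dot_gr dotxx.
have : nsq (- gr (gradj l) (gr l x)) <= nsq (gr l x).
  rewrite -!normE normN lerXn2r ?nnegrE ?norm_ge0//.
  by have := gradj_contraction l1 (gr l x); rewrite mul1r.
lra.
Qed.

Lemma norm_damp l x : bounded_by 1 (gr l : H -> H) -> norm (damp l x) <= norm x.
Proof.
move=> l1; rewrite -(ler_pXn2r (n := 2))// ?nnegrE ?norm_ge0// !normE.
by have := nsq_damp x l1; have := nsq_ge0 (gr l x); lra.
Qed.

Lemma damp_decreasing l x : bounded_by 1 (gr l : H -> H) ->
  nsq (gr l (damp l x)) <= nsq (gr l x).
Proof.
move=> l1; have -> : gr l (damp l x) = damp (gradj l) (gr l x).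
  by rewrite /damp gradjK linopB//; exact: linear_gr.
by rewrite -!normE lerXn2r ?nnegrE ?norm_ge0// norm_damp//; exact: gradj_contraction.
Qed.

(** Each step lowers the squared norm of the vector by at least that of its image
    under b, and the squared norms of these images decrease along the iteration. *)
Lemma iter_damp l x n : bounded_by 1 (gr l : H -> H) ->
  n.+1%:R * nsq (gr l (iter n (damp l) x)) <= nsq x.
Proof.
move=> l1; suff : n.+1%:R * nsq (gr l (iter n (damp l) x)) <=
    nsq x - nsq (iter n.+1 (damp l) x).
  by have := nsq_ge0 (iter n.+1 (damp l) x); lra.
elim: n => [|n IH].
  by rewrite mul1r /=; have := nsq_damp x l1; lra.
have h1 := damp_decreasing (iter n (damp l) x) l1.
have h2 := nsq_damp (iter n.+1 (damp l) x) l1.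
have -> : n.+2%:R = n.+1%:R + 1 :> R by rewrite -[n.+2]addn1 natrD.
rewrite mulrDl mul1r.
have : n.+1%:R * nsq (gr l (iter n.+1 (damp l) x)) <=
       n.+1%:R * nsq (gr l (iter n (damp l) x)) by rewrite ler_wpM2l.
move: h2 IH; rewrite !iterS.
set u := nsq (gr l (damp _ _)); set v := nsq (gr l (iter _ _ _)).
set a := n.+1%:R * u; set b := n.+1%:R * v; lra.
Qed.

Lemma iter_close (e : R) (V W : H -> H) x n : linear V ->
  0 <= e <= 1 -> norm x <= 1 -> (forall z, norm (V z) <= norm z) ->
  (forall z, norm (W z - V z) <= e * norm z) ->
  norm (iter n W x - iter n V x) <= (2 ^+ n - 1) * e.
Proof.
move=> Vl /andP[e0 e1] x1 V1 WV; elim: n => [|n IH].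
  by rewrite /= !subrr norm0 mul0r.
rewrite !iterS; set w := iter n W x in IH *; set v := iter n V x in IH *.
have -> : W w - V v = (W w - V w) + V (w - v) by rewrite linopB// addrA subrK.
have v1 : norm v <= 1.
  by rewrite /v; elim: (n) => //= j IHj; exact: le_trans (V1 _) IHj.
have h1 := normD (W w - V w) (V (w - v)).
have h2 := WV w; have h3 := V1 (w - v).
have h4 : norm w <= 1 + norm (w - v).
  by rewrite -{1}(subrK v w) (le_trans (normD _ _))// addrC lerD2r.
have h5 := norm_ge0 (w - v).
have h6 : e * norm w <= e * (1 + norm (w - v)) by rewrite ler_wpM2l.
have h7 : e * norm (w - v) <= norm (w - v) by rewrite ler_piMl.
by rewrite exprS; lra.
Qed.

(** An operator m that stays away from a closed ideal I has almost norming
    vectors that are almost annihilated by any given b in I, as in a faithful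
    representation of the quotient by I.  They are obtained by applying large
    powers of 1 - b^* b, which are congruent to 1 modulo I; since only the
    elements of the group ring come with an explicit adjoint, b^* is replaced
    by the adjoint of an approximation of b. *)
Lemma approximate_vector I S m (d eta : R) : closed_ideal A I -> I S -> A m ->
  ~ near_ideal I m (1 - d) -> 0 < eta ->
  exists y, [/\ norm y <= 1 + eta, 1 - d <= norm (m y) & norm (S y) <= eta].
Proof.
move=> Iid IS Am mI eta0.
have AS := ideal_sub Iid IS; have /reduced_CstarP[[Sl [M SM]] _] := AS.
have [ml [M' mM']] := reduced_Cstar_bounded Am.
pose s : R := (2 * (`|M| + 1))^-1.
have M1 : 0 < `|M| + 1 by rewrite ltr_wpDl.
have s0 : 0 < s by rewrite invr_gt0 mulr_gt0.
pose b := (s%:C)%C *: S.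
have Ib : I b by exact: in_idealZ.
have Ab := ideal_sub Iid Ib; have /reduced_CstarP[[bl _] bA] := Ab.
have normb z : norm (b z) = s * norm (S z) by rewrite /b opZ normZ normc_real ?ltW.
have b12 : bounded_by 2^-1 b.
  move=> z; rewrite normb; apply: le_trans (ler_wpM2l (ltW s0) (SM z)) _.
  rewrite mulrA ler_wpM2r ?norm_ge0// /s invfM -mulrA ler_piMr ?invr_ge0//.
  by rewrite mulrC ler_pdivrMr// mul1r (le_trans (ler_norm _))// lerDl.
pose tau : R := Num.min 2^-1 (Num.min eta (s * eta / 6)).
have tau0 : 0 < tau.
  by rewrite /tau !lt_min eta0 invr_gt0 ltr0n /= !(mulr_gt0, invr_gt0).
have [tau1 tau2 tau3] : [/\ tau <= 2^-1, tau <= eta & tau <= s * eta / 6].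
  by rewrite /tau; split; rewrite !ge_min lexx ?orbT.
have [N hN] : exists N, (s * eta / 3) ^- 2 <= N.+1%:R.
  exists (Num.bound ((s * eta / 3) ^- 2)); apply: ltW.
  apply: lt_le_trans (archi_boundP _) _; first by rewrite invr_ge0 sqr_ge0.
  by rewrite ler_nat.
have eps0 : 0 < tau / 2 ^+ N by rewrite divr_gt0// exprn_gt0.
have epstau : tau / 2 ^+ N <= tau.
  rewrite ler_pdivrMr ?exprn_gt0// ler_peMr ?(ltW tau0)//.
  by apply: exprn_ege1; rewrite ler1n.
have [l bL] := bA _ eps0; set eps := tau / 2 ^+ N in eps0 epstau bL.
have l1 : bounded_by 1 (gr l : H -> H).
  move=> z; rewrite mul1r -[gr l z](subKr (b z)).
  rewrite (le_trans (normB _ _))//.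
  have := bL z; have := b12 z; rewrite opB => h1 h2.
  have := norm_ge0 z => h3.
  have h4 : eps * norm z <= 2^-1 * norm z.
    by rewrite ler_wpM2r// (le_trans epstau).
  lra.
pose W z := z - gr (gradj l) (b z).
have WV z : norm (W z - damp l z) <= eps * norm z.
  rewrite /W /damp opprB addrC addrA subrK -(linopB _ _ (linear_gr _)).
  have := gradj_contraction l1 (gr l z - b z); rewrite mul1r => h.
  by rewrite (le_trans h)// distC; exact: bL.
pose r := iter N W.
have Wl : linear W.
  move=> a u v; rewrite /W bl linear_gr scalerBr opprD addrACA //.
have Ir n : A (iter n W) /\ I (iter n W - id).
  elim: n => [|n [IHA IHI]].
    have -> : iter 0 W = id by [].
    by split; [exact: reduced_Cstar_id|rewrite subrr; exact: in_ideal0 Iid].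
  have IW : I (W - id).
    rewrite (_ : W - id = - (gr (gradj l) \o b)).
      exact: (in_idealN Iid (in_idealMl Iid (reduced_Cstar_gr (gradj l)) Ib)).
    by apply/funext => z; rewrite opB /W addrC addrA addNr add0r.
  have AW : A W.
    rewrite -(subrK id W); have [_ _ _ AD _] := reduced_Cstar_algebra R G.
    rewrite -[W - id]scale1r; exact: AD (ideal_sub Iid IW) (@reduced_Cstar_id R G).
  have -> : iter n.+1 W = W \o iter n W by apply/funext.
  split; first exact: reduced_CstarM AW IHA.
  rewrite (_ : _ - id = ((W - id) \o iter n W) + (iter n W - id)).
    exact (in_idealD Iid (in_idealMr Iid IHA IW) IHI).
  by apply/funext => z; rewrite opD !opB /= opB addrA subrK.
have [Ar Irid] := Ir N; have rl := reduced_Cstar_linear Ar.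
have close x : norm x <= 1 -> norm (r x - iter N (damp l) x) <= tau.
  move=> x1; apply: le_trans (iter_close (e := eps) _ _ _ x1 _ _) _ => //.
  - exact: linear_damp.
  - rewrite (ltW eps0) (le_trans epstau)// (le_trans tau1)//.
    by rewrite invf_le1// ler1n.
  - by move=> z; exact: norm_damp.
  rewrite mulrBl mul1r /eps [_ * (_ / _)]mulrC divfK ?gt_eqF ?exprn_gt0//.
  by rewrite gerBl ltW.
have r1 x : norm x <= 1 -> norm (r x) <= 1 + tau.
  move=> x1; rewrite -(subrK (iter N (damp l) x) (r x)).
  apply: le_trans (normD _ _) _; rewrite addrC; apply: lerD; last exact: close.
  by elim: (N) => //= j IHj; exact: le_trans (norm_damp _ l1) IHj.
have [x x1 mx] : exists2 x, norm x = 1 & 1 - d < norm (m (r x)).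
  have : ~ bounded_by (1 - d) (m \o r).
    move=> mr; apply: mI; exists (- (m \o (r - id))).
      exact (in_idealN Iid (in_idealMl Iid Am Irid)).
    rewrite opprK (_ : m + _ = m \o r)//.
    by apply/funext => z; rewrite opD /= opB linopB// addrC subrK.
  move=> /existsNP[x /negP]; rewrite -ltNge => mx.
  have [x0|x0] := eqVneq (norm x) 0.
    have x1 : x = 0.
      apply: ell2_eqP => g; have := @nsq_coords R G x [:: g] isT.
      rewrite big_cons big_nil addr0 -normE x0 expr0n /= => h.
      apply: ComplexField.Normc.eq0_normc; apply/eqP; rewrite -sqrf_eq0.
      by rewrite eq_le h sqr_ge0.
    have rx : r x = 0 by rewrite x1; exact: linop0.
    have mrx : (m \o r) x = 0 by rewrite -(linop0 ml) -rx.
    by move: mx; rewrite mrx x0 norm0 mulr0 ltxx.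
  have xp : 0 < norm x by rewrite lt_def x0 norm_ge0.
  exists (((norm x)^-1)%:C%C *: x).
    by rewrite normZ normc_real ?invr_ge0 ?norm_ge0// mulVf.
  rewrite linopZ// linopZ// normZ normc_real ?invr_ge0 ?norm_ge0//.
  by rewrite mulrC ltr_pdivlMr.
have x1' : norm x <= 1 by rewrite x1.
exists (r x); split; [|exact: ltW|].
  by rewrite (le_trans (r1 _ x1'))// lerD2l.
rewrite -(ler_pM2l s0) -normb.
set y := r x in mx *; set v := iter N (damp l) x.
have -> : b y = (b y - gr l y) + (gr l (y - v) + gr l v).
  by rewrite (linopB _ _ (linear_gr l)) !subrK.
have h1 : norm (b y - gr l y) <= eps * norm y := bL y.
have h2 : norm (gr l (y - v)) <= norm (y - v) by have := l1 (y - v); rewrite mul1r.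
have h3 : norm (y - v) <= tau := close _ x1'.
have h4 : norm (gr l v) <= s * eta / 3.
  rewrite -(ler_pXn2r (n := 2))// ?nnegrE ?norm_ge0//; last first.
    by apply/ltW; rewrite divr_gt0// mulr_gt0.
  have q0 : 0 < (s * eta / 3) ^+ 2 by rewrite exprn_gt0// divr_gt0// mulr_gt0.
  have := iter_damp x N l1; rewrite -/v -(normE x) x1 expr1n normE => h.
  have := le_trans (ler_wpM2r (nsq_ge0 (gr l v)) hN) h.
  by rewrite ler_pdivrMl// mulr1.
have h5 : norm y <= 1 + tau := r1 _ x1'.
have h6 : eps * norm y <= tau * (3 / 2).
  have tau32 : norm y <= 3 / 2 by lra.
  by rewrite ler_pM ?norm_ge0 ?(ltW eps0).
have := normD (b y - gr l y) (gr l (y - v) + gr l v).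
have := normD (gr l (y - v)) (gr l v).
by lra.
Qed.

(** Uniform convexity, from the parallelogram law: if an average of unit vectors
    has norm almost 1, then so has the average of any two of them. *)
Lemma almost_equal (y : H) (vs : seq H) v (eta : R) : v \in vs ->
  0 <= eta <= 1 -> (forall u, u \in y :: vs -> norm u <= 1 + eta) ->
  (size vs).+1%:R * eta <= 1 ->
  (size vs).+1%:R * (1 - eta) <= norm (y + \sum_(u <- vs) u) ->
  nsq (y - v) <= 20 * (size vs).+1%:R * eta.
Proof.
move=> vvs /andP[eta0 eta1] vs1 neta; rewrite (big_rem v)//= addrA => h.
have h1 : norm (\sum_(u <- rem v vs) u) <= (size vs).-1%:R * (1 + eta).
  apply: le_trans (norm_sum _ _) _; rewrite -(size_rem vvs).
  rewrite big_seq; apply: le_trans (_ : _ <= \sum_(u <- rem v vs | u \in rem v vs) (1 + eta)) _.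
    apply: ler_sum => u /mem_rem uvs.
    by apply: vs1; rewrite in_cons uvs orbT.
  by rewrite -big_seq big_const_seq count_predT iter_addr addr0 mulr_natl.
have := normD (y + v) (\sum_(u <- rem v vs) u) => h2.
have sv : (0 < size vs)%N by case: (vs) vvs.
move: h h1 neta; rewrite -(prednK sv) /=; set n := (size vs).-1 => h h1 neta.
have n2 : n.+2%:R = n%:R + 2 :> R by rewrite -addn2 natrD.
rewrite n2 in h neta *.
have n0 : 0 <= n%:R :> R by [].
have h3 : 2 - 2 * ((n%:R + 2) * eta) <= norm (y + v) by nra.
have h4 : (2 - 2 * ((n%:R + 2) * eta)) ^+ 2 <= nsq (y + v).
  rewrite -normE lerXn2r ?nnegrE ?norm_ge0//; lra.
have hb u : u \in y :: vs -> nsq u <= (1 + eta) ^+ 2.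
  move=> /vs1 u1; rewrite -normE lerXn2r ?nnegrE ?norm_ge0 ?addr_ge0//.
have := hb y (mem_head _ _); have := hb v; rewrite in_cons vvs orbT => /(_ isT).
have := parallelogram y v.
rewrite -[20 * _ * _]mulrA.
set t := (n%:R + 2) * eta in h3 h4 neta *.
have ht : 2 * eta <= t by rewrite /t mulrDl; nra.
have eta2 : eta ^+ 2 <= eta by rewrite expr2 ler_piMr.
have t2 := sqr_ge0 t; move: h4; rewrite !sqrrD sqrrN exprMn.
by lra.
Qed.

End ApproximateVectors.

(** * Coefficients and ping-pong *)

Section Coefficients.
Variables (R : realType) (G : groupType).
Local Notation C := R[i].
Local Notation H := (ell2 R G).
Local Notation normc := ComplexField.Normc.normc.
Local Notation norm := (@ell2norm R G).
Local Notation lam := (@left_regular R G).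
Local Notation A := (reduced_Cstar R G).
Implicit Types (x y z : H) (S T : H -> H) (g h k : G).

Definition delta_fun : G -> C := fun g => (g == 1%g)%:R.

Lemma sqnorm_delta : sqnorm delta_fun = 1%E.
Proof.
rewrite /sqnorm -[RHS](@esum_set1 R G 1%g (fun=> 1%E)) ?lee01//.
rewrite [RHS]esum_mkcond; apply: eq_esum => g _.
have -> : (g \in [set 1%g]) = (g == 1%g) by apply/idP/eqP; rewrite inE.
rewrite /delta_fun; case: (g =P 1%g) => _.
  by rewrite ComplexField.Normc.normc1 expr1n.
by rewrite ComplexField.Normc.normc0 expr0n.
Qed.

Lemma delta_in : in_ell2 delta_fun.
Proof. by apply/in_ell2P; rewrite sqnorm_delta ltry. Qed.

Definition delta : H := exist _ delta_fun delta_in.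

Lemma norm_delta : norm delta = 1.
Proof. by rewrite /ell2norm sqnorm_delta /= sqrtr1. Qed.

Lemma entry_gr l x h :
  entry (gr l x) h = \sum_(p <- l) p.1 * entry x (p.2^-1 * h)%g.
Proof.
elim: l => [|p l IH]; first by rewrite gr_nil big_nil.
by rewrite gr_cons big_cons opD entryD IH opZ entryZ.
Qed.

Lemma entry_gr_delta l g :
  entry (gr l delta) g = \sum_(p <- l | p.2 == g) p.1.
Proof.
rewrite entry_gr [RHS]big_mkcond; apply: eq_bigr => -[c h] _ /=.
rewrite /entry /= /delta_fun -(inj_eq (mulgI h)) mulVKg mulg1 eq_sym.
by case: eqP => _; rewrite ?mulr1 ?mulr0.
Qed.

Lemma entry_gr_uniq l x h :
  entry (gr l x) h = \sum_(g <- undup (unzip2 l))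
    entry (gr l delta) g * entry x (g^-1 * h)%g.
Proof.
rewrite entry_gr; under [RHS]eq_bigr do rewrite entry_gr_delta mulr_suml.
rewrite (exchange_big_dep predT)//= big_seq [RHS]big_seq; apply: eq_bigr => p pl.
have pu : p.2 \in undup (unzip2 l) by rewrite mem_undup; apply: map_f.
rewrite big_mkcond (bigD1_seq p.2)//= ?undup_uniq// eqxx big1 ?addr0// => g.
by rewrite eq_sym => /negPf ->.
Qed.

Lemma entry_le x g : normc (entry x g) <= norm x.
Proof.
rewrite -(ler_pXn2r (n := 2))// ?nnegrE ?norm_ge0 ?normc_ge0// normE.
by have := @nsq_coords R G x [:: g] isT; rewrite big_cons big_nil addr0.
Qed.

Lemma normc_sum (J : Type) (r : seq J) (F : J -> C) :
  normc (\sum_(j <- r) F j) <= \sum_(j <- r) normc (F j).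
Proof.
elim: r => [|j r IH]; first by rewrite !big_nil ComplexField.Normc.normc0.
by rewrite !big_cons (le_trans (le_normcD _ _))// lerD2l.
Qed.

(** Each entry of a convolution is at most the product of the two norms, here in
    the form of a weighted sum of their squares. *)
Lemma entry_gr_le l x h (t : R) : 0 < t ->
  normc (entry (gr l x) h) <= t * nsq (gr l delta) + t^-1 * nsq x.
Proof.
move=> t0; rewrite entry_gr_uniq; set u := undup _.
apply: le_trans (normc_sum _ _) _.
apply: le_trans (_ : _ <= \sum_(g <- u) (t * sqabs (entry (gr l delta) g) +
   t^-1 * sqabs (entry x (g^-1 * h)%g))) _.
  apply: ler_sum => g _; rewrite ComplexField.Normc.normcM /sqabs.
  set a := normc _; set b := normc _.
  rewrite -subr_ge0 (_ : _ - _ = t^-1 * ((t * a - b) ^+ 2 + (t * a) ^+ 2 + b ^+ 2) / 2).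
    rewrite divr_ge0// mulr_ge0 ?invr_ge0 ?(ltW t0)//.
    by rewrite !addr_ge0// sqr_ge0.
  by field; rewrite gt_eqF.
rewrite big_split /= -!mulr_sumr lerD// ler_wpM2l ?invr_ge0 ?(ltW t0)//.
  by apply: nsq_coords; exact: undup_uniq.
rewrite -(big_map (fun g => g^-1 * h)%g predT (fun g => sqabs (entry x g))).
apply: nsq_coords; rewrite map_inj_uniq ?undup_uniq// => g k /mulIg.
exact: invg_inj.
Qed.

(** The elements of the algebra are convolution operators by [S delta].  This
    passes to the limit thanks to the bound on the entries. *)
Lemma delta_separating S : A S -> S delta = 0 -> S = 0.
Proof.
move=> /reduced_CstarP[_ SA] S0; apply/funext => x; apply: ell2_eqP => h.
apply: ComplexField.Normc.eq0_normc; apply/eqP; rewrite eq_le normc_ge0 andbT.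
apply/ler_addgt0Pr => e e0; rewrite add0r.
pose K := norm x + 1 + nsq x.
have K0 : 0 < K by rewrite /K ltr_wpDr ?nsq_ge0// ltr_wpDl// norm_ge0.
pose t := e / K; have t0 : 0 < t by rewrite divr_gt0.
have [l Sl] := SA _ t0.
have n1 : nsq (gr l delta) <= t ^+ 2.
  rewrite -normE lerXn2r ?nnegrE ?norm_ge0 ?(ltW t0)//.
  by have := Sl delta; rewrite opB S0 sub0r normN norm_delta mulr1.
have -> : entry (S x) h = entry ((S - gr l) x) h + entry (gr l x) h.
  by rewrite opB entryD entryN subrK.
apply: le_trans (le_normcD _ _) _.
have tV : 0 < t^-1 by rewrite invr_gt0.
have h1 := entry_gr_le l x h tV.
have h2 := le_trans (entry_le ((S - gr l) x) h) (Sl x).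
have h3 : t^-1 * nsq (gr l delta) <= t.
  by rewrite ler_pdivrMl// -expr2.
rewrite invrK in h1.
have -> : e = t * norm x + (t + t * nsq x) by rewrite /t /K; field; rewrite gt_eqF.
by rewrite lerD// (le_trans h1)// lerD.
Qed.

(** ** Ping-pong *)

Definition restr_fun (P : pred G) x : G -> C := fun g => if P g then entry x g else 0.

Lemma restr_in (P : pred G) x : in_ell2 (restr_fun P x).
Proof.
apply/in_ell2P; apply: le_lt_trans (_ : _ <= (nsq x)%:E)%E (ltry _).
rewrite -sqnormE; apply: le_esum => g _; rewrite lee_fin /restr_fun.
by case: (P g) => //; rewrite ComplexField.Normc.normc0 expr0n sqr_ge0.
Qed.

Definition restr (P : pred G) x : H := exist _ (restr_fun P x) (restr_in P x).

Lemma entry_restr P x g : entry (restr P x) g = if P g then entry x g else 0.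
Proof. by []. Qed.

Lemma sqabsD_weight (s : R) (a b : C) : 0 < s ->
  sqabs (a + b) <= (1 + s) * sqabs a + (1 + s^-1) * sqabs b.
Proof.
move=> s0; rewrite !sqabsE; case: a b => a a' [b b'] /=.
rewrite -subr_ge0.
have -> : (1 + s) * (a ^+ 2 + a' ^+ 2) + (1 + s^-1) * (b ^+ 2 + b' ^+ 2) -
   ((a + b) ^+ 2 + (a' + b') ^+ 2) =
   s^-1 * ((s * a - b) ^+ 2 + (s * a' - b') ^+ 2).
  by field; rewrite gt_eqF.
by rewrite mulr_ge0// ?invr_ge0 ?(ltW s0)// addr_ge0// sqr_ge0.
Qed.

Lemma sqabs0 : sqabs (0 : C) = 0.
Proof. by rewrite /sqabs ComplexField.Normc.normc0 expr0n. Qed.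

Lemma sqabs_sum (J : Type) (r : seq J) (F : J -> C) :
  sqabs (\sum_(j <- r) F j) <= (size r)%:R * \sum_(j <- r) sqabs (F j).
Proof.
elim: r => [|j r IH]; first by rewrite !big_nil sqabs0 mulr0.
rewrite !big_cons /=; case: (posnP (size r)) => [/size0nil ->|sr].
  by rewrite !big_nil !addr0 mul1r.
have s0 : 0 < (size r)%:R :> R by rewrite ltr0n.
apply: le_trans (@sqabsD_weight _ _ _ s0) _.
have sV : 0 <= 1 + (size r)%:R^-1 :> R by rewrite addr_ge0 ?invr_ge0.
have h := ler_wpM2l sV IH.
have -> : (size r).+1%:R = 1 + (size r)%:R :> R by rewrite -natr1 addrC.
rewrite mulrDr lerD2l (le_trans h)// mulrA.
by rewrite mulrDl mul1r mulVf ?gt_eqF// addrC.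
Qed.

Lemma big_map_ord (V : nmodType) (Q : Type) n (f : 'I_n -> Q) (F : Q -> V) :
  \sum_(q <- [seq f i | i <- enum 'I_n]) F q = \sum_(i < n) F (f i).
Proof. by rewrite big_map big_enum. Qed.

(** Powers' estimate.  If g_i maps the complement of S_i into S_i, for pairwise
    disjoint sets S_i, then the sum of the n unitaries lam g_i has norm at most
    2 sqrt n: each translate of x splits into a part supported in S_i, and these
    are orthogonal, and a part coming from the restriction of x to S_i, and
    these restrictions are orthogonal as well. *)
Lemma ping_pong_sum n (gs : 'I_n -> G) (P : 'I_n -> pred G) x :
  (forall i j h, P i h -> P j h -> i = j) ->
  (forall i h, ~~ P i h -> P i (gs i * h)%g) ->
  nsq (\sum_(i < n) lam (gs i) x) <= 4 * n%:R * nsq x.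
Proof.
move=> Pdisj Ppp.
pose F i g := entry (lam (gs i) x) g.
pose F' i g := entry (lam (gs i) (restr (P i) x)) g.
have split_F i g : F i g = (if P i g then F i g else 0) + (if P i g then 0 else F' i g).
  case: ifPn => [Pg|Pg]; first by rewrite addr0.
  rewrite add0r /F' entry_lam entry_restr ifT//.
  by apply: contraNT Pg => /Ppp; rewrite mulVKg.
have one i : nsq (lam (gs i) x) = nsq x by rewrite nsq_lam.
have sum_restr : \sum_(i < n) nsq (restr (P i) x) <= nsq x.
  have := @nsq_le R G [seq (1, restr (P i) x) | i <- enum 'I_n] [:: (1, x)].
  rewrite big_map_ord /= big_cons big_nil addr0 mul1r.
  under eq_bigr do rewrite mul1r.
  apply; [by apply/allP => _ /mapP[i _ ->]; exact: ler01|by rewrite /= ler01|].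
  move=> g; rewrite big_map_ord /= big_cons big_nil addr0 mul1r.
  under eq_bigr do rewrite mul1r entry_restr.
  have [/existsP[i Pi]|/existsPn noP] := boolP [exists i, P i g].
    rewrite (bigD1 i)//= Pi big1 ?addr0// => j ji; rewrite ifF ?sqabs0//.
    by apply: contraNF ji => Pj; apply/eqP; exact: Pdisj Pj Pi.
  by rewrite big1 ?sqabs_ge0// => i _; rewrite (negPf (noP i)) sqabs0.
pose l := [:: (1 : R, \sum_(i < n) lam (gs i) x)].
pose m := [seq (2 : R, lam (gs i) x) | i <- enum 'I_n] ++
          [seq (2 * n%:R : R, lam (gs i) (restr (P i) x)) | i <- enum 'I_n].
have : \sum_(p <- l) p.1 * nsq p.2 <= \sum_(p <- m) p.1 * nsq p.2.
  apply: nsq_le; first by rewrite /= ler01.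
    rewrite all_cat; apply/andP; split; apply/allP => _ /mapP[i _ ->] //.
    by rewrite mulr_ge0.
  move=> g; rewrite /l /m big_cons big_nil addr0 mul1r big_cat/= !big_map_ord/=.
  have -> : entry (\sum_(i < n) lam (gs i) x) g = \sum_(i < n) F i g.
    by rewrite /F; elim/big_rec2: _ => [//|i y1 y2 _ <-]; rewrite entryD.
  rewrite (eq_bigr _ (fun i _ => split_F i g)).
  rewrite big_split /=; apply: le_trans (@sqabsD_weight _ _ _ ltr01) _.
  rewrite invr1 -!mulr_sumr -mulrA; apply: lerD; apply: ler_wpM2l => //.
    have [/existsP[i Pi]|/existsPn noP] := boolP [exists i, P i g].
      rewrite (bigD1 i)//= Pi big1 ?addr0; last first.
        move=> j ji; rewrite ifF//.
        by apply: contraNF ji => Pj; apply/eqP; exact: Pdisj Pj Pi.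
      rewrite [leRHS](bigD1 i)//= lerDl sumr_ge0// => j _; exact: sqabs_ge0.
    rewrite big1 ?sqabs0; last by move=> i _; rewrite (negPf (noP i)).
    by rewrite sumr_ge0// => j _; exact: sqabs_ge0.
  apply: le_trans (sqabs_sum _ _) _; rewrite /index_enum -enumT size_enum_ord.
  apply: ler_wpM2l => //; rewrite !big_enum /=; apply: ler_sum => i _.
  by case: ifP; rewrite ?sqabs0 ?sqabs_ge0// lexx.
rewrite /l /m big_cons big_nil addr0 mul1r big_cat/= !big_map_ord/=.
have -> : \sum_(i < n) 2 * nsq (lam (gs i) x) = 2 * n%:R * nsq x.
  under eq_bigr do rewrite one.
  by rewrite sumr_const card_ord -mulr_natl; ring.
have -> : \sum_(i < n) 2 * n%:R * nsq (lam (gs i) (restr (P i) x)) =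
    2 * n%:R * \sum_(i < n) nsq (restr (P i) x).
  by under eq_bigr do rewrite nsq_lam; rewrite mulr_sumr.
have n0 : 0 <= 2 * n%:R :> R by rewrite mulr_ge0.
by have := ler_wpM2l n0 sum_restr; lra.
Qed.

End Coefficients.

(** * Averages of conjugates *)

Section Averages.
Variables (R : realType) (G : groupType).
Local Notation C := R[i].
Local Notation H := (ell2 R G).
Local Notation normc := ComplexField.Normc.normc.
Local Notation norm := (@ell2norm R G).
Local Notation lam := (@left_regular R G).
Local Notation A := (reduced_Cstar R G).
Implicit Types (S T : H -> H) (I : set (H -> H)) (g h k p : G) (ks ps : seq G).

Lemma avg_allpairs ps ks (F : G -> H -> H) :
  avg [seq (p * k)%g | p <- ps, k <- ks] F =
  avg ps (fun p => avg ks (fun k => F (p * k)%g)).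
Proof.
rewrite /avg big_allpairs_dep size_allpairs -scaler_sumr scalerA; congr (_ *: _).
by rewrite natrM invfM rmorphM.
Qed.

Lemma avg_exchange ps ks (F : G -> G -> H -> H) :
  avg ps (fun p => avg ks (F p)) = avg ks (fun k => avg ps (F^~ k)).
Proof.
rewrite /avg -!scaler_sumr !scalerA mulrC exchange_big //.
Qed.

Lemma eq_avg ps (F F' : G -> H -> H) : (forall p, p \in ps -> F p = F' p) ->
  avg ps F = avg ps F'.
Proof. by move=> FF; rewrite /avg; congr (_ *: _); apply: eq_big_seq. Qed.

Lemma conj_op_avg p ks (F : G -> H -> H) :
  conj_op p (avg ks F) = avg ks (fun k => conj_op p (F k)).
Proof.
apply/funext => x; rewrite /conj_op /= !avgE (linopZ _ _ (linear_lam p)).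
by rewrite linop_sum//; exact: linear_lam.
Qed.

Lemma avg_comp_lam ks (F : G -> H -> H) g :
  avg ks F \o lam g = avg ks (fun k => F k \o lam g).
Proof. by apply/funext => x; rewrite /= !avgE. Qed.

Lemma avg_comp ks ps (F F' : G -> H -> H) : (forall k, k \in ks -> linear (F k)) ->
  avg ks F \o avg ps F' = avg ks (fun k => avg ps (fun p => F k \o F' p)).
Proof.
move=> Fl; apply/funext => x; rewrite /= !avgE; congr (_ *: _).
apply: eq_big_seq => k kks; rewrite avgE linopZ; last exact: Fl.
by rewrite linop_sum//; exact: Fl.
Qed.

Lemma avg_lam_gr ks (f : G -> G) :
  avg ks (fun k => lam (f k)) =
  gr [seq (((size ks)%:R^-1 : R)%:C%C, f k) | k <- ks].
Proof. by rewrite /avg /gr big_map scaler_sumr. Qed.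

Lemma reduced_Cstar_avg ks (f : G -> G) : A (avg ks (fun k => lam (f k))).
Proof. by rewrite avg_lam_gr; exact: reduced_Cstar_gr. Qed.

Lemma avg_const ks S : ks != [::] -> avg ks (fun=> S) = S.
Proof.
move=> ks0; rewrite /avg big_const_seq count_predT iter_addr addr0.
rewrite -[S *+ _]scaler_nat scalerA -(rmorph_nat (real_complex R)) -rmorphM.
by rewrite mulVf ?rmorph1 ?scale1r// pnatr_eq0 size_eq0.
Qed.

Lemma avg_conj_gr ps (l : seq (C * G)) :
  avg ps (fun p => conj_op p (gr l)) =
  \sum_(q <- l) q.1 *: avg ps (fun p => lam (p * q.2 * p^-1)%g).
Proof.
rewrite /avg; under eq_bigr do rewrite conj_op_gr /gr big_map.
rewrite exchange_big scaler_sumr; apply: eq_bigr => q _ /=.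
by rewrite -scaler_sumr !scalerA mulrC.
Qed.

(** Conjugation by a unitary preserves the norm modulo I. *)
Lemma near_avg_conj I ps (l : seq (C * G)) e : closed_ideal A I -> ps != [::] ->
  near_ideal I (gr l) e ->
  near_ideal I (avg ps (fun p => conj_op p (gr l))) e.
Proof.
move=> Iid ps0 Ie; apply: (near_avg Iid ps0) => p _.
exact (near_conj p Iid (reduced_Cstar_gr l) Ie).
Qed.

Lemma near_part I (l : seq (C * G)) (P : pred (C * G)) (F : C * G -> H -> H) (d e : R) :
  closed_ideal A I -> 0 <= d ->
  near_ideal I (\sum_(q <- l) q.1 *: F q) e ->
  (forall q, q \in l -> ~~ P q -> near_ideal I (F q) d) ->
  near_ideal I (\sum_(q <- l | P q) q.1 *: F q) (e + d * \sum_(q <- l) normc q.1).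
Proof.
move=> Iid d0 Ie Id.
rewrite (_ : \sum_(q <- l | P q) _ =
  \sum_(q <- l) q.1 *: F q + \sum_(q <- l) (if P q then 0 else - q.1 *: F q)).
  apply: (near_idealD Iid Ie); rewrite mulr_sumr.
  apply: (near_ideal_sum Iid) => q ql; case: ifPn => [_|nP].
    apply: (near_ideal_bounded Iid) => x; rewrite norm0.
    by rewrite !mulr_ge0 ?normc_ge0 ?norm_ge0.
  have := near_idealZ Iid (- q.1) (Id q ql nP).
  by rewrite normcN mulrC.
rewrite -big_split /= [LHS]big_mkcond; apply: eq_bigr => q _.
by case: ifP => _; rewrite ?addr0// scaleNr subrr.
Qed.

End Averages.

(** * Extremely proximal actions *)

Section Dynamics.
Variables (G : groupType) (X : topologicalType) (act : G -> X -> X).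
Implicit Types (g h k p t : G) (x y z : X) (U V W O : set X).

Inductive commutator_product (P : set G) : G -> Prop :=
| commutator_product1 : commutator_product P 1%g
| commutator_product_comm a b : P a -> P b ->
    commutator_product P (a^-1 * b^-1 * a * b)%g
| commutator_productM a b : commutator_product P a -> commutator_product P b ->
    commutator_product P (a * b)%g
| commutator_productV a : commutator_product P a -> commutator_product P a^-1%g.

Definition fixes U g := forall z, U z -> act g z = z.

Definition trivial_near x : set G := [set g | \forall z \near x, act g z = z].

(** All that the proof needs to know about T and the circle.  Perfectness is
    asked at a single point x0; by proximality, every element that fixes an open
    set is conjugate to one with trivial germ at x0. *)
Record extremely_proximal_action (x0 : X) : Prop := {
  actM : forall g h z, act (g * h)%g z = act g (act h z);
  act1 : forall z, act 1%g z = z;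
  act_faithful : forall g h, (forall z, act g z = act h z) -> g = h;
  act_continuous : forall g, continuous (act g);
  act_hausdorff : hausdorff_space X;
  act_no_isolated : forall U, open U -> U !=set0 ->
    exists x y, [/\ U x, U y & x != y];
  act_proximal : forall U O, open U -> U !=set0 -> open O -> O !=set0 ->
    exists p, forall z, ~ U z -> O (act p z);
  act_perfect : forall g, trivial_near x0 g ->
    commutator_product (trivial_near x0) g }.

Variables (x0 : X) (act_axioms : extremely_proximal_action x0).
Let aM := actM act_axioms.
Let a1 := act1 act_axioms.

Lemma actK g z : act g^-1%g (act g z) = z.
Proof. by rewrite -aM mulVg a1. Qed.

Lemma actVK g z : act g (act g^-1%g z) = z.
Proof. by rewrite -aM mulgV a1. Qed.

Lemma act_inj g x y : act g x = act g y -> x = y.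
Proof. by move=> /(congr1 (act g^-1%g)); rewrite !actK. Qed.

Lemma fixesV U g : fixes U g -> fixes U g^-1%g.
Proof. by move=> fg z Uz; rewrite -{1}(fg z Uz) actK. Qed.

Lemma fixes1 U : fixes U 1%g.
Proof. by move=> z _; exact: a1. Qed.

Lemma fixes_conj U V h g : (forall z, V z -> U (act h^-1%g z)) ->
  fixes U g -> fixes V (h * g * h^-1)%g.
Proof. by move=> VU fg z /VU Uz; rewrite !aM fg// actVK. Qed.

Lemma open_act_preimage g U : open U -> open (act g @^-1` U).
Proof.
by move=> oU; apply: open_comp => // z _; exact: (act_continuous act_axioms).
Qed.

Lemma supported_stable W k z : fixes (~` W) k -> W z -> W (act k z).
Proof.
move=> fk Wz; apply: contrapT => nW.
by have := fk _ nW => /act_inj kz; apply: nW; rewrite kz.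
Qed.

Lemma disjoint_commute V W k h : fixes (~` V) k -> fixes (~` W) h ->
  (forall z, V z -> W z -> False) -> (k * h = h * k)%g.
Proof.
move=> fk fh VW; apply: (act_faithful act_axioms) => z; rewrite !aM.
have [Vz|Vz] := pselect (V z).
  have Vkz := supported_stable fk Vz.
  by rewrite !fh// => Wz; apply: (VW _ _ Wz).
rewrite (fk z Vz); have [Wz|Wz] := pselect (W z).
  have Whz := supported_stable fh Wz.
  by rewrite fk// => Vhz; apply: (VW _ Vhz).
by rewrite fh// fk.
Qed.

Lemma separate x y : x != y ->
  exists U V, [/\ open U, open V, U x, V y & forall z, U z -> V z -> False].
Proof.
move=> xy; have := act_hausdorff act_axioms; rewrite open_hausdorff.
move=> /(_ x y xy)[[U V] /= [Ux Vy] [oU oV /eqP UV]].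
exists U, V; split=> //; [by rewrite inE in Ux|by rewrite inE in Vy|].
by move=> z Uz Vz; have : (U `&` V) z by []; rewrite UV.
Qed.

Lemma disjoint_pair U V : open U -> U !=set0 -> open V -> V !=set0 ->
  exists U' V', [/\ open U' /\ U' !=set0, open V' /\ V' !=set0,
    U' `<=` U, V' `<=` V & forall z, U' z -> V' z -> False].
Proof.
move=> oU [x Ux] oV V0.
have [y Vy xy] : exists2 y, V y & x != y.
  have [y [y' [Vy Vy' yy']]] := act_no_isolated act_axioms oV V0.
  have [xy|xy] := eqVneq x y; last by exists y.
  by exists y' => //; rewrite xy.
have [U' [V' [oU' oV' U'x V'y UV]]] := separate xy.
exists (U' `&` U), (V' `&` V); split.
- by split; [exact: openI|exists x].
- by split; [exact: openI|exists y].
- by move=> z [].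
- by move=> z [].
- by move=> z [Uz _] [Vz _]; exact: UV Uz Vz.
Qed.

Lemma disjoint_from n (M : nat -> set X) O :
  (forall i, (i < n)%N -> open (M i) /\ M i !=set0) -> open O -> O !=set0 ->
  exists (M2 : nat -> set X) O2, [/\ open O2, O2 !=set0, O2 `<=` O &
    forall i, (i < n)%N -> [/\ open (M2 i), M2 i !=set0, M2 i `<=` M i &
      forall z, M2 i z -> O2 z -> False]].
Proof.
elim: n => [|n IH] Mn oO O0; first by exists M, O; split.
have [|m [ O2 [oO2 O20 O2O mn]]] := IH _ oO O0.
  by move=> i ni; apply: Mn; rewrite ltnS ltnW.
have [oM M0] := Mn n (ltnSn n).
have [N [ O3 [[oN N0] [oO3 O30] NM O3O2 NO]]] := disjoint_pair oM M0 oO2 O20.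
exists (fun i => if i == n then N else m i), O3; split=> //.
  exact: subset_trans O3O2 O2O.
move=> i; rewrite ltnS leq_eqVlt; have [->|ni] /= := eqVneq i n; first by split.
move=> /mn[oM' m0 mM mO]; split=> // z mz O3z; exact: mO mz (O3O2 _ O3z).
Qed.

(** As there are no isolated points, the open sets can be shrunk until they are
    disjoint, one pair at a time. *)
Lemma disjoint_family n (M : nat -> set X) :
  (forall i, (i < n)%N -> open (M i) /\ M i !=set0) ->
  exists W : nat -> set X,
    (forall i, (i < n)%N -> [/\ open (W i), W i !=set0 & W i `<=` M i]) /\
    (forall i j z, (i < n)%N -> (j < n)%N -> W i z -> W j z -> i = j).
Proof.
elim: n M => [|n IH] M Mn; first by exists M; split.
have [oM M0] := Mn n (ltnSn n).
have [|m [ O [oO O0 OM mn]]] := disjoint_from (n := n) (M := M) _ oM M0.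
  by move=> i ni; apply: Mn; rewrite ltnS ltnW.
have [|W [Wn Wdisj]] := IH m; first by move=> i /mn[].
exists (fun i => if i == n then O else W i); split.
  move=> i; rewrite ltnS leq_eqVlt; have [->|ni] /= := eqVneq i n; first by split.
  move=> ni'; have [oW W0 WM'] := Wn _ ni'; have [_ _ mM _] := mn _ ni'.
  by split=> //; exact: subset_trans WM' mM.
have ltn i : (i < n.+1)%N -> i != n -> (i < n)%N.
  by rewrite ltnS ltn_neqAle => -> ->.
move=> i j z /ltn ni /ltn nj.
have [->|{}/ni ni] := eqVneq i n; have [->|{}/nj nj] := eqVneq j n => //.
- move=> Oz Wz; have [_ _ WM'] := Wn _ nj; have [_ _ _ mO] := mn _ nj.
  by case: (mO z (WM' _ Wz) Oz).
- move=> Wz Oz; have [_ _ WM'] := Wn _ ni; have [_ _ _ mO] := mn _ ni.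
  by case: (mO z (WM' _ Wz) Oz).
- exact: Wdisj.
Qed.

Definition displaces t W := [/\ open W, W !=set0 & forall z, W z -> ~ W (act t z)].

Lemma displacesS t U W : open U -> U !=set0 -> U `<=` W -> displaces t W ->
  displaces t U.
Proof.
move=> oU U0 UW [_ _ tW]; split=> // z Uz /UW Wz; exact: tW (UW _ Uz) Wz.
Qed.

Lemma displacesP g : g != 1%g -> exists W, displaces g W.
Proof.
move=> g1; have [z gz] : exists z, act g z != z.
  apply: contrapT => /forallNP gz; move/eqP: g1; apply.
  apply: (act_faithful act_axioms) => z; rewrite a1; apply/eqP.
  by have /negP := gz z; rewrite negbK.
have [U [V [oU oV Ugz Vz UV]]] := separate gz.
exists (V `&` act g @^-1` U); split.
- by apply: openI => //; exact: open_act_preimage.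
- by exists z.
- by move=> x [_ Ux] [Vx _]; exact: UV Ux Vx.
Qed.

(** The conjugate by t of an element supported in W is supported off W, hence
    commutes with the elements supported in W. *)
Lemma displaced_supported t W k : displaces t W -> fixes (~` W) k ->
  fixes W (t * k * t^-1)%g.
Proof.
move=> [_ _ tW] fk; apply: fixes_conj fk => z Wz; rewrite /setC /=.
by move=> /tW; rewrite actVK.
Qed.

Lemma displaced_commute t W k h : displaces t W ->
  fixes (~` W) k -> fixes (~` W) h -> (h * (t * k * t^-1) = t * k * t^-1 * h)%g.
Proof.
move=> tW fk fh; apply: (@disjoint_commute W (~` W)) => //.
  by rewrite setCK; exact: displaced_supported fk.
Qed.

End Dynamics.

(** * Averages of twisted commutators *)

Section Dichotomy.
Variables (R : realType) (G : groupType) (X : topologicalType).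
Variables (act : G -> X -> X) (x0 : X).
Hypothesis act_axioms : extremely_proximal_action act x0.
Local Notation C := R[i].
Local Notation H := (ell2 R G).
Local Notation normc := ComplexField.Normc.normc.
Local Notation norm := (@ell2norm R G).
Local Notation lam := (@left_regular R G).
Local Notation A := (reduced_Cstar R G).
Local Notation fixes := (fixes act).
Implicit Types (S T : H -> H) (I J : set (H -> H)) (g h k p t : G) (ks ps : seq G).

Definition twisted t k : H -> H := lam (k * t * k^-1 * t^-1)%g.

Definition supported_list W ks := ks != [::] /\ forall k, k \in ks -> fixes (~` W) k.

(** The alternative on which the proof rests.  It concerns the ideal: for the
    zero ideal, it fails when the elements supported in some displaced set form
    an amenable group. *)
Definition vanishing_averages I := forall t W e, displaces act t W -> 0 < e ->
  exists2 ks, supported_list W ks & near_ideal I (avg ks (twisted t)) e.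

Lemma conj_lam_twisted t k : lam (k * t * k^-1)%g = twisted t k \o lam t.
Proof. by rewrite /twisted -lamME mulgVK. Qed.

Lemma near_comp_lam I S g e : closed_ideal A I -> A S -> 0 <= e ->
  near_ideal I S e -> near_ideal I (S \o lam g) e.
Proof.
move=> Iid AS e0 Ie; rewrite -[e]mulr1.
apply: (near_idealM Iid AS (@reduced_Cstar_lam R G g) e0 Ie).
exact (near_ideal_bounded Iid (@bounded_by_lam R G g)).
Qed.

Lemma supported_list_mul V W ks ps : supported_list V ks -> supported_list W ps ->
  supported_list (V `|` W) [seq (k * p)%g | k <- ks, p <- ps].
Proof.
move=> [ks0 ksV] [ps0 psW]; split.
  rewrite -size_eq0 size_allpairs muln_eq0 !size_eq0.
  by rewrite (negPf ks0) (negPf ps0).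
move=> _ /allpairsP[[k p] /= [kks pps ->]] z.
rewrite setCU => -[zV zW]; rewrite (actM act_axioms).
by rewrite (psW p pps)// (ksV k kks).
Qed.

Lemma supported_listS V W ks : V `<=` W -> supported_list V ks -> supported_list W ks.
Proof.
by move=> VW [ks0 ksV]; split=> // k /ksV fk z nW; apply: fk => /VW.
Qed.

(** Averaging over conjugators supported in disjoint sets kills several group
    elements at once: the average adapted to one of them only conjugates what
    the averages adapted to the other ones produce. *)
Lemma kill_family I n (gs : nat -> G) (W : nat -> set X) (e : R) :
  closed_ideal A I -> vanishing_averages I -> 0 < e ->
  (forall i, (i < n)%N -> displaces act (gs i) (W i)) ->
  (forall i j z, (i < n)%N -> (j < n)%N -> W i z -> W j z -> i = j) ->
  exists2 ps, supported_list [set z | exists2 i, (i < n)%N & W i z] ps &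
    forall i, (i < n)%N ->
      near_ideal I (avg ps (fun p => lam (p * gs i * p^-1)%g)) e.
Proof.
move=> Iid Iv e0; elim: n => [|n IH] gW Wdisj.
  exists [:: 1%g] => //; split=> // k; rewrite inE => /eqP ->.
  exact: fixes1 act_axioms _.
have [||ps [ps0 psW] psn] := IH.
- by move=> i ni; apply: gW; rewrite ltnS ltnW.
- by move=> i j z ni nj; apply: Wdisj; rewrite ltnS ltnW.
have [ks [ks0 ksW] Iks] := Iv _ _ _ (gW n (ltnSn n)) e0.
have {}Iks : near_ideal I (avg ks (fun k => lam (k * gs n * k^-1)%g)) e.
  rewrite (eq_avg (F' := fun k => twisted (gs n) k \o lam (gs n))); last first.
    by move=> k _; exact: conj_lam_twisted.
  rewrite -avg_comp_lam; apply: near_comp_lam => //; last exact: ltW.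
  exact: reduced_Cstar_avg.
exists [seq (p * k)%g | p <- ps, k <- ks].
  have := supported_list_mul (conj ps0 psW) (conj ks0 ksW).
  apply: supported_listS => z [[i ni Wz]|Wz]; last by exists n.
  by exists i => //; rewrite ltnS ltnW.
move=> i; rewrite ltnS leq_eqVlt => /predU1P[->|ni].
  rewrite avg_allpairs (eq_avg (F' := fun p => conj_op p
    (avg ks (fun k => lam (k * gs n * k^-1)%g)))).
    apply: (near_avg Iid ps0) => p _.
    exact (near_conj p Iid (reduced_Cstar_avg _ _ _) Iks).
  move=> p _; rewrite conj_op_avg; apply: eq_avg => k _.
  by rewrite conj_op_lam invgM !mulgA.
rewrite avg_allpairs avg_exchange (eq_avg (F' := fun k => conj_op k
    (avg ps (fun p => lam (p * gs i * p^-1)%g)))).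
  apply: (near_avg Iid ks0) => k _.
  exact (near_conj k Iid (reduced_Cstar_avg _ _ _) (psn i ni)).
move=> k kks; rewrite conj_op_avg; apply: eq_avg => p pps.
have -> : (p * k = k * p)%g.
  apply: (disjoint_commute act_axioms (psW p pps) (ksW k kks)) => z [j nj Wj] Wn.
  have := Wdisj j n z; rewrite !ltnS ltnW// leqnn => /(_ isT isT Wj Wn) jn.
  by rewrite jn ltnn in nj.
by rewrite conj_op_lam invgM !mulgA.
Qed.

Lemma kill_all I (gs : seq G) (e : R) : closed_ideal A I -> vanishing_averages I ->
  0 < e -> (forall g, g \in gs -> g != 1%g) ->
  exists2 ps, ps != [::] & forall g, g \in gs ->
      near_ideal I (avg ps (fun p => lam (p * g * p^-1)%g)) e.
Proof.
move=> Iid Iv e0 gs1; pose n := size gs; pose g i := nth 1%g gs i.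
have /choice[M gM] : forall i, exists W, (i < n)%N -> displaces act (g i) W.
  move=> i; have [ni|ni] := ltnP i n; last by exists setT.
  have [W gW] := displacesP act_axioms (gs1 _ (mem_nth 1%g ni)).
  by exists W.
have [|W [Wn Wdisj]] := disjoint_family act_axioms (n := n) (M := M).
  by move=> i /gM[].
have gW i : (i < n)%N -> displaces act (g i) (W i).
  by move=> ni; have [oW W0 WM] := Wn i ni; exact: displacesS WM (gM i ni).
have [ps [ps0 _] psn] := kill_family Iid Iv e0 gW Wdisj.
exists ps => // h /(nthP 1%g)[i ni <-]; exact: psn.
Qed.

(** A nonzero ideal contains some operator with coefficient 1 at the unit; all
    the other group elements met by an approximation of it are averaged away
    modulo I, so that the unit lies in I. *)
Lemma vanishing_averages_full I S : closed_ideal A I -> vanishing_averages I ->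
  I S -> S <> 0 -> I id.
Proof.
move=> Iid Iv IS S0; have AS := ideal_sub Iid IS.
have [g0 Sg0] : exists g0, entry (S (delta R G)) g0 != 0.
  apply: contrapT => /forallNP Sd; apply: S0; apply: delta_separating AS _.
  by apply: ell2_eqP => g; apply/eqP; have /negP := Sd g; rewrite negbK.
pose c := (entry (S (delta R G)) g0)^-1.
pose S1 := c *: (lam g0^-1%g \o S).
have IS1 : I S1.
  exact (in_idealZ Iid c (in_idealMl Iid (@reduced_Cstar_lam R G g0^-1%g) IS)).
have S11 : entry (S1 (delta R G)) 1%g = 1.
  by rewrite /S1 opZ entryZ /= entry_lam invgK mulg1 mulVf.
have /reduced_CstarP[_ S1A] := ideal_sub Iid IS1.
have [|l Sl] := S1A 8^-1; first by rewrite invr_gt0.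
pose K := \sum_(q <- l) normc q.1.
have K0 : 0 <= K by apply: sumr_ge0 => q _; exact: normc_ge0.
pose d : R := (8 * (K + 1))^-1.
have K1 : 0 < K + 1 by rewrite ltr_wpDl.
have d0 : 0 < d by rewrite invr_gt0 mulr_gt0.
have [|ps ps0 psl] := kill_all (gs := [seq q.2 | q <- l & q.2 != 1%g]) Iid Iv d0.
  by move=> g /mapP[q]; rewrite mem_filter => /andP[q1 _] ->.
have near_l : near_ideal I (gr l) 8^-1.
  by exists S1 => //; exact: bounded_byC.
have := near_avg_conj Iid ps0 near_l; rewrite avg_conj_gr => near_avg_l.
have [|] := near_part (P := fun q => q.2 == 1%g) Iid (ltW d0) near_avg_l.
  by move=> q ql q1; apply: psl; apply: map_f; rewrite mem_filter q1.
rewrite -/K => T IT.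
pose a := \sum_(q <- l | q.2 == 1%g) q.1.
have -> : \sum_(q <- l | q.2 == 1%g) q.1 *: avg ps (fun p => lam (p * q.2 * p^-1)%g) =
    a *: (id : H -> H).
  rewrite /a scaler_suml; apply: eq_bigr => q /eqP ->; congr (_ *: _).
  rewrite (eq_avg (F' := fun=> id)); first by rewrite avg_const.
  by move=> p _; rewrite mulg1 mulgV lam1E.
move=> aT; have {}aT : near_ideal I (a *: (id : H -> H)) 4^-1.
  exists T => //; apply: bounded_by_le aT.
  have : d * K <= 8^-1.
    rewrite /d invfM -mulrA ler_piMr ?invr_ge0// mulrC ler_pdivrMr// mul1r.
    by rewrite lerDl.
  lra.
have a1 : normc (a - 1) <= 8^-1.
  rewrite /a -entry_gr_delta -S11 -entryN -entryD -opB.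
  apply: le_trans (entry_le _ _) _.
  by have := bounded_byC Sl (delta R G); rewrite norm_delta mulr1.
have a78 : 7 / 8 <= normc a.
  have := le_normcD (1 - a) a; rewrite subrK ComplexField.Normc.normc1.
  by rewrite -opprB normcN; lra.
have a0 : a != 0.
  by apply: contraTneq a78 => ->; rewrite ComplexField.Normc.normc0 -ltNge divr_gt0.
apply: (near_ideal_id Iid (e := 1 / 2)); first by lra.
have := near_idealZ Iid a^-1 aT; rewrite scalerA mulVf// scale1r.
apply: near_ideal_le; rewrite ComplexField.Normc.normcV.
rewrite ler_pdivrMl ?ltr_pdivrMl; lra.
Qed.

(** The averages for disjoint subsets of W multiply.  If every open subset of W
    had an average of norm at most 1 - d, then W would have averages of norm at
    most (1 - d)^n for all n. *)
Lemma persistent_averages I (d : R) : closed_ideal A I -> ~ vanishing_averages I ->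
  0 < d <= 1 -> exists t W, displaces act t W /\
    forall ks, supported_list W ks -> ~ near_ideal I (avg ks (twisted t)) (1 - d).
Proof.
move=> Iid nIv /andP[d0 d1].
have [t [W [e [tW e0 We]]]] : exists t W e, [/\ displaces act t W, 0 < e &
    forall ks, supported_list W ks -> ~ near_ideal I (avg ks (twisted t)) e].
  apply: contrapT => h; apply: nIv => t W e tW e0; apply: contrapT => h'.
  apply: h; exists t, W, e; split=> // ks ksW Iks; apply: h'; exists ks => //.
apply: contrapT => h; have hW V : open V -> V !=set0 -> V `<=` W ->
    exists2 ks, supported_list V ks & near_ideal I (avg ks (twisted t)) (1 - d).
  move=> oV V0 VW; apply: contrapT => h'; apply: h; exists t, V; split.
    exact: displacesS VW tW.
  by move=> ks ksV Iks; apply: h'; exists ks.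
have dd : 0 <= 1 - d by rewrite subr_ge0.
have pow n V : open V -> V !=set0 -> V `<=` W ->
    exists2 ks, supported_list V ks & near_ideal I (avg ks (twisted t)) ((1 - d) ^+ n).
  elim: n V => [|n IH] V oV V0 VW.
    exists [:: 1%g].
      by split=> // k; rewrite inE => /eqP ->; exact: fixes1 act_axioms _.
    apply: (near_ideal_bounded Iid) => x; rewrite expr0 mul1r.
    rewrite avgE big_seq1 invr1 scale1r /twisted.
    by rewrite mul1g invg1 mulg1 mulgV lam1.
  have [V1 [V2 [[oV1 V10] [oV2 V20] V1V V2V V12]]] := disjoint_pair act_axioms oV V0 oV V0.
  have V1W := subset_trans V1V VW; have V2W := subset_trans V2V VW.
  have [ks ksV Iks] := hW _ oV1 V10 V1W.
  have [ps psV Ips] := IH _ oV2 V20 V2W.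
  exists [seq (k * p)%g | k <- ks, p <- ps].
    apply: supported_listS (supported_list_mul ksV psV).
    by move=> z [/V1V|/V2V].
  rewrite avg_allpairs exprS.
  have Ikp := near_idealM Iid (reduced_Cstar_avg _ _ _) (reduced_Cstar_avg _ _ _) dd Iks Ips.
  rewrite avg_comp in Ikp; last by move=> k _; exact: linear_lam.
  suff -> : avg ks (fun k => avg ps (fun p => twisted t (k * p)%g)) =
    avg ks (fun k => avg ps (fun p => twisted t k \o twisted t p)) by exact Ikp.
  apply: eq_avg => k kks; apply: eq_avg => p pps.
  have fW U q : U `<=` W -> fixes (~` U) q -> fixes (~` W) q.
    by move=> UW fq z nW; apply: fq => /UW.
  have fk := fW _ _ V1W (ksV.2 k kks); have fp := fW _ _ V2W (psV.2 p pps).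
  have kp : (k * p = p * k)%g.
    exact: (disjoint_commute act_axioms (ksV.2 k kks) (psV.2 p pps)).
  have pt := displaced_commute act_axioms tW (fixesV act_axioms fk) fp.
  rewrite /twisted -lamME; congr (left_regular _); apply/esym.
  have -> : (k * t * k^-1 * t^-1 * (p * t * p^-1 * t^-1) =
             k * (t * k^-1 * t^-1 * p) * t * p^-1 * t^-1)%g by rewrite !mulgA.
  by rewrite -pt {2}kp invgM !mulgA mulgVK.
have [n nd] : exists n, (1 - d) ^+ n <= e.
  have /cvgrPdist_lt/(_ e e0)[n _ /(_ n (leqnn n))] : (fun n => (1 - d) ^+ n) @ \oo --> (0 : R).
    by apply: cvg_expr; rewrite ger0_norm// ltrBlDr ltrDl.
  by rewrite sub0r normrN ger0_norm ?exprn_ge0// => nd; exists n; exact: ltW.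
have [oW W0 _] := tW; have [ks ksW Iks] := pow n W oW W0 (@subset_refl _ W).
by apply: We ksW _; exact (near_ideal_le nd Iks).
Qed.

End Dichotomy.

(** * Augmentation is bounded modulo an ideal *)

Section Augmentation.
Variables (R : realType) (G : groupType) (X : topologicalType).
Variables (act : G -> X -> X) (x0 : X).
Hypothesis act_axioms : extremely_proximal_action act x0.
Local Notation C := R[i].
Local Notation H := (ell2 R G).
Local Notation normc := ComplexField.Normc.normc.
Local Notation norm := (@ell2norm R G).
Local Notation lam := (@left_regular R G).
Local Notation A := (reduced_Cstar R G).
Local Notation fixes := (fixes act).
Implicit Types (S T : H -> H) (I J : set (H -> H)) (g h k p t : G) (ks ps : seq G).

(** If two commuting copies s1, s2 of a group almost agree on a vector y, then
    y is almost fixed by s1 of every commutator, since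
      s1 (a b) y ~ s2 (a b) y = s2 a (s2 b y) ~ s2 a (s1 b y)
                 = s1 b (s2 a y) ~ s1 b (s1 a y) = s1 (b a) y.
    Only finitely many elements of the group are involved. *)
Lemma commutator_almost_fixed (P : set G) g :
  (forall a b, P a -> P b -> P (a * b)%g) -> commutator_product P g ->
  exists (L : seq G) (n : nat), (forall k, k \in L -> P k) /\
    forall (s1 s2 : G -> G) y (e : R),
      {morph s1 : a b / (a * b)%g} -> {morph s2 : a b / (a * b)%g} ->
      (forall a b, a \in L -> b \in L -> (s1 a * s2 b = s2 b * s1 a)%g) ->
      (forall k, k \in L -> norm (lam (s1 k) y - lam (s2 k) y) <= e) ->
      norm (lam (s1 g) y - y) <= n%:R * e.
Proof.
move=> PM; have morph1 (s : G -> G) : {morph s : a b / (a * b)%g} -> s 1%g = 1%g.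
  by move=> sM; apply: (mulgI (s 1%g)); rewrite -sM !mulg1.
elim=> [|a b Pa Pb|a b _ [La [na [LaP ha]]] _ [Lb [nb [LbP hb]]]|a _ [La [na [LaP ha]]]].
- exists [::], 0%N; split=> // s1 s2 y e s1M _ _ _.
  by rewrite morph1// lam1 subrr norm0 mul0r.
- exists [:: a; b; (a * b)%g], 3%N; split.
    by move=> k; rewrite !inE => /or3P[] /eqP -> //; exact: PM.
  move=> s1 s2 y e s1M s2M s12 ye.
  have ea : norm (lam (s1 a) y - lam (s2 a) y) <= e by apply: ye; rewrite mem_head.
  have eb : norm (lam (s1 b) y - lam (s2 b) y) <= e by apply: ye; rewrite !inE eqxx orbT.
  have eab := ye (a * b)%g; rewrite !inE eqxx !orbT in eab; have {}eab := eab isT.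
  have -> : (a^-1 * b^-1 * a * b = (b * a)^-1 * (a * b))%g by rewrite invgM !mulgA.
  have s1ba : (s1 (b * a)^-1 = (s1 (b * a))^-1)%g.
    by apply/esym/mulg1_eq; rewrite -s1M mulgV morph1.
  rewrite s1M s1ba lamM -{2}(lamK (s1 (b * a)%g) y) -(linopB _ _ (linear_lam _)).
  rewrite norm_lam.
  have -> : lam (s1 (a * b)%g) y - lam (s1 (b * a)%g) y =
      (lam (s1 (a * b)%g) y - lam (s2 (a * b)%g) y) +
      (- lam (s2 a) (lam (s1 b) y - lam (s2 b) y) +
       - lam (s1 b) (lam (s1 a) y - lam (s2 a) y)).
    rewrite !(linopB _ _ (linear_lam _)) -!lamM -s1M -s2M.
    rewrite -s12 ?mem_head ?inE ?eqxx ?orbT// !opprB.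
    by rewrite [X in _ = _ + X]addrA !addrA !subrK.
  apply: le_trans (normD _ _) _.
  have := normD (- lam (s2 a) (lam (s1 b) y - lam (s2 b) y))
                (- lam (s1 b) (lam (s1 a) y - lam (s2 a) y)).
  by rewrite !normN !norm_lam; lra.
- exists (La ++ Lb), (na + nb)%N; split.
    by move=> k; rewrite mem_cat => /orP[/LaP|/LbP].
  move=> s1 s2 y e s1M s2M s12 ye.
  have h1 : norm (lam (s1 a) y - y) <= na%:R * e.
    apply: ha s1M s2M _ _ => [k k' kL kL'|k kL].
      by apply: s12; rewrite mem_cat ?kL ?kL'.
    by apply: ye; rewrite mem_cat kL.
  have h2 : norm (lam (s1 b) y - y) <= nb%:R * e.
    apply: hb s1M s2M _ _ => [k k' kL kL'|k kL].
      by apply: s12; rewrite mem_cat ?kL ?kL' orbT.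
    by apply: ye; rewrite mem_cat kL orbT.
  have -> : lam (s1 (a * b)%g) y - y =
      lam (s1 a) (lam (s1 b) y - y) + (lam (s1 a) y - y).
    by rewrite s1M lamM (linopB _ _ (linear_lam _)) addrA subrK.
  apply: le_trans (normD _ _) _.
  by rewrite norm_lam natrD mulrDl [leRHS]addrC; exact: lerD.
- exists La, na; split=> // s1 s2 y e s1M s2M s12 ye.
  have s1V : (s1 a^-1 = (s1 a)^-1)%g.
    by apply/esym/mulg1_eq; rewrite -s1M mulgV morph1.
  have := ha s1 s2 y e s1M s2M s12 ye; rewrite s1V.
  rewrite -(norm_lam (s1 a)^-1%g) (linopB _ _ (linear_lam _)) lamK.
  by rewrite distC.
Qed.

Lemma fixes_common (L : seq G) : (forall k, k \in L -> trivial_near act x0 k) ->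
  exists U, [/\ open U, U x0 & forall k, k \in L -> fixes U k].
Proof.
elim: L => [|k L IH] kL; first by exists setT; split=> //; exact: openT.
have [|U [oU Ux UL]] := IH; first by move=> h hL; apply: kL; rewrite in_cons hL orbT.
have : nbhs x0 [set z | act k z = z] := kL k (mem_head _ _).
rewrite nbhsE => -[V [oV Vx] Vk].
exists (U `&` V); split; [exact: openI|by []|].
move=> h; rewrite in_cons => /predU1P[->|hL] z [Uz Vz]; first exact: Vk.
exact: UL.
Qed.

(** The elements fixing U are conjugated into the displaced set W on which the
    averages persist.  Almost norming vectors for the average of all k t k^-1 t^-1
    are almost fixed by each of them, by uniform convexity. *)
Lemma almost_equal_copies I U (L : seq G) (e : R) : closed_ideal A I ->
  ~ vanishing_averages act I -> open U -> U !=set0 ->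
  (forall k, k \in L -> fixes U k) -> 0 < e ->
  exists h t, let s k := (h * k * h^-1)%g in
    (forall a b, a \in L -> b \in L ->
      (s a * (t * s b * t^-1) = t * s b * t^-1 * s a)%g) /\
    forall S, I S -> exists y, [/\ 1 - e <= norm y, norm y <= 1 + e, norm (S y) <= e &
      forall k, k \in L -> norm (lam (s k) y - lam (t * s k * t^-1)%g y) <= e].
Proof.
move=> Iid nIv oU U0 LU e0; pose n : R := (size L).+1%:R.
have n1 : 1 <= n by rewrite ler1n.
have n0 : 0 < n by apply: lt_le_trans n1.
pose eta : R := Num.min (n^-1) (Num.min e (e ^+ 2 / (20 * n))).
have eta0 : 0 < eta.
  by rewrite /eta !lt_min invr_gt0 n0 e0 divr_gt0 ?exprn_gt0// mulr_gt0.
have [eta1 eta2 eta3] : [/\ eta <= n^-1, eta <= e & eta <= e ^+ 2 / (20 * n)].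
  by rewrite /eta; split; rewrite !ge_min lexx ?orbT.
have neta : n * eta <= 1 by rewrite -ler_pdivlMl// mulr1.
have eta4 : eta <= 1 by rewrite (le_trans eta1)// invf_le1.
have [|t [W [tW Wks]]] := persistent_averages act_axioms (d := eta) Iid nIv.
  by rewrite eta0.
have [oW W0 _] := tW.
have [h hU] := act_proximal act_axioms oU U0 oW W0.
have sW k : k \in L -> fixes (~` W) (h * k * h^-1)%g.
  move=> /LU; apply: (fixes_conj act_axioms) => z nW.
  by apply: contrapT => /hU; rewrite (actVK act_axioms).
exists h, t => s; have comm a b : a \in L -> b \in L ->
    (s a * (t * s b * t^-1) = t * s b * t^-1 * s a)%g.
  by move=> /sW fa /sW fb; exact: (displaced_commute act_axioms tW fb fa).
split=> // S IS; pose ks := 1%g :: [seq s k | k <- L].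
have ksW : supported_list act W ks.
  split=> // k; rewrite in_cons => /predU1P[->|]; first exact: fixes1 act_axioms _.
  by move=> /mapP[k' /sW ? ->].
have [y [y1 my Sy]] := approximate_vector Iid IS
  (reduced_Cstar_avg _ _ _) (Wks ks ksW) eta0.
have sz : size ks = (size L).+1 by rewrite /= size_map.
have tw1 : twisted t 1%g y = y.
  by rewrite /twisted mul1g invg1 mulg1 mulgV lam1.
have normm : n * norm (avg ks (twisted t) y) =
    norm (y + \sum_(v <- [seq twisted t (s k) y | k <- L]) v).
  rewrite avgE normZ normc_real ?invr_ge0// sz mulrA mulfV ?gt_eqF// mul1r.
  by rewrite big_cons tw1 !big_map.
have ny : 1 - eta <= norm y.
  apply: le_trans my _; rewrite -(ler_pM2l n0) normm.
  apply: le_trans (normD _ _) _.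
  rewrite /n -natr1 addrC mulrDl mul1r lerD2r big_map.
  apply: le_trans (norm_sum _ _) _.
  under eq_bigr do rewrite norm_lam.
  by rewrite big_const_seq count_predT iter_addr addr0 mulr_natl.
exists y; split.
- by apply: le_trans ny; rewrite lerD2l lerN2.
- by apply: le_trans y1 _; rewrite lerD2l.
- exact: le_trans Sy eta2.
move=> k kL; have vs : twisted t (s k) y \in [seq twisted t (s k) y | k <- L].
  exact: map_f.
have := almost_equal (eta := eta) vs; rewrite size_map => /(_ y) almost.
have {almost} : nsq (y - twisted t (s k) y) <= 20 * n * eta.
  apply: almost => //; first by rewrite (ltW eta0).
    move=> u; rewrite in_cons => /predU1P[->//|/mapP[k' _ ->]].
    by rewrite /twisted norm_lam.
  by rewrite -normm ler_pM2l.
have -> : norm (lam (s k) y - lam (t * s k * t^-1)%g y) = norm (y - twisted t (s k) y).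
  have tst : ((t * s k * t^-1)^-1 = t * (s k)^-1 * t^-1)%g.
    by rewrite !invgM invgK mulgA.
  have -> : twisted t (s k) y = lam (t * s k * t^-1)^-1%g (lam (s k) y).
    rewrite -lamM /twisted -[in LHS]mulgA -[in LHS]mulgA [X in (_ * X)%g]mulgA -tst.
    congr (lam _ _); apply: (mulIg (t * s k * t^-1)%g); rewrite mulgVK.
    by rewrite -mulgA comm// mulgA mulVg mul1g.
  set w := (t * s k * t^-1)%g.
  have -> : y - lam w^-1%g (lam (s k) y) = lam w^-1%g (lam w y - lam (s k) y).
    by rewrite (linopB _ _ (linear_lam _)) lamK.
  by rewrite norm_lam distC.
move=> h1; rewrite -(ler_pXn2r (n := 2))// ?nnegrE ?norm_ge0 ?(ltW e0)// normE.
by apply: le_trans h1 _; rewrite mulrC -ler_pdivlMr// mulr_gt0.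
Qed.

(** The elements of l are products of commutators of elements that fix a common
    neighbourhood of x0; thus a conjugate of l almost multiplies by the sum of
    its coefficients some vectors of norm almost 1, on which the ideal almost
    vanishes.  In other words, the trivial representation of the group of
    elements with trivial germ at x0 is weakly contained in the quotient. *)
Lemma augmentation_bound I (l : seq (C * G)) (e : R) : closed_ideal A I ->
  ~ vanishing_averages act I -> (forall q, q \in l -> trivial_near act x0 q.2) ->
  0 <= e -> near_ideal I (gr l) e -> normc (\sum_(q <- l) q.1) <= e.
Proof.
move=> Iid nIv lx e0 Ie.
have [L [n [LP Ln]]] : exists (L : seq G) (n : nat),
    (forall k, k \in L -> trivial_near act x0 k) /\
    forall (s1 s2 : G -> G) y (e : R), 0 <= e ->
      {morph s1 : a b / (a * b)%g} -> {morph s2 : a b / (a * b)%g} ->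
      (forall a b, a \in L -> b \in L -> (s1 a * s2 b = s2 b * s1 a)%g) ->
      (forall k, k \in L -> norm (lam (s1 k) y - lam (s2 k) y) <= e) ->
      forall q, q \in l -> norm (lam (s1 q.2) y - y) <= n%:R * e.
  elim: l lx {Ie} => [|q l IH] lx; first by exists [::], 0%N.
  have [|L [n [LP Ln]]] := IH; first by move=> q' ql; apply: lx; rewrite in_cons ql orbT.
  have := act_perfect act_axioms (lx q (mem_head _ _)).
  case/commutator_almost_fixed.
    move=> a b; rewrite /trivial_near /=; apply: filterS2 => z az bz.
    by rewrite (actM act_axioms) bz.
  move=> L' [n' [LP' Ln']]; exists (L ++ L'), (n + n')%N; split.
    by move=> k; rewrite mem_cat => /orP[/LP|/LP'].
  move=> s1 s2 y d d0 s1M s2M s12 ye q'; rewrite in_cons => /predU1P[->|q'l].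
    apply: le_trans (_ : _ <= n'%:R * d) _; last first.
      by rewrite ler_wpM2r// ler_nat leq_addl.
    apply: Ln' s1M s2M _ _ => [k k' kL kL'|k kL].
      by apply: s12; rewrite mem_cat ?kL ?kL' orbT.
    by apply: ye; rewrite mem_cat kL orbT.
  apply: le_trans (_ : _ <= n%:R * d) _; last first.
    by rewrite ler_wpM2r// ler_nat leq_addr.
  apply: Ln d0 s1M s2M _ _ _ q'l => [k k' kL kL'|k kL].
    by apply: s12; rewrite mem_cat ?kL ?kL'.
  by apply: ye; rewrite mem_cat kL.
have [U [oU Ux UL]] := fixes_common LP.
set c := normc _; have c0 : 0 <= c by exact: normc_ge0.
pose K := \sum_(q <- l) normc q.1.
have K0 : 0 <= K by apply: sumr_ge0 => q _; exact: normc_ge0.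
apply/ler_addgt0Pr => d d0.
pose B := c + e + 1 + K * n%:R.
have B0 : 0 < B.
  by rewrite /B ltr_pwDl ?mulr_ge0// ltr_wpDl// addr_ge0.
pose eta := d / B; have eta0 : 0 < eta by rewrite divr_gt0.
have U0 : U !=set0 by exists x0.
have [h [t [comm vect]]] := almost_equal_copies Iid nIv oU U0 UL eta0.
pose s k := (h * k * h^-1)%g.
have [T IT lT] := near_conj h Iid (reduced_Cstar_gr l) Ie.
have [y [y1 y2 Ty ys]] := vect T IT.
have sM : {morph s : a b / (a * b)%g} by move=> a b; rewrite /s !mulgA mulgVK.
have tsM : {morph (fun k => t * s k * t^-1)%g : a b / (a * b)%g}.
  by move=> a b; rewrite /s !mulgA !mulgVK.
have fixl := Ln s _ y _ (ltW eta0) sM tsM comm ys.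
have grs : conj_op h (gr l) y = \sum_(q <- l) q.1 *: lam (s q.2) y.
  by rewrite conj_op_gr grE big_map.
have h1 : norm (conj_op h (gr l) y - (\sum_(q <- l) q.1) *: y) <= K * (n%:R * eta).
  rewrite grs scaler_suml -sumrB; apply: le_trans (norm_sum _ _) _.
  rewrite mulr_suml big_seq [leRHS]big_seq; apply: ler_sum => q ql.
  by rewrite -scalerBr normZ ler_wpM2l ?normc_ge0// fixl.
have h2 : norm (conj_op h (gr l) y - T y) <= e * norm y by have := lT y; rewrite opB.
have h3 : c * norm y <= e * norm y + eta + K * (n%:R * eta).
  rewrite -normZ; set v := _ *: y in h1 *; set u := conj_op h (gr l) y in h1 h2.
  have -> : v = (u - T y) + T y - (u - v) by rewrite subrK opprB addrC subrK.
  apply: le_trans (normB _ _) _; apply: lerD => //.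
  by apply: le_trans (normD _ _) _; apply: lerD.
have h4 : c * (1 - eta) <= c * norm y by rewrite ler_wpM2l.
have h5 : e * norm y <= e * (1 + eta) by rewrite ler_wpM2l.
have -> : d = eta * B by rewrite /eta divfK// gt_eqF.
rewrite /B; lra.
Qed.

(** A point moved by g has a neighbourhood displaced by g, since the space is
    Hausdorff; there is one such shrinking for each g. *)
Lemma fixes_or_displaced (gs : seq G) : exists U, [/\ open U, U !=set0 &
  forall g, g \in gs -> fixes U g \/ forall z, U z -> ~ U (act g z)].
Proof.
elim: gs => [|g gs [U [oU U0 Ugs]]].
  by exists setT; split=> //; [exact: openT|exists x0].
have [fg|] := pselect (fixes U g).
  exists U; split=> // h; rewrite in_cons => /predU1P[->|]; [by left|exact: Ugs].
move=> /existsNP[z /not_implyP[Uz /eqP gz]].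
have [V [W [oV oW Vgz Wz VW]]] := separate act_axioms gz.
exists (U `&` (W `&` act g @^-1` V)); split.
- by apply: openI => //; apply: openI => //; exact: (open_act_preimage act_axioms).
- by exists z.
move=> h; rewrite in_cons => /predU1P[->|/Ugs[fh|dh]].
- by right=> x [_ [_ Vx]] [_ [Wx _]]; exact: VW Vx Wx.
- by left=> x [Ux _]; exact: fh.
- by right=> x [Ux _] [Uhx _]; exact: dh Ux Uhx.
Qed.

(** Conjugating by elements that push the complement of U into disjoint sets,
    the elements displacing U are brought to ping-pong position and averaged
    away, whereas the elements fixing U remain elements fixing a common open
    set, to which [augmentation_bound] applies after one more conjugation. *)
Lemma partial_augmentation_bound I (l : seq (C * G)) U (e : R) : closed_ideal A I ->
  ~ vanishing_averages act I -> open U -> U !=set0 ->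
  (forall q, q \in l -> fixes U q.2 \/ forall z, U z -> ~ U (act q.2 z)) ->
  0 <= e -> near_ideal I (gr l) e ->
  normc (\sum_(q <- l | `[< fixes U q.2 >]) q.1) <= e.
Proof.
move=> Iid nIv oU U0 lU e0 Ie.
pose K := \sum_(q <- l) normc q.1.
have K0 : 0 <= K by apply: sumr_ge0 => q _; exact: normc_ge0.
apply/ler_addgt0Pr => d d0.
have K1 : 0 < K + 1 by rewrite ltr_wpDl.
pose eps := d / (K + 1); have eps0 : 0 < eps by rewrite divr_gt0.
have [n n4] : exists n : nat, 4 / eps ^+ 2 <= n.+1%:R.
  exists (Num.bound (4 / eps ^+ 2)); apply: ltW.
  apply: lt_le_trans (archi_boundP _) _; first by rewrite divr_ge0// sqr_ge0.
  by rewrite ler_nat.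
(* n.+1 sets for the conjugates, and one more set that they all fix. *)
have [|V [oV Vdisj]] := disjoint_family act_axioms (n := n.+2) (M := fun=> setT).
  by move=> i _; split; [exact: openT|exists x0].
have /choice[p pV] : forall i : 'I_n.+1, exists p, forall z, ~ U z -> V i (act p z).
  move=> i; have [oVi Vi0 _] := oV i (ltnW (ltn_ord i)).
  exact: act_proximal act_axioms _ _ oU U0 oVi Vi0.
pose ps := [seq p i | i <- enum 'I_n.+1].
have szps : size ps = n.+1 by rewrite size_map size_enum_ord.
have ps0 : ps != [::] by rewrite -size_eq0 szps.
have averaged q : q \in l -> ~~ `[< fixes U q.2 >] ->
    near_ideal I (avg ps (fun p => lam (p * q.2 * p^-1)%g)) eps.
  move=> ql /asboolPn nf; case: (lU q ql) => // dq.
  apply: (near_ideal_bounded Iid) => x.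
  have epsx : 0 <= eps * norm x := mulr_ge0 (ltW eps0) (norm_ge0 x).
  rewrite -(ler_pXn2r (n := 2))// ?nnegrE ?norm_ge0//.
  rewrite avgE szps big_map_ord exprMn !normE nsqZ {1}/sqabs normc_real ?invr_ge0//.
  have := @ping_pong_sum R G n.+1 (fun i => p i * q.2 * (p i)^-1)%g
    (fun i h => `[< V i (act h x0) >]) x.
  move=> /(_ _ _)/(ler_wpM2l (sqr_ge0 (n.+1%:R^-1))) pp.
  apply: le_trans (pp _ _) _.
  - move=> i j h /asboolP Vi /asboolP Vj; apply/val_inj.
    by apply: Vdisj Vi Vj; rewrite ltnW// ltnS.
  - move=> i h /asboolPn nV; apply/asboolP; rewrite !(actM act_axioms); apply: (pV i).
    apply: dq; apply: contrapT => /(pV i).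
    by rewrite (actVK act_axioms).
  rewrite mulrA ler_wpM2r ?nsq_ge0// exprVn expr2 invfM.
  have nn : n.+1%:R != 0 :> R by rewrite pnatr_eq0.
  have -> : n.+1%:R^-1 / n.+1%:R * (4 * n.+1%:R) = 4 / n.+1%:R :> R by field.
  by rewrite ler_pdivrMr ?ltr0n// mulrC -ler_pdivrMr// exprn_gt0.
have := near_avg_conj Iid ps0 Ie; rewrite avg_conj_gr => near_avg_l.
have := near_part Iid (ltW eps0) near_avg_l averaged.
pose lU1 := [seq q <- l | `[< fixes U q.2 >]].
rewrite -big_filter -/lU1 -/K -avg_conj_gr => near_lU.
have [oVn Vn0 _] := oV n.+1 (ltnSn _).
have [h0 Vh0] : exists h0, V n.+1 (act h0 x0).
  have T0 : [set: X] !=set0 by exists x0.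
  have [V1 [V2 [[oV1 V10] [oV2 V20] _ _ V12]]] :=
    disjoint_pair act_axioms (@openT X) T0 (@openT X) T0.
  have [V1x|V1x] := pselect (V1 x0).
    have [h hV] := act_proximal act_axioms oV2 V20 oVn Vn0.
    by exists h; apply: hV; exact: V12.
  have [h hV] := act_proximal act_axioms oV1 V10 oVn Vn0.
  by exists h; exact: hV.
pose l1 := [seq (((size ps)%:R^-1 : R)%:C%C * q.1, (r * q.2 * r^-1)%g) | r <- ps, q <- lU1].
have grl1 : gr l1 = avg ps (fun r => conj_op r (gr lU1)).
  rewrite /avg /gr big_allpairs_dep scaler_sumr; apply: eq_bigr => r _ /=.
  rewrite -/(gr lU1) conj_op_gr /gr big_map scaler_sumr.
  by apply: eq_bigr => q _; rewrite scalerA.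
rewrite -grl1 in near_lU.
have near_l2 := near_conj h0^-1%g Iid (reduced_Cstar_gr l1) near_lU.
rewrite conj_op_gr in near_l2.
have e1 : 0 <= e + eps * K by rewrite addr_ge0// mulr_ge0// ltW.
have := augmentation_bound Iid nIv _ e1 near_l2; rewrite big_map /=.
have -> : \sum_(q <- l1) q.1 = \sum_(q <- lU1) q.1.
  rewrite /l1 big_allpairs_dep /=.
  under eq_bigr do rewrite -mulr_sumr.
  rewrite big_const_seq count_predT iter_addr addr0 -[LHS]mulr_natl mulrA.
  rewrite -(rmorph_nat (real_complex R)) -rmorphM mulfV ?rmorph1 ?mul1r//.
  by rewrite szps pnatr_eq0.
move=> bound; rewrite -big_filter -/lU1; apply: le_trans (bound _) _.
  move=> _ /mapP[q ql1 ->] /=; rewrite /trivial_near /=.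
  have nbh : nbhs x0 (act h0 @^-1` V n.+1).
    apply: open_nbhs_nbhs; split => //; exact: (open_act_preimage act_axioms).
  apply: filterS nbh => z Vz; move: ql1 => /allpairsP[[r q'] /= [/mapP[i _ ->] + ->]] /=.
  rewrite mem_filter => /andP[/asboolP fq _].
  have fpq : fixes (V n.+1) (p i * q'.2 * (p i)^-1)%g.
    apply: (fixes_conj act_axioms) fq => w Vw; apply: contrapT => /(pV i).
    rewrite (actVK act_axioms) => Vi.
    have /eqP := Vdisj i n.+1 w (ltnW (ltn_ord i)) (ltnSn _) Vi Vw.
    by rewrite ltn_eqF.
  by rewrite invgK (actM act_axioms) (actM act_axioms) fpq// (actK act_axioms).
rewrite lerD2l /eps mulrAC ler_pdivrMr// ler_wpM2l ?(ltW d0)//.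
by rewrite lerDl.
Qed.

(** The sum of the coefficients at the elements fixing a small open set U is
    almost 0 for approximations of S and of T, and it is 1 for the unit. *)
Lemma not_comaximal I J S T (e : R) : closed_ideal A I -> closed_ideal A J ->
  ~ vanishing_averages act I -> ~ vanishing_averages act J ->
  I S -> J T -> 0 <= e < 1 -> ~ bounded_by e (id - (S + T)).
Proof.
move=> Iid Jid nI nJ IS JT /andP[e0 e1] ST.
pose eps := (1 - e) / 8.
have eps0 : 0 < eps by rewrite divr_gt0// subr_gt0.
have /reduced_CstarP[_ /(_ _ eps0)[lS SlS]] := ideal_sub Iid IS.
have /reduced_CstarP[_ /(_ _ eps0)[lT TlT]] := ideal_sub Jid JT.
have [U [oU U0 Ul]] := fixes_or_displaced [seq q.2 | q <- lS ++ lT].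
pose neg (m : seq (C * G)) := [seq (-1 * q.1, q.2) | q <- m].
pose l := (1, 1%g) :: neg lS ++ neg lT.
pose sU (m : seq (C * G)) := \sum_(q <- m | `[< fixes U q.2 >]) q.1.
have grl : gr l = id - (S + T) + ((S - gr lS) + (T - gr lT)).
  rewrite /l gr_cons scale1r lam1E gr_cat !gr_scale !scaleN1r.
  apply/funext => x; rewrite !(opB, opD).
  set a := S x; set b := T x; set c := gr lS x; set d := gr lT x.
  by rewrite [a - c + _]addrACA [RHS]addrA subrK.
have near_l : near_ideal I (gr l) (e + (eps + eps)).
  apply: (near_ideal_bounded Iid); rewrite grl.
  by apply: bounded_byD => //; exact: bounded_byD.
have near_lS : near_ideal I (gr lS) eps by exists S => //; exact: bounded_byC.
have near_lT : near_ideal J (gr lT) eps by exists T => //; exact: bounded_byC.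
have UlS q : q \in lS -> fixes U q.2 \/ forall z, U z -> ~ U (act q.2 z).
  by move=> ql; apply: Ul; apply: map_f; rewrite mem_cat ql.
have UlT q : q \in lT -> fixes U q.2 \/ forall z, U z -> ~ U (act q.2 z).
  by move=> ql; apply: Ul; apply: map_f; rewrite mem_cat ql orbT.
have bS := partial_augmentation_bound Iid nI oU U0 UlS (ltW eps0) near_lS.
have bT := partial_augmentation_bound Jid nJ oU U0 UlT (ltW eps0) near_lT.
have e2 : 0 <= e + (eps + eps) by rewrite !addr_ge0 ?(ltW eps0).
have := partial_augmentation_bound Iid nI oU U0 _ e2 near_l.
have sneg m : \sum_(q <- neg m | `[< fixes U q.2 >]) q.1 = - sU m.
  by rewrite big_map /sU -sumrN; apply: eq_bigr => q _ /=; rewrite mulN1r.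
rewrite big_cons asboolT; last exact: fixes1 act_axioms _.
rewrite big_cat /= !sneg => bound.
have {bound} : normc (1 + (- sU lS - sU lT)) <= e + (eps + eps).
  apply: bound => q; rewrite in_cons => /predU1P[->|].
    by left; exact: fixes1 act_axioms _.
  by rewrite mem_cat => /orP[] /mapP[q' ql ->] /=; [exact: UlS|exact: UlT].
have := le_normcD (1 + (- sU lS - sU lT)) (sU lS + sU lT).
rewrite -addrA -opprD addNr addr0 ComplexField.Normc.normc1.
have := le_normcD (sU lS) (sU lT).
rewrite /sU in bS bT *; move: bS bT; rewrite /eps; lra.
Qed.

End Augmentation.

(** * The greatest proper ideal *)

Section UniqueMaximalIdeal.
Variables (R : realType) (G : groupType) (X : topologicalType).
Variables (act : G -> X -> X) (x0 : X).
Hypothesis act_axioms : extremely_proximal_action act x0.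
Local Notation H := (ell2 R G).
Local Notation A := (reduced_Cstar R G).
Implicit Types (S T : H -> H) (I J : set (H -> H)).

Lemma not_bounded_id (e : R) : e < 1 -> ~ bounded_by e (id : H -> H).
Proof.
by move=> e1 /(_ (delta R G)); rewrite norm_delta mulr1 leNgt e1.
Qed.

Lemma half_lt1 : (2^-1 : R) < 1.
Proof. by rewrite invf_lt1// ltr1n. Qed.

Lemma zero_ideal_closure : let Z := norm_closure [set (0 : H -> H)] in
  closed_ideal A Z /\ ~ Z id.
Proof.
split.
  apply: closed_ideal_closure; first exact: reduced_Cstar_algebra.
  have [_ _ A0 _ _] := reduced_Cstar_algebra R G; split=> //.
  - by move=> S ->.
  - by move=> a S T -> ->; rewrite scaler0 addr0.
  - move=> S T AS ->; have Sl := reduced_Cstar_linear AS; split; last by [].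
    by apply/funext => x /=; exact: linop0.
move=> /norm_closureP[|_ /(_ 2^-1)].
  by move=> S ->; exact: bounded_operator0.
rewrite invr_gt0 ltr0n => /(_ isT)[T ->]; rewrite subr0.
exact: not_bounded_id half_lt1.
Qed.

Lemma proper_ideals_directed I J : closed_ideal A I -> ~ I id ->
  closed_ideal A J -> ~ J id ->
  exists K, [/\ closed_ideal A K, ~ K id, I `<=` K & J `<=` K].
Proof.
move=> Iid I1 Jid J1.
have [I0|/existsNP[S /not_implyP[IS S0]]] := pselect (forall S, I S -> S = 0).
  by exists J; split=> // S /I0 ->; exact: in_ideal0 Jid.
have [J0|/existsNP[T /not_implyP[JT T0]]] := pselect (forall T, J T -> T = 0).
  by exists I; split=> // T /J0 ->; exact: in_ideal0 Iid.
have nI : ~ vanishing_averages act I.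
  by move=> vI; apply: I1; exact (vanishing_averages_full act_axioms Iid vI IS S0).
have nJ : ~ vanishing_averages act J.
  by move=> vJ; apply: J1; exact (vanishing_averages_full act_axioms Jid vJ JT T0).
pose K : set (H -> H) := [set U | exists S T, [/\ I S, J T & U = S + T]].
have [_ _ _ AD _] := reduced_Cstar_algebra R G.
have KA : K `<=` A.
  move=> _ [S' [T' [IS' JT' ->]]]; rewrite -[S']scale1r.
  exact (AD 1 S' T' (ideal_sub Iid IS') (ideal_sub Jid JT')).
have Kb : K `<=` @bounded_operator R G by move=> U /KA; exact: reduced_Cstar_bounded.
exists (norm_closure K); split.
- apply: closed_ideal_closure; first exact: reduced_Cstar_algebra.
  split=> //.
  + exists 0, 0; split; [exact: in_ideal0 Iid|exact: in_ideal0 Jid|by rewrite addr0].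
  + move=> a _ _ [S1 [T1 [IS1 JT1 ->]]] [S2 [T2 [IS2 JT2 ->]]].
    exists (a *: S1 + S2), (a *: T1 + T2); split.
    * exact (ideal_comb Iid a IS1 IS2).
    * exact (ideal_comb Jid a JT1 JT2).
    * by rewrite scalerDr addrACA.
  + move=> U _ AU [S1 [T1 [IS1 JT1 ->]]]; have Ul := reduced_Cstar_linear AU.
    split.
      exists (U \o S1), (U \o T1); split.
      * exact (in_idealMl Iid AU IS1).
      * exact (in_idealMl Jid AU JT1).
      * by apply/funext => x; rewrite opD /= opD linopD.
    exists (S1 \o U), (T1 \o U); split=> //.
    * exact (in_idealMr Iid AU IS1).
    * exact (in_idealMr Jid AU JT1).
- move=> /(norm_closureP _ Kb)[_ /(_ 2^-1)]; rewrite invr_gt0 ltr0n => /(_ isT).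
  move=> [_ [S1 [T1 [IS1 JT1 ->]]]].
  apply: (not_comaximal act_axioms Iid Jid nI nJ IS1 JT1).
  by rewrite invr_ge0 ler0n half_lt1.
- move=> S' IS'; apply: sub_norm_closure => //; exists S', 0; split=> //.
    exact: in_ideal0 Jid.
  by rewrite addr0.
- move=> T' JT'; apply: sub_norm_closure => //; exists 0, T'; split=> //.
    exact: in_ideal0 Iid.
  by rewrite add0r.
Qed.

(** The maximal ideal is the closure of the union of all the proper ideals. *)
Lemma unique_maximal_ideal_of_action : exists! I, maximal_ideal A I.
Proof.
pose M : set (H -> H) := [set S | exists I, [/\ closed_ideal A I, ~ I id & I S]].
have MA : M `<=` A by move=> S [I [Iid _ IS]]; exact: ideal_sub Iid _ IS.
have Mb : M `<=` @bounded_operator R G by move=> U /MA; exact: reduced_Cstar_bounded.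
have Mid : two_sided_ideal A M.
  split=> //.
  - have [Zid Z1] := zero_ideal_closure.
    by exists (norm_closure [set 0]); split=> //; exact: in_ideal0 Zid.
  - move=> a S T [I [Iid I1 IS]] [J [Jid J1 JT]].
    have [K [Kid K1 IK JK]] := proper_ideals_directed Iid I1 Jid J1.
    exists K; split=> //; exact (ideal_comb Kid a (IK _ IS) (JK _ JT)).
  - move=> S T AS [I [Iid I1 IT]]; split; exists I; split=> //.
    + exact (in_idealMl Iid AS IT).
    + exact (in_idealMr Iid AS IT).
pose K := norm_closure M.
have Kid : closed_ideal A K.
  exact (closed_ideal_closure (@reduced_Cstar_algebra R G) Mid).
have K1 : ~ K id.
  move=> /(norm_closureP _ Mb)[_ /(_ 2^-1)]; rewrite invr_gt0 ltr0n => /(_ isT).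
  move=> [S [I [Iid I1 IS]] S1]; apply: I1; apply: (near_ideal_id Iid half_lt1).
  by exists S.
have sub_K J : closed_ideal A J -> J <> A -> J `<=` K.
  move=> Jid /(ideal_properP Jid) J1 S JS; apply: sub_norm_closure => //.
  by exists J.
have Kmax J : closed_ideal A J -> J <> A -> K `<=` J -> J = K.
  move=> Jid JA KJ; apply/seteqP; split=> //; exact: sub_K.
have KA : K <> A by apply/(ideal_properP Kid).
exists K; split; first by split.
move=> J [Jid JA Jmax]; exact: Jmax Kid KA (sub_K _ Jid JA).
Qed.

End UniqueMaximalIdeal.

(** * Topology of the circle *)

Local Open Scope quotient_scope.

Section Circle.
Variable R : realType.
Local Notation circle := (circle R).
Local Notation pi := (\pi_circle : R -> circle).
Implicit Types (x y t : R) (z w : circle).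

Lemma piDint x (m : int) : pi (x + m%:~R) = pi x.
Proof. by apply/eq_circle; rewrite addrC addKr intr_int. Qed.

Lemma eq_pi_int x y : pi x = pi y -> exists m : int, x = y + m%:~R.
Proof.
by move=> /eq_circle/intrP[m xy]; exists m; rewrite -xy addrC subrK.
Qed.

Lemma small_int (x : R) : x \is a Num.int -> -1 < x < 1 -> x = 0.
Proof.
move=> /intrP[m ->] /andP[m1 m2].
have {}m1 : -1 < m by rewrite -(ltr_int R).
have {}m2 : m < 1 by rewrite -(ltr_int R).
by have -> : m = 0 by lia.
Qed.

Lemma pi_inj01 x y : 0 <= x < 1 -> 0 <= y < 1 -> pi x = pi y -> x = y.
Proof.
move=> /andP[x0 x1] /andP[y0 y1] /eq_circle/small_int xy.
by apply/eqP; rewrite -subr_eq0; apply/eqP/xy; lra.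
Qed.

Definition rep01 z : R := repr z - (Num.floor (repr z))%:~R.

Lemma rep01P z : 0 <= rep01 z < 1.
Proof.
have /andP[m1 m2] := floor_itv (repr z).
by rewrite /rep01 subr_ge0 m1 /= ltrBlDl -intrD1.
Qed.

Lemma rep01K z : pi (rep01 z) = z.
Proof.
by rewrite -[RHS]reprK /rep01 -intrN piDint.
Qed.

Lemma rep01_pi x : 0 <= x < 1 -> rep01 (pi x) = x.
Proof. by move=> x01; apply: pi_inj01 (rep01P _) x01 _; rewrite rep01K. Qed.

Lemma open_circleP (U : set circle) : open U = open (pi @^-1` U).
Proof. by []. Qed.

Lemma continuous_circle (Y : topologicalType) (f : circle -> Y) :
  continuous (f \o pi) -> continuous f.
Proof.
move=> fc; apply/continuousP => U oU; rewrite open_circleP.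
by have /continuousP := fc; apply.
Qed.

Lemma continuous_pi : continuous pi.
Proof. exact: pi_continuous. Qed.

(** The saturation of an open set is a union of integer translates. *)
Lemma open_pi (U : set R) : open U -> open (pi @` U).
Proof.
move=> oU; rewrite open_circleP openE => y [u Uu uy].
have [m yE] := eq_pi_int (esym uy).
have nu : nbhs u U by exact: open_nbhs_nbhs.
have cu : t - m%:~R @[t --> y] --> u.
  by rewrite -(addrK m%:~R u) -yE; apply: cvgB; [exact: cvg_id|exact: cvg_cst].
have h : \forall t \near y, U (t - m%:~R) := cu _ nu.
apply: filterS h => t Ut; exists (t - m%:~R) => //.
by rewrite -intrN piDint.
Qed.

Lemma circle_hausdorff : hausdorff_space circle.
Proof.
rewrite open_hausdorff => z w zw.
pose x := rep01 z; pose y := rep01 w; pose d := x - y.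
pose f := d - (Num.floor d)%:~R.
have /andP[m1 m2] := floor_itv d.
have f1 : f < 1 by rewrite /f ltrBlDl -intrD1.
have f0 : 0 < f.
  rewrite lt_def subr_ge0 m1 andbT subr_eq0; apply: contraNneq zw => dm.
  rewrite -(rep01K z) -(rep01K w); apply/eqP/eq_circle.
  by rewrite -/x -/y -/d dm intr_int.
pose e := Num.min f (1 - f) / 2.
have e0 : 0 < e by rewrite divr_gt0// lt_min f0 subr_gt0.
have [ef ef'] : e * 2 <= f /\ e * 2 <= 1 - f.
  by rewrite /e divfK// !ge_min !lexx orbT.
exists (pi @` ball x e, pi @` ball y e) => /=.
  split; apply/mem_set; [exists x; rewrite ?rep01K//|exists y; rewrite ?rep01K//];
  exact: ballxx.
split; [exact/open_pi/ball_open|exact/open_pi/ball_open|].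
apply/eqP/seteqP; split=> // c [[a xa ac] [b yb bc]].
have [m abm] : exists m : int, a = b + m%:~R by apply: eq_pi_int; rewrite ac bc.
move: xa yb; rewrite /ball /= !ltr_norml => /andP[xa1 xa2] /andP[yb1 yb2].
have : -1 < ((m - Num.floor d)%:~R : R) < 1.
  by rewrite intrB; move: f0 f1 ef ef'; rewrite /f /d; lra.
move=> /(small_int (intr_int _ _)); rewrite intrB => /eqP; rewrite subr_eq0 => /eqP md.
move: f0 f1 ef ef'; rewrite /f -md /d; lra.
Qed.

Lemma open_contains_arc (U : set circle) : open U -> U !=set0 ->
  exists (d : R) (k : nat), dyadic d /\
    forall x, d <= x <= d + 2 ^- k -> U (pi x).
Proof.
move=> oU [z Uz]; have x0 : (pi @^-1` U) (rep01 z) by rewrite /= rep01K.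
have : nbhs (rep01 z) (pi @^-1` U) by apply: open_nbhs_nbhs; split.
move=> /dyadic_dense[d dd Ud].
have : nbhs d (pi @^-1` U) by apply: open_nbhs_nbhs; split.
move=> /nbhs_ballP[e /= e0 eU].
exists d, (Num.bound e^-1); split=> // x /andP[x1 x2]; apply: eU.
have ne : e^-1 < 2 ^+ Num.bound e^-1 by apply: upper_nthrootP.
have {}ne : 2 ^- Num.bound e^-1 < e.
  by rewrite -[ltRHS]invrK ltf_pV2// posrE ?invr_gt0// exprn_gt0.
rewrite /ball /= ltr_norml; apply/andP; split; lra.
Qed.

Lemma circle_no_isolated (U : set circle) : open U -> U !=set0 ->
  exists z w, [/\ U z, U w & z != w].
Proof.
move=> oU U0; have [d [k [_ dk]]] := open_contains_arc oU U0.
have p0 : 0 < 2 ^- k.+1 :> R by rewrite invr_gt0 exprn_gt0.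
have p1 : 2 ^- k = 2 * 2 ^- k.+1 :> R by rewrite exprS invfM mulVKf// pnatr_eq0.
have p2 : 2 ^- k <= 1 :> R by rewrite invf_le1 ?exprn_gt0// exprn_ege1// ler1n.
exists (pi d), (pi (d + 2 ^- k.+1)); split; [apply: dk|apply: dk|]; try by lra.
apply/eqP => /eq_circle/small_int h.
have := h; rewrite opprD addrA subrr sub0r; lra.
Qed.

End Circle.

(** * Maps between dyadic subdivisions *)

Section DyadicSubdivisions.
Variable R : realType.
Local Notation circle := (circle R).
Local Notation pi := (\pi_circle : R -> circle).
Implicit Types (f g h : circle -> circle) (a b c s t x y : R) (u v w : seq nat).

Definition width (e : nat) : R := 2 ^- e.

Definition total u : R := \sum_(e <- u) width e.

Lemma width_gt0 e : 0 < width e.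
Proof. by rewrite /width invr_gt0 exprn_gt0. Qed.

Lemma widthS e : width e = width e.+1 + width e.+1.
Proof. by rewrite /width exprS invfM; field. Qed.

Lemma total_nil : total [::] = 0. Proof. by rewrite /total big_nil. Qed.

Lemma total_cons e u : total (e :: u) = width e + total u.
Proof. by rewrite /total big_cons. Qed.

Lemma total_cat u v : total (u ++ v) = total u + total v.
Proof. by rewrite /total big_cat. Qed.

Lemma total_ge0 u : 0 <= total u.
Proof. by apply: sumr_ge0 => e _; exact/ltW/width_gt0. Qed.

Lemma dyadic_width e : dyadic (width e).
Proof. by exists 1, e; rewrite mul1r. Qed.

(** Subdivisions are lists of exponents, e standing for an arc of width 2^-e, and
    a pair of lists of the same size encodes a piecewise linear map; this turns
    computations in the group into surgery on lists. *)
Fixpoint affine_on f a b u v : Prop :=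
  match u, v with
  | [::], [::] => True
  | e :: u', e' :: v' =>
      (forall s, 0 <= s <= 1 -> f (pi (a + s * width e)) = pi (b + s * width e')) /\
      affine_on f (a + width e) (b + width e') u' v'
  | _, _ => False
  end.

Lemma affine_on_size f a b u v : affine_on f a b u v -> size u = size v.
Proof.
by elim: u v a b => [|e u IH] [|e' v] //= a b [_ /IH ->].
Qed.

Lemma affine_on_cat f a b u1 u2 v1 v2 : size u1 = size v1 ->
  affine_on f a b (u1 ++ u2) (v1 ++ v2) <->
  affine_on f a b u1 v1 /\ affine_on f (a + total u1) (b + total v1) u2 v2.
Proof.
elim: u1 v1 a b => [|e u1 IH] [|e' v1] // a b; first by rewrite /= total_nil !addr0; tauto.
by move=> [/IH uv] /=; rewrite uv !total_cons !addrA; tauto.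
Qed.

Lemma affine_on_comp f g a b c u v w :
  affine_on f a b u v -> affine_on g b c v w -> affine_on (g \o f) a c u w.
Proof.
elim: u v w a b c => [|e u IH] [|e' v] [|e'' w] //= a b c [fe fu] [ge gv].
by split; [move=> s s01; rewrite fe// ge|exact: IH gv].
Qed.

Lemma affine_on_can f g a b u v : cancel f g ->
  affine_on f a b u v -> affine_on g b a v u.
Proof.
move=> fg; elim: u v a b => [|e u IH] [|e' v] //= a b [fe fu].
by split; [move=> s s01; rewrite -fe// fg|exact: IH].
Qed.

(** An affine map sends halves to halves: a pair of subdivisions can be refined
    without changing the map. *)
Lemma affine_on_split f a b u1 u2 v1 v2 e e' : size u1 = size v1 ->
  affine_on f a b (u1 ++ e :: u2) (v1 ++ e' :: v2) <->
  affine_on f a b (u1 ++ [:: e.+1, e.+1 & u2]) (v1 ++ [:: e'.+1, e'.+1 & v2]).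
Proof.
move=> uv; rewrite !affine_on_cat//=.
set a' := a + total u1; set b' := b + total v1.
rewrite -(addrA a' (width _)) -(addrA b' (width _)) -!widthS.
split=> -[h1]; [move=> [h2 h3]|move=> [h2 [h3 h4]]]; split=> //.
  split; [|split=> //] => s /andP[s0 s1].
    have -> : s * width e.+1 = s / 2 * width e by rewrite (widthS e); field.
    have -> : s * width e'.+1 = s / 2 * width e' by rewrite (widthS e'); field.
    by apply: h2; apply/andP; split; lra.
  have -> : a' + width e.+1 + s * width e.+1 = a' + (1 + s) / 2 * width e.
    by rewrite (widthS e); field.
  have -> : b' + width e'.+1 + s * width e'.+1 = b' + (1 + s) / 2 * width e'.
    by rewrite (widthS e'); field.
  by apply: h2; apply/andP; split; lra.
split=> // s /andP[s0 s1]; have [s2|s2] := lerP s (1 / 2).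
  have -> : s * width e = (2 * s) * width e.+1 by rewrite (widthS e); ring.
  have -> : s * width e' = (2 * s) * width e'.+1 by rewrite (widthS e'); ring.
  by apply: h2; apply/andP; split; lra.
have -> : a' + s * width e = a' + width e.+1 + (2 * s - 1) * width e.+1.
  by rewrite (widthS e); ring.
have -> : b' + s * width e' = b' + width e'.+1 + (2 * s - 1) * width e'.+1.
  by rewrite (widthS e'); ring.
by apply: h3; apply/andP; split; lra.
Qed.

Lemma affine_on_eq f g a b u v : affine_on f a b u v -> affine_on g a b u v ->
  forall t, a <= t <= a + total u -> u != [::] -> f (pi t) = g (pi t).
Proof.
elim: u v a b => [|e u IH] [|e' v] //= a b [fe fu] [ge gu] t /andP[t1].
rewrite total_cons addrA => t2 _; have [te|te] := lerP t (a + width e).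
  have w0 := width_gt0 e; have -> : t = a + (t - a) / width e * width e.
    by rewrite divfK ?gt_eqF// addrC subrK.
  rewrite fe ?ge// divr_ge0 ?subr_ge0 ?(ltW w0)//= ler_pdivrMr// mul1r; lra.
case: u fu gu t2 IH => [|e1 u] fu gu t2 IH; first by move: t2; rewrite total_nil addr0 leNgt te.
by apply: IH fu gu _ _ _ => //; rewrite (ltW te).
Qed.

Lemma affine_on_fun_eq f g u v : total u = 1 ->
  affine_on f 0 0 u v -> affine_on g 0 0 u v -> f = g.
Proof.
move=> u1 fu gu; apply/funext => z; rewrite -(rep01K z).
apply: (affine_on_eq fu gu); last by apply: contra_eq_neq u1 => ->; rewrite total_nil eq_sym oner_eq0.
by have /andP[z0 z1] := rep01P z; rewrite u1 add0r z0 ltW.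
Qed.

Lemma affine_on_id a u : affine_on id a a u u.
Proof. by elim: u a => [|e u IH] a //=; split. Qed.

(** ** Piecewise linear homeomorphisms from subdivisions *)

Definition clamp c t := Num.min (Num.max t 0) c.

Lemma clamp_le0 c t : 0 < c -> t <= 0 -> clamp c t = 0.
Proof. by move=> c0 t0; rewrite /clamp max_r// min_l// ltW. Qed.

Lemma clamp_ge c t : 0 < c -> c <= t -> clamp c t = c.
Proof.
move=> c0 ct; have t0 := le_trans (ltW c0) ct.
by rewrite /clamp max_l// min_r.
Qed.

Lemma clamp_id c t : 0 <= t <= c -> clamp c t = t.
Proof. by move=> /andP[t0 tc]; rewrite /clamp max_l// min_l. Qed.

(** Written as a sum of clamped linear functions, the interpolating function is
    visibly continuous. *)
Fixpoint interpolate u v t : R :=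
  match u, v with
  | e :: u', e' :: v' =>
      width e' / width e * clamp (width e) t + interpolate u' v' (t - width e)
  | _, _ => 0
  end.

Lemma continuous_interpolate u v : continuous (interpolate u v).
Proof.
elim: u v => [|e u IH] [|e' v] t /=; try exact: cst_continuous.
apply: (@continuousD _ R^o _ (fun t => width e' / width e * clamp (width e) t)
  (fun t => interpolate u v (t - width e))); last first.
  apply: (@continuous_comp _ _ _ (fun t => t - width e) (interpolate u v)); last exact: IH.
  by apply: continuousB; [exact: cvg_id|exact: cst_continuous].
apply: continuousM; first exact: cst_continuous.
apply: (@continuous_min _ _ (fun t => Num.max t 0) (fun=> width e)); last exact: cst_continuous.
by apply: (@continuous_max _ _ id (fun=> 0)); [exact: cvg_id|exact: cst_continuous].
Qed.

Lemma interpolate_le0 u v t : t <= 0 -> interpolate u v t = 0.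
Proof.
elim: u v t => [|e u IH] [|e' v] t //= t0.
rewrite clamp_le0 ?width_gt0// mulr0 add0r IH//.
by have := width_gt0 e; lra.
Qed.

Lemma interpolate_ge u v t : size u = size v -> total u <= t ->
  interpolate u v t = total v.
Proof.
elim: u v t => [|e u IH] [|e' v] t //=; first by rewrite total_nil.
move=> [uv]; rewrite !total_cons => ut.
rewrite clamp_ge ?width_gt0//; last by have := total_ge0 u; lra.
by rewrite divfK ?gt_eqF ?width_gt0// IH//; lra.
Qed.

Lemma affine_on_interpolate f a b u v : size u = size v ->
  (forall t, a <= t <= a + total u -> f (pi t) = pi (b + interpolate u v (t - a))) ->
  affine_on f a b u v.
Proof.
elim: u v a b => [|e u IH] [|e' v] //= a b [uv] fi; rewrite total_cons in fi.
have w0 := width_gt0 e; have tu := total_ge0 u; split=> [s /andP[s0 s1]|].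
  have sw0 : 0 <= s * width e by rewrite mulr_ge0// ltW.
  have sw1 : s * width e <= width e by rewrite ler_piMl// ltW.
  rewrite fi; last by apply/andP; split; lra.
  have -> : a + s * width e - a = s * width e by ring.
  rewrite clamp_id ?sw0// interpolate_le0; last by lra.
  by congr pi; field; rewrite gt_eqF.
apply: IH => // t /andP[t1 t2]; rewrite fi; last by apply/andP; split; lra.
rewrite clamp_ge ?width_gt0//; last by lra.
rewrite divfK ?gt_eqF// addrA; congr (pi (_ + interpolate u v _)); ring.
Qed.

Lemma affine_on_dyadic f a b u v t : affine_on f a b u v -> dyadic a -> dyadic b ->
  dyadic t -> a <= t <= a + total u -> u != [::] -> exists2 y, dyadic y & f (pi t) = pi y.
Proof.
elim: u v a b => [|e u IH] [|e' v] //= a b [fe fu] da db dt /andP[t1].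
rewrite total_cons addrA => t2 _; have [te|te] := lerP t (a + width e).
  have w0 := width_gt0 e; have tE : t = a + (t - a) / width e * width e.
    by rewrite divfK ?gt_eqF// addrC subrK.
  exists (b + (t - a) / width e * width e').
    apply: dyadicD => //.
    have -> : (t - a) / width e * width e' = 2 ^ (e%:Z - e'%:Z) * (t - a).
      by rewrite /width invrK expfzDr ?pnatr_eq0// -exprnN exprnP; ring.
    by apply: dyadicMz; apply: dyadicD => //; exact: dyadicN.
  rewrite {1}tE fe// divr_ge0 ?subr_ge0 ?(ltW w0)//= ler_pdivrMr// mul1r; lra.
case: u fu t2 IH => [|e1 u] fu t2 IH; first by move: t2; rewrite total_nil addr0 leNgt te.
apply: IH fu _ _ dt _ _ => //; try by apply: dyadicD => //; exact: dyadic_width.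
by rewrite (ltW te).
Qed.

Fixpoint starts a u : seq R := if u is e :: u' then a :: starts (a + width e) u' else [::].

Lemma starts_dyadic a u x : dyadic a -> x \in starts a u -> dyadic x.
Proof.
elim: u a => [|e u IH] a //= da; rewrite in_cons => /predU1P[->//|].
by apply: IH; apply: dyadicD => //; exact: dyadic_width.
Qed.

Lemma near_between a b t : a < t < b -> \forall y \near t, a < y < b.
Proof.
move=> tab; have : t \in `]a, b[ by rewrite in_itv.
by move=> /near_in_itvoo; apply: filterS => y; rewrite in_itv.
Qed.

Lemma affine_on_slope f a b u v t : affine_on f a b u v ->
  a <= t < a + total u -> pi t \notin map pi (starts a u) ->
  exists (k : int) (c : R), \forall y \near t, f (pi y) = pi (2 ^ k * y + c).
Proof.
elim: u v a b => [|e u IH] [|e' v] //= a b; first by rewrite total_nil addr0 => _ /andP[t1 t2]; lra.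
move=> [fe fu] /andP[t1]; rewrite total_cons addrA => t2.
rewrite in_cons negb_or => /andP[ta tu].
have [te|te] := ltrP t (a + width e); last by apply: IH fu _ tu; rewrite te.
have w0 := width_gt0 e.
have {}t1 : a < t by rewrite lt_def t1 andbT; apply: contraNneq ta => ->.
exists (e%:Z - e'%:Z), (b - 2 ^ (e%:Z - e'%:Z) * a).
have slope : 2 ^ (e%:Z - e'%:Z) = width e' / width e :> R.
  by rewrite /width invrK expfzDr ?pnatr_eq0// -exprnN exprnP mulrC.
have /near_between : a < t < a + width e by rewrite t1.
apply: filterS => y /andP[y1 y2].
have yE : y = a + (y - a) / width e * width e.
  by rewrite divfK ?gt_eqF// addrC subrK.
rewrite {1}yE fe; last first.
  by rewrite divr_ge0 ?subr_ge0 ?(ltW w0) ?(ltW y1)//= ler_pdivrMr// mul1r; lra.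
by congr pi; rewrite slope; ring.
Qed.

(** The interpolating function descends to the circle; its inverse comes from
    exchanging the two subdivisions. *)
Lemma thompson_of_lists u v : size u = size v -> total u = 1 -> total v = 1 ->
  exists g : thompsonT R, affine_on (val g) 0 0 u v.
Proof.
move=> uv u1 v1; pose F u v z := pi (interpolate u v (rep01 z)).
have interp1 u' v' t : size u' = size v' -> total u' = 1 -> total v' = 1 -> 1 <= t ->
    interpolate u' v' t = 1.
  by move=> h1 h2 h3 h4; rewrite interpolate_ge// h2.
have Fpi u' v' t : size u' = size v' -> total u' = 1 -> total v' = 1 -> 0 <= t <= 1 ->
    F u' v' (pi t) = pi (interpolate u' v' t).
  move=> h1 h2 h3 /andP[t0]; rewrite le_eqVlt => /predU1P[->|t1].
    rewrite interp1// /F -{1}[1]add0r (piDint 0 1) rep01_pi ?lexx ?ltr01//.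
    by rewrite interpolate_le0// -(piDint 0 1) add0r.
  by rewrite /F rep01_pi// t0.
have Faff u' v' : size u' = size v' -> total u' = 1 -> total v' = 1 ->
    affine_on (F u' v') 0 0 u' v'.
  move=> h1 h2 h3; apply: affine_on_interpolate => // t.
  by rewrite !add0r subr0 h2; exact: Fpi.
have Fc u' v' : size u' = size v' -> total u' = 1 -> total v' = 1 -> continuous (F u' v').
  move=> h1 h2 h3; apply: continuous_circle => x.
  pose m := Num.floor x; pose x1 := x - m%:~R.
  have /andP[m1 m2] := floor_itv x.
  have x10 : 0 <= x1 by rewrite subr_ge0.
  have x11 : x1 < 1 by rewrite /x1 ltrBlDl -intrD1.
  have loc : \forall y \near x, F u' v' (pi y) =
      pi (interpolate u' v' (y - m%:~R) + interpolate u' v' (y - m%:~R + 1)).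
    have /near_between : m%:~R - 1 < x < m%:~R + 1.
      by apply/andP; split; rewrite /x1 in x10 x11; lra.
    apply: filterS => y /andP[y1 y2].
    rewrite -(piDint y (- m)) intrN; set t := y - m%:~R.
    have [t0|t0] := lerP 0 t.
      have t1 : t <= 1 by rewrite /t; lra.
      have t2 : 1 <= t + 1 by lra.
      by rewrite Fpi ?t0// (interp1 _ _ (t + 1))// -[X in _ + X]mulr1z piDint.
    rewrite -(piDint t 1) mulr1z Fpi//; last by apply/andP; rewrite /t in t0 *; split; lra.
    by rewrite (interpolate_le0 _ _ (ltW t0)) add0r.
  have lim : pi (interpolate u' v' (y - m%:~R) + interpolate u' v' (y - m%:~R + 1))
      @[y --> x] --> F u' v' (pi x).
    rewrite (nbhs_singleton loc); apply: continuous_comp; last exact: continuous_pi.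
    apply: (@continuousD _ R^o).
      apply: (@continuous_comp _ _ _ (fun y => y - m%:~R) (interpolate u' v')).
        by apply: continuousB; [exact: cvg_id|exact: cst_continuous].
      exact: continuous_interpolate.
    apply: (@continuous_comp _ _ _ (fun y => y - m%:~R + 1) (interpolate u' v')).
      apply: continuousD; last exact: cst_continuous.
      by apply: continuousB; [exact: cvg_id|exact: cst_continuous].
    exact: continuous_interpolate.
  apply: cvg_trans lim; apply: near_eq_cvg; by apply: filterS loc => y /= ->.
have FK u' v' : size u' = size v' -> total u' = 1 -> total v' = 1 ->
    cancel (F u' v') (F v' u').
  move=> h1 h2 h3 z; have := affine_on_fun_eq h2
    (affine_on_comp (Faff _ _ h1 h2 h3) (Faff _ _ (esym h1) h3 h2)) (affine_on_id 0 u').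
  by move=> /(congr1 (fun f => f z)).
have T : in_thompsonT (F u v).
  have aff := Faff _ _ uv u1 v1.
  have un : u != [::] by apply: contra_eq_neq u1 => ->; rewrite total_nil eq_sym oner_eq0.
  have d0 : dyadic (0 : R) by exists 0, 0%N; rewrite mul0r.
  split.
  - by exists (F v u); split; [exact: FK|exact: FK|exact: Fc|exact: Fc].
  - apply/dyadic_piecewise_linearP; exists (map pi (starts 0 u)); split.
      by move=> z /mapP[x /(starts_dyadic d0) dx ->]; exists x.
    move=> x xs; pose m := Num.floor x; pose x1 := x - m%:~R.
    have /andP[m1 m2] := floor_itv x.
    have x01 : 0 <= x1 < 0 + total u.
      by rewrite u1 add0r subr_ge0 m1 /= /x1 ltrBlDl -intrD1.
    have pix : pi x1 = pi x by rewrite /x1 -intrN piDint.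
    rewrite -pix in xs; have [k [c kc]] := affine_on_slope aff x01 xs.
    exists k, (c - 2 ^ k * m%:~R).
    have kc' : \forall y \near 1 * x + - m%:~R, F u v (pi y) = pi (2 ^ k * y + c).
      by rewrite mul1r.
    apply: filterS (affine_near kc') => y; rewrite mul1r -intrN piDint => ->.
    by congr pi; rewrite intrN; ring.
  - move=> x dx; have dr : dyadic (rep01 (pi x)).
      by apply: dyadic_pi dx; rewrite rep01K.
    rewrite -(rep01K (pi x)); apply: (affine_on_dyadic aff) => //.
    by have /andP[h1 h2] := rep01P (pi x); rewrite u1 add0r h1 ltW.
by exists (SigSub (mem_set T)); exact: Faff.
Qed.

End DyadicSubdivisions.

(** * The action of T on the circle *)

Section Proximality.
Variable R : realType.
Local Notation circle := (circle R).
Local Notation pi := (\pi_circle : R -> circle).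
Local Notation T := (thompsonT R).
Implicit Types (x y t d e : R) (z w : circle) (g h p : T).

Definition thompson_act g : circle -> circle := val g.

Lemma thompson_actM g h z :
  thompson_act (g * h)%g z = thompson_act g (thompson_act h z).
Proof. by []. Qed.

Lemma thompson_act1 z : thompson_act 1%g z = z.
Proof. by []. Qed.

Lemma thompson_actK g : cancel (thompson_act g) (thompson_act g^-1%g).
Proof. by move=> z; rewrite -thompson_actM mulVg. Qed.

Lemma thompson_faithful g h : (forall z, thompson_act g z = thompson_act h z) -> g = h.
Proof. by move=> gh; apply: val_inj; apply/funext. Qed.

Lemma thompson_continuous g : continuous (thompson_act g).
Proof. by have /set_mem[[f [_ _ gc _]] _ _] := valP g. Qed.

Lemma rotation_ex d : dyadic d ->
  exists g : T, forall x, thompson_act g (pi x) = pi (x + d).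
Proof.
move=> dd; pose F c z := pi (rep01 z + c).
have Fpi c x : F c (pi x) = pi (x + c).
  have [m xm] : exists m : int, rep01 (pi x) = x + m%:~R.
    by apply: eq_pi_int; rewrite rep01K.
  by rewrite /F xm addrAC piDint.
have Fc c : continuous (F c).
  apply: continuous_circle; rewrite (_ : F c \o pi = pi \o (fun x => x + c)).
    move=> x; apply: continuous_comp; last exact: continuous_pi.
    by apply: continuousD; [exact: cvg_id|exact: cst_continuous].
  by apply/funext => x /=; rewrite Fpi.
have FK c : cancel (F c) (F (- c)).
  by move=> z; rewrite -(rep01K z) !Fpi addrK.
suff Td : in_thompsonT (F d) by exists (SigSub (mem_set Td)) => x; exact: Fpi.
split.
- exists (F (- d)); split; [exact: FK| |exact: Fc|exact: Fc].
  by rewrite -{2}(opprK d); exact: FK.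
- exists [::]; split=> // x _; exists 0, d; apply: (@filterE _ (nbhs x)) => y.
  by rewrite Fpi expr0z mul1r.
- by move=> x dx; exists (x + d); [exact: dyadicD|rewrite Fpi].
Qed.

(** The north-south dynamics: this element moves every point of ]0, 1[ towards 1. *)
Lemma north_south_ex : exists g : T,
  [/\ forall x, 0 <= x <= 1 / 4 -> thompson_act g (pi x) = pi (2 * x),
      forall x, 1 / 4 <= x <= 1 / 2 -> thompson_act g (pi x) = pi (x + 1 / 4) &
      forall x, 1 / 2 <= x <= 1 -> thompson_act g (pi x) = pi (1 / 2 + x / 2)].
Proof.
have [||| g] := @thompson_of_lists R [:: 2%N; 2%N; 1%N] [:: 1%N; 2%N; 2%N] => //.
- by rewrite !total_cons total_nil /width; field.
- by rewrite !total_cons total_nil /width; field.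
have w1 : width R 1 = 1 / 2 by rewrite /width; field.
have w2 : width R 2 = 1 / 4 by rewrite /width; field.
rewrite /= !w1 !w2 !add0r => -[g1 [g2 [g3 _]]]; exists g; split=> x /andP[x1 x2].
- rewrite /thompson_act; have := g1 (4 * x); rewrite !add0r.
  have -> : 4 * x * (1 / 4) = x by field.
  have -> : 4 * x * (1 / 2) = 2 * x by field.
  by apply; apply/andP; split; lra.
- rewrite /thompson_act; have := g2 (4 * x - 1).
  have -> : 1 / 4 + (4 * x - 1) * (1 / 4) = x by field.
  have -> : 1 / 2 + (4 * x - 1) * (1 / 4) = x + 1 / 4 by field.
  by apply; apply/andP; split; lra.
- rewrite /thompson_act; have := g3 (2 * x - 1).
  have -> : 1 / 4 + 1 / 4 + (2 * x - 1) * (1 / 2) = x by field.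
  have -> : 1 / 2 + 1 / 4 + (2 * x - 1) * (1 / 4) = 1 / 2 + x / 2 by field.
  by apply; apply/andP; split; lra.
Qed.

Lemma push_to_right_half n : exists p : T, forall x, 2 ^- n.+1 <= x <= 1 ->
  exists2 y, 1 / 2 <= y <= 1 & thompson_act p (pi x) = pi y.
Proof.
have [g [g1 g2 g3]] := north_south_ex.
elim: n => [|n [p hp]].
  by exists 1%g => x; rewrite expr1 => /andP[x1 x2]; exists x => //; apply/andP; split; lra.
have w0 : 0 < 2 ^- n.+2 :> R by rewrite invr_gt0 exprn_gt0.
have wS : 2 ^- n.+1 = 2 * 2 ^- n.+2 :> R by rewrite [in RHS]exprS invfM mulVKf// pnatr_eq0.
have w1 : 2 ^- n.+1 <= 1 / 2 :> R.
  by rewrite mul1r exprS invfM ler_piMr ?invr_ge0// invf_le1 ?exprn_gt0// exprn_ege1// ler1n.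
exists (p * g)%g => x /andP[x1 x2]; rewrite thompson_actM.
have [x3|x3] := lerP x (1 / 4).
  by rewrite g1; [apply: hp; apply/andP; split; lra|apply/andP; split; lra].
have [x4|x4] := lerP x (1 / 2).
  by rewrite g2; [apply: hp; apply/andP; split; lra|apply/andP; split; lra].
by rewrite g3; [apply: hp; apply/andP; split; lra|apply/andP; split; lra].
Qed.

Lemma push_to_one n : exists p : T, forall x, 1 / 2 <= x <= 1 ->
  exists2 y, 1 - 2 ^- n.+1 <= y <= 1 & thompson_act p (pi x) = pi y.
Proof.
have [g [g1 g2 g3]] := north_south_ex.
elim: n => [|n [p hp]].
  by exists 1%g => x /andP[x1 x2]; exists x => //; rewrite expr1; apply/andP; split; lra.
exists (g * p)%g => x /hp[y /andP[y1 y2] py].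
have w1 : 2 ^- n.+1 <= 1 / 2 :> R.
  by rewrite mul1r exprS invfM ler_piMr ?invr_ge0// invf_le1 ?exprn_gt0// exprn_ege1// ler1n.
have wS : 2 ^- n.+1 = 2 * 2 ^- n.+2 :> R by rewrite [in RHS]exprS invfM mulVKf// pnatr_eq0.
exists (1 / 2 + y / 2); first by apply/andP; split; lra.
by rewrite thompson_actM py g3//; apply/andP; split; lra.
Qed.

(** Rotate so that U contains an arc starting at 0, push the rest of the circle
    close to 1 by the north-south dynamics, and rotate into O. *)
Lemma thompson_proximal (U O : set circle) : open U -> U !=set0 -> open O ->
  O !=set0 -> exists p : T, forall z, ~ U z -> O (thompson_act p z).
Proof.
move=> oU U0 oO O0.
have [d [k [dd Ud]]] := open_contains_arc oU U0.
have [e [l [de Oe]]] := open_contains_arc oO O0.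
have [r1 hr1] := rotation_ex (dyadicN dd).
have dr2 : dyadic (e + 2 ^- l - 1).
  apply: dyadicD; last by apply: dyadicN; apply: dyadic_int; exact: int_num1.
  by apply: dyadicD => //; exact: (dyadic_width R l).
have [r2 hr2] := rotation_ex dr2.
have [p hp] := push_to_right_half k; have [q hq] := push_to_one l.
have ws n : 2 ^- n.+1 <= 2 ^- n :> R.
  by rewrite exprS invfM ler_piMl ?invr_ge0 ?exprn_ge0// invf_le1// ler1n.
exists (r2 * q * p * r1)%g => z nUz; rewrite !thompson_actM.
rewrite -(rep01K (thompson_act r1 z)); set x := rep01 _.
have /andP[x0 x1] : 0 <= x < 1 by exact: rep01P.
have pix : pi x = thompson_act r1 z by rewrite rep01K.
have xk : 2 ^- k < x.
  rewrite ltNge; apply/negP => xk; apply: nUz.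
  have -> : z = pi (d + x).
    rewrite -(thompson_actK r1 z) -pix -(thompson_actK r1 (pi (d + x))) hr1.
    by rewrite addrAC subrr add0r.
  by apply: Ud; apply/andP; split; lra.
have [|y /andP[y1 y2] ->] := hp x.
  by have := ws k => wk; apply/andP; split; lra.
have [|y' /andP[y1' y2'] ->] := hq y; first by rewrite y1.
rewrite hr2; apply: Oe; have := ws l => wl; apply/andP; split; lra.
Qed.

End Proximality.

(** * Elements that are the identity near the base point *)

Section Perfectness.
Variable R : realType.
Local Notation circle := (circle R).
Local Notation pi := (\pi_circle : R -> circle).
Local Notation T := (thompsonT R).
Local Notation total := (total R).
Local Notation width := (width R).
Implicit Types (g h k : T) (u v w p q r s : seq nat) (e : nat).

Local Notation Fc := (trivial_near (@thompson_act R) (pi 0)).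
Local Notation der := (commutator_product Fc).

Lemma trivial_nearM g h : Fc g -> Fc h -> Fc (g * h)%g.
Proof.
rewrite /trivial_near /=; apply: filterS2 => z gz hz.
by rewrite thompson_actM hz.
Qed.

Lemma trivial_nearV g : Fc g -> Fc g^-1%g.
Proof.
rewrite /trivial_near /=; apply: filterS => z gz.
by rewrite -{1}gz thompson_actK.
Qed.

Lemma derJ g h : Fc h -> der g -> der (h * g * h^-1)%g.
Proof.
move=> hF; elim=> [|a b aF bF|a b _ IHa _ IHb|a _ IHa].
- by rewrite mulg1 mulgV; exact: commutator_product1.
- have -> : (h * (a^-1 * b^-1 * a * b) * h^-1 =
    (h * a * h^-1)^-1 * (h * b * h^-1)^-1 * (h * a * h^-1) * (h * b * h^-1))%g.
    by rewrite !invgM !invgK !mulgA !mulgVK.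
  by apply: commutator_product_comm; do ?[apply: trivial_nearM] => //; exact: trivial_nearV.
- have -> : (h * (a * b) * h^-1 = (h * a * h^-1) * (h * b * h^-1))%g.
    by rewrite !mulgA mulgVK.
  exact: commutator_productM.
- have -> : (h * a^-1 * h^-1 = (h * a * h^-1)^-1)%g by rewrite !invgM invgK mulgA.
  exact: commutator_productV.
Qed.

Definition maps g u v := affine_on (thompson_act g) 0 0 u v.

Lemma maps_unique g h u v : total u = 1 -> maps g u v -> maps h u v -> g = h.
Proof. by move=> u1 gu hu; apply: val_inj; exact: affine_on_fun_eq u1 gu hu. Qed.

Lemma mapsM g h u v w : maps g u v -> maps h v w -> maps (h * g)%g u w.
Proof. exact: affine_on_comp. Qed.

Lemma mapsV g u v : maps g u v -> maps g^-1%g v u.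
Proof. by apply: affine_on_can => z; exact: thompson_actK. Qed.

Lemma maps_split g u1 u2 v1 v2 e e' : size u1 = size v1 ->
  maps g (u1 ++ e :: u2) (v1 ++ e' :: v2) <->
  maps g (u1 ++ [:: e.+1, e.+1 & u2]) (v1 ++ [:: e'.+1, e'.+1 & v2]).
Proof. exact: affine_on_split. Qed.

(** The first and the last arcs, on both sides of the base point, are mapped to
    arcs of the same widths, hence by the identity. *)
Lemma maps_trivial_near g a b u v : maps g (a :: u ++ [:: b]) (a :: v ++ [:: b]) ->
  total (a :: u ++ [:: b]) = 1 -> total (a :: v ++ [:: b]) = 1 -> Fc g.
Proof.
rewrite /maps -!cat_cons !total_cat /total !big_cons !big_nil !addr0 => gm u1 v1.
have uv : size u = size v.
  have := affine_on_size gm; rewrite !size_cat /= => /eqP.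
  by rewrite !addn1 !eqSS => /eqP.
move: gm; rewrite affine_on_cat /= ?uv// => -[[ga _] [gb _]].
have wa : 0 < width a by exact: width_gt0. have wb : 0 < width b by exact: width_gt0.
have -> : Fc g = \forall z \near pi 0, thompson_act g z = z by [].
have oV : open (pi @` [set x | - width b < x < width a]).
  apply: open_pi; rewrite (_ : [set x | _] = `]- width b, width a[%classic).
    exact: interval_open.
  by apply/seteqP; split=> x /=; rewrite in_itv.
have V0 : nbhs (pi 0) (pi @` [set x | - width b < x < width a]).
  by apply: open_nbhs_nbhs; split=> //; exists 0 => //=; rewrite oppr_lt0 wb wa.
apply: filterS V0 => z [x /andP[x1 x2] <-]; have [x0|x0] := lerP 0 x.
  have xE : x = 0 + x / width a * width a by rewrite add0r divfK// gt_eqF.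
  rewrite {1}xE ga; first by rewrite -xE.
  by rewrite divr_ge0 ?(ltW wa)//= ler_pdivrMr// mul1r ltW.
move: gb; rewrite /total !big_cons !add0r.
rewrite (_ : width a + _ = 1 - width b); last by rewrite -u1; ring.
rewrite (_ : width a + _ = 1 - width b); last by rewrite -v1; ring.
move=> gb; rewrite -(piDint x 1) mulr1z.
have xE : x + 1 = 1 - width b + (x + width b) / width b * width b.
  by rewrite divfK ?gt_eqF//; ring.
rewrite {1}xE gb; first by rewrite -xE.
by rewrite divr_ge0 ?(ltW wb)//= ?ler_pdivrMr//; lra.
Qed.

(** ** Refining subdivisions *)

Inductive refines : seq nat -> seq nat -> Prop :=
| refines_refl p : refines p p
| refines_split p1 e p2 q :
    refines (p1 ++ [:: e.+1, e.+1 & p2]) q -> refines (p1 ++ e :: p2) q.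

Lemma refines_total p q : refines p q -> total p = total q.
Proof.
elim=> // p1 e p2 r _ <-; rewrite !total_cat !total_cons addrA.
by rewrite [in LHS](widthS R e) !addrA.
Qed.

Lemma refines_trans p q r : refines p q -> refines q r -> refines p r.
Proof. by elim=> // p1 e p2 s _ IH sr; apply: refines_split; exact: IH. Qed.

Lemma refines_catl p q r : refines p q -> refines (r ++ p) (r ++ q).
Proof.
elim=> [?|p1 e p2 s _ IH]; first exact: refines_refl.
by rewrite catA; apply: refines_split; rewrite -catA.
Qed.

Lemma refines_catr p q r : refines p q -> refines (p ++ r) (q ++ r).
Proof.
elim=> [?|p1 e p2 s _ IH]; first exact: refines_refl.
by rewrite -catA; apply: refines_split; move: IH; rewrite -catA.
Qed.

Lemma refines_cat p q r s : refines p q -> refines r s -> refines (p ++ r) (q ++ s).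
Proof. by move=> pq rs; apply: refines_trans (refines_catr _ pq) (refines_catl _ rs). Qed.

Lemma maps_refines g a1 a2 b1 b2 p q : size a1 = size b1 -> refines p q ->
  maps g (a1 ++ p ++ a2) (b1 ++ p ++ b2) <-> maps g (a1 ++ q ++ a2) (b1 ++ q ++ b2).
Proof.
move=> ab; elim=> // p1 e p2 s _ <-.
by rewrite -!catA !(catA _ p1) /=; apply: maps_split; rewrite !size_cat ab.
Qed.

Lemma refines_nseq1 e j : refines [:: e] (nseq (2 ^ j) (e + j)%N).
Proof.
elim: j e => [|j IH] e; first by rewrite addn0; exact: refines_refl.
apply: (@refines_split [::]); rewrite /= expnS mul2n -addnn nseqD.
by apply: (@refines_cat [:: e.+1] _ [:: e.+1]); rewrite -addSnnS; exact: IH.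
Qed.

Lemma refines_nseq K p : all (fun e => e <= K)%N p ->
  exists2 n, refines p (nseq n K) & (p != [::] -> 0 < n)%N.
Proof.
elim: p => [|e p IH] /=; first by exists 0%N => //; exact: refines_refl.
move=> /andP[eK /IH[n pn _]]; exists (2 ^ (K - e) + n)%N.
  rewrite nseqD; apply: (@refines_cat [:: e]) => //.
  by rewrite -{2}(subnKC eK); exact: refines_nseq1.
by move=> _; rewrite addn_gt0 expn_gt0.
Qed.

Lemma refines_size e m : exists2 r, refines [:: e] r & size r = m.+1.
Proof.
elim: m e => [|m IH] e; first by exists [:: e] => //; exact: refines_refl.
have [r er rm] := IH e.+1; exists (e.+1 :: r); last by rewrite /= rm.
by apply: (@refines_split [::]); exact: (@refines_catl _ _ [:: e.+1]).
Qed.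

Lemma bounded_exponents p : exists K, forall j, all (fun e => e <= K + j)%N p.
Proof.
exists (\max_(e <- p) e) => j; apply/allP => e ep.
by rewrite (leq_trans _ (leq_addr _ _))//; exact: leq_bigmax_seq.
Qed.

Lemma refines_nseq_ge p K : p != [::] -> all (fun e => e <= K)%N p ->
  exists n, refines p (nseq n.+3 K.+2).
Proof.
move=> p0 pK; have [n pn /(_ p0) n0] := refines_nseq pK.
have [|m pm _] := @refines_nseq K.+2 (nseq n K).
  by apply/allP => e; rewrite mem_nseq => /andP[_ /eqP ->]; rewrite -addn2 leq_addr.
have := refines_trans pn pm; move: (refines_total pm).
rewrite /total !big_nseq -!/(iter _ _ _) !iter_addr !addr0 => mn.
suff : (3 <= m)%N by case: m pm {mn} => [|[|[|m]]] // pm _ pm'; exists m.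
have : (n%:R * 4 : R) = m%:R.
  have w0 : width K.+2 != 0 by rewrite gt_eqF ?width_gt0.
  apply: (mulIf w0); rewrite [RHS]mulr_natl -mn !(widthS R K) !(widthS R K.+1).
  by rewrite -[RHS]mulr_natl; ring.
by rewrite -natrM => /eqP; rewrite eqr_nat => /eqP; lia.
Qed.

(** Both lists are refined to a uniform width 2^-K, with at least three arcs; the
    shorter one is then refined further inside one interior arc. *)
Lemma common_refinement p q : p != [::] -> q != [::] ->
  exists K r s, [/\ refines p (K :: r ++ [:: K]), refines q (K :: s ++ [:: K]) &
    size r = size s].
Proof.
wlog : p q / exists K m n, [/\ refines p (nseq m.+3 K), refines q (nseq n.+3 K) & (m <= n)%N].
  move=> wl p0 q0; have [Kp pK] := bounded_exponents p; have [Kq qK] := bounded_exponents q.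
  have [m pm] := refines_nseq_ge p0 (pK Kq).
  have [n] := refines_nseq_ge q0 (qK Kp); rewrite addnC => qn.
  have [mn|/ltnW nm] := leqP m n.
    by apply: wl => //; exists (Kp + Kq).+2, m, n; split.
  have [|K [r [s [qr ps rs]]]] := wl q p _ q0 p0.
    by exists (Kp + Kq).+2, n, m; split.
  by exists K, s, r; split.
move=> [K [m [n [pm qn mn]]]] _ _.
have nseqE j : nseq j.+3 K = K :: (nseq j.+1 K) ++ [:: K].
  by rewrite -[nseq j.+3 K]/(K :: nseq j.+2 K) -(addn1 j.+1) nseqD.
have [t Kt tn] := refines_size K (n - m).
exists K, (t ++ nseq m K), (nseq n.+1 K); split.
- apply: refines_trans pm _; rewrite nseqE.
  by apply: (@refines_catl _ _ [:: K]); apply: refines_catr; exact: (@refines_catr [:: K]).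
- by rewrite -nseqE.
- by rewrite size_cat !size_nseq tn; lia.
Qed.

(** ** Null rearrangements *)

(** Quantifying over the context p, q, which is nonempty in order to stay away
    from the base point, makes null pairs stable under concatenation. *)
Definition null u v := [/\ size u = size v, total u = total v &
  forall p q g, p != [::] -> q != [::] -> total (p ++ u ++ q) = 1 ->
    maps g (p ++ u ++ q) (p ++ v ++ q) -> der g].

Lemma null_refl u : null u u.
Proof.
split=> // p q g _ _ t1 gm.
have -> : g = 1%g by apply: maps_unique t1 gm _; exact: affine_on_id.
exact: commutator_product1.
Qed.

Lemma null_sym u v : null u v -> null v u.
Proof.
move=> [uv tuv nuv]; split=> // p q g p0 q0 t1 gm.
rewrite -[g]invgK; apply: commutator_productV; apply: (nuv p q) => //.
  by rewrite !total_cat tuv -!total_cat.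
exact: mapsV.
Qed.

(** The element that performs u -> w factors through the one that performs
    u -> v, whose existence is [thompson_of_lists]. *)
Lemma null_trans v u w : null u v -> null v w -> null u w.
Proof.
move=> [uv tuv nuv] [vw tvw nvw]; split; [by rewrite uv|by rewrite tuv|].
move=> p q g p0 q0 t1 gm.
have t2 : total (p ++ v ++ q) = 1 by rewrite -t1 !total_cat tuv.
have [|h hm] := @thompson_of_lists R (p ++ u ++ q) (p ++ v ++ q) _ t1 t2.
  by rewrite !size_cat uv.
have -> : (g = (g * h^-1) * h)%g by rewrite mulgVK.
apply: commutator_productM; last exact: (nuv p q).
by apply: (nvw p q) => //; exact: mapsM (mapsV hm) gm.
Qed.

Lemma null_cat a b u v : null u v -> null (a ++ u ++ b) (a ++ v ++ b).
Proof.
move=> [uv tuv nuv]; split; [by rewrite !size_cat uv|by rewrite !total_cat tuv|].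
move=> p q g p0 q0; have E x : p ++ (a ++ x ++ b) ++ q = (p ++ a) ++ x ++ (b ++ q).
  by rewrite !catA.
rewrite !E; apply: nuv.
  by rewrite -size_eq0 size_cat addn_eq0 size_eq0 (negPf p0).
by rewrite -size_eq0 size_cat addn_eq0 !size_eq0 (negPf q0) andbF.
Qed.

Lemma null_split u1 u2 v1 v2 e e' : size u1 = size v1 ->
  null (u1 ++ e :: u2) (v1 ++ e' :: v2) <->
  null (u1 ++ [:: e.+1, e.+1 & u2]) (v1 ++ [:: e'.+1, e'.+1 & v2]).
Proof.
move=> uv; have tE x y d : total (x ++ d :: y) = total (x ++ [:: d.+1, d.+1 & y]).
  exact: (refines_total (refines_split (refines_refl _))).
have sE x y d : size (x ++ [:: d.+1, d.+1 & y]) = (size (x ++ d :: y)).+1.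
  by rewrite !size_cat /= !addnS.
have mE p q g :
    maps g (p ++ (u1 ++ e :: u2) ++ q) (p ++ (v1 ++ e' :: v2) ++ q) <->
    maps g (p ++ (u1 ++ [:: e.+1, e.+1 & u2]) ++ q) (p ++ (v1 ++ [:: e'.+1, e'.+1 & v2]) ++ q).
  rewrite -!catA !(catA p) /=; apply: maps_split; by rewrite !size_cat uv.
rewrite /null !sE -!tE; split=> -[h1 h2 h3]; split=> //; try by [case: h1|rewrite h1].
- move=> p q g p0 q0 t1 /mE; apply: h3 => //.
  by rewrite -t1 !(total_cat _ p) !(total_cat _ _ q); congr (_ + (_ + _)); exact: tE.
- move=> p q g p0 q0 t1 /mE; apply: h3 => //.
  by rewrite -t1 !(total_cat _ p) !(total_cat _ _ q); congr (_ + (_ + _)); exact/esym/tE.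
Qed.

End Perfectness.

(** * Rearrangements of subdivisions are products of commutators *)

Section Rearrangements.
Variable R : realType.
Local Notation circle := (circle R).
Local Notation pi := (\pi_circle : R -> circle).
Local Notation T := (thompsonT R).
Local Notation total := (total R).
Local Notation width := (width R).
Local Notation null := (null R).
Local Notation Fc := (trivial_near (@thompson_act R) (pi 0)).
Local Notation der := (commutator_product Fc).
Implicit Types (g h k : T) (u v w p q r s : seq nat) (e : nat).

(** The basic move goes from the first to the second of these subdivisions of an
    arc of width 2^-e. *)
Definition big_first e := [:: e.+1; e.+2; e.+2].
Definition big_last e := [:: e.+2; e.+2; e.+1].

Lemma total_block p q e : total (p ++ big_first e ++ q) = total (p ++ e :: q).
Proof.
rewrite !total_cat !total_cons total_nil.
by rewrite (widthS R e) (widthS R e.+1); ring.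
Qed.

Lemma total_block' p q e : total (p ++ big_last e ++ q) = total (p ++ e :: q).
Proof.
rewrite !total_cat !total_cons total_nil.
by rewrite (widthS R e) (widthS R e.+1); ring.
Qed.

Lemma maps_block g p q r s e f : size p = size r ->
  maps g (p ++ e :: q) (r ++ f :: s) ->
  maps g (p ++ big_first e ++ q) (r ++ big_first f ++ s) /\
  maps g (p ++ big_last e ++ q) (r ++ big_last f ++ s).
Proof.
move=> pr /(maps_split _ _ _ _ _ pr) gm; split.
  have E x y d : x ++ big_first d ++ y = (x ++ [:: d.+1]) ++ [:: d.+2, d.+2 & y].
    by rewrite -catA.
  rewrite !E; apply: (proj1 (maps_split g q s e.+1 f.+1 _)).
    by rewrite !size_cat pr.
  by rewrite -!catA.
exact: (proj1 (maps_split g (e.+1 :: q) (f.+1 :: s) e.+1 f.+1 pr) gm).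
Qed.

Lemma context_refinement p q r s : refines p r -> refines q s -> forall g x y,
  maps g (p ++ x ++ q) (p ++ y ++ q) -> size x = size y ->
  maps g (r ++ x ++ s) (r ++ y ++ s).
Proof.
move=> pr qs g x y gm xy.
have : maps g (r ++ x ++ q) (r ++ y ++ q).
  exact/(maps_refines g (a1 := [::]) (b1 := [::]) (x ++ q) (y ++ q) erefl pr).
have E z : r ++ z ++ q = (r ++ z) ++ q ++ [::] by rewrite cats0 catA.
have E' z : r ++ z ++ s = (r ++ z) ++ s ++ [::] by rewrite cats0 catA.
rewrite !E !E'; apply: (proj1 (maps_refines g [::] [::] _ qs)).
by rewrite !size_cat xy.
Qed.

(** Some element with trivial germ at the base point carries one block affinely
    onto the other; it exists because the contexts on both sides of the blocks
    have common refinements. *)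
Lemma basic_moves_conjugate p q p' q' e e' g g' :
  p != [::] -> q != [::] -> p' != [::] -> q' != [::] ->
  total (p ++ e :: q) = 1 -> total (p' ++ e' :: q') = 1 ->
  maps g (p ++ big_first e ++ q) (p ++ big_last e ++ q) ->
  maps g' (p' ++ big_first e' ++ q') (p' ++ big_last e' ++ q') ->
  exists2 h, Fc h & g' = (h * g * h^-1)%g.
Proof.
move=> p0 q0 p'0 q'0 t1 t1' gm gm'.
have [K [r [r' [pr pr' rr']]]] := common_refinement R p0 p'0.
have [L [s [s' [qs qs' ss']]]] := common_refinement R q0 q'0.
have {}gm := context_refinement pr qs gm erefl.
have {}gm' := context_refinement pr' qs' gm' erefl.
set P := K :: r ++ [:: K] in pr gm; set P' := K :: r' ++ [:: K] in pr' gm'.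
set Q := L :: s ++ [:: L] in qs gm; set Q' := L :: s' ++ [:: L] in qs' gm'.
have PP' : size P = size P' by rewrite /= !size_cat rr'.
have QQ' : size Q = size Q' by rewrite /= !size_cat ss'.
have tP : total (P ++ e :: Q) = 1.
  by rewrite -t1 !(total_cat _ _ (e :: _)) !(total_cons _ e) (refines_total R pr) (refines_total R qs).
have tP' : total (P' ++ e' :: Q') = 1.
  by rewrite -t1' !(total_cat _ _ (e' :: _)) !(total_cons _ e') (refines_total R pr') (refines_total R qs').
have [|h hm] := @thompson_of_lists R (P ++ e :: Q) (P' ++ e' :: Q') _ tP tP'.
  by rewrite !size_cat PP' /= !size_cat ss'.
exists h.
  have E x y d : (K :: x ++ [:: K]) ++ d :: L :: y ++ [:: L] =
      K :: (x ++ [:: K, d, L & y]) ++ [:: L] by rewrite /= -!catA.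
  apply: (@maps_trivial_near R h K L (r ++ [:: K, e, L & s]) (r' ++ [:: K, e', L & s']));
    by rewrite -!E.
have [hf hl] := maps_block PP' hm.
apply: maps_unique gm' _; first by rewrite total_block.
exact: mapsM (mapsV hf) (mapsM gm hl).
Qed.

(** Let g perform the move in an arc, g3 the same move in its left half and g1 in
    its right half.  Then g g = g3 g g1, as in the pentagon relation, and all
    three are conjugate, so that g is trivial modulo commutators. *)
Lemma null_basic e : null (big_first e) (big_last e).
Proof.
split=> //; first by rewrite /big_first /big_last !total_cons total_nil; ring.
move=> p q g p0 q0; rewrite total_block => t1 gm.
have gF : Fc g.
  case: p p0 t1 gm => // a p _ t1; case/lastP: q q0 t1 => // q b _ t1.
  have E x : (a :: p) ++ x ++ rcons q b = a :: (p ++ x ++ q) ++ [:: b].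
    by rewrite -cats1 /= !catA.
  have := total_block' (a :: p) (rcons q b) e; have := total_block (a :: p) (rcons q b) e.
  rewrite t1 !E => tf tl gm.
  exact: maps_trivial_near gm tf tl.
have cF h : Fc h -> der (h * g * h^-1 * g^-1)%g.
  move=> hF; rewrite -{1}[h]invgK -{1}[g]invgK.
  by apply: commutator_product_comm; exact: trivial_nearV.
have tS : total (p ++ [:: e.+1, e.+1 & q]) = 1.
  by rewrite -t1; exact/esym/(refines_total R (refines_split (refines_refl _))).
have pe : p ++ [:: e.+1] != [::] by rewrite -size_eq0 size_cat addnS.
have tp : total ((p ++ [:: e.+1]) ++ e.+1 :: q) = 1 by rewrite -catA.
have [|||g1 g1m] := @thompson_of_lists R ((p ++ [:: e.+1]) ++ big_first e.+1 ++ q)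
    ((p ++ [:: e.+1]) ++ big_last e.+1 ++ q).
- by rewrite !size_cat.
- by rewrite total_block.
- by rewrite total_block'.
have [|||g3 g3m] := @thompson_of_lists R (p ++ big_first e.+1 ++ e.+1 :: q)
    (p ++ big_last e.+1 ++ e.+1 :: q).
- by rewrite !size_cat.
- by rewrite total_block.
- by rewrite total_block'.
have [h1 h1F g1E] := basic_moves_conjugate p0 q0 pe q0 t1 tp gm g1m.
have [h3 h3F g3E] := basic_moves_conjugate (q' := e.+1 :: q) p0 q0 p0 isT t1 tS gm g3m.
(* In units of an eighth of the arc, both sides map the widths 4, 2, 1, 1 onto
   the widths 1, 1, 2, 4. *)
have gg : (g * g = g3 * g * g1)%g.
  pose source := p ++ [:: e.+1; e.+2; e.+3; e.+3] ++ q.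
  pose target := p ++ [:: e.+3; e.+3; e.+2; e.+1] ++ q.
  have cutE a b d y : p ++ (a ++ d :: b) ++ y = (p ++ a) ++ d :: (b ++ y).
    by rewrite -!catA.
  have cut a b c d b' c' : size a = size c ->
      maps g (p ++ (a ++ b :: b') ++ q) (p ++ (c ++ d :: c') ++ q) ->
      maps g (p ++ (a ++ [:: b.+1, b.+1 & b']) ++ q) (p ++ (c ++ [:: d.+1, d.+1 & c']) ++ q).
    move=> ac; rewrite !cutE => /(maps_split _ _ _ _ _ _) cg.
    by rewrite -!catA !(catA p); apply: cg; rewrite !size_cat ac.
  have third := cut [:: e.+1; e.+2] e.+2 [:: e.+2; e.+2] e.+1 [::] [::] erefl gm.
  have first := cut [::] e.+1 [::] e.+2 [:: e.+2; e.+2] [:: e.+2; e.+1] erefl gm.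
  have second := cut [:: e.+1] e.+2 [:: e.+2] e.+2 [:: e.+2] [:: e.+1] erefl gm.
  apply: (@maps_unique R _ _ source target).
  - have E : source = (p ++ [:: e.+1]) ++ big_first e.+1 ++ q by rewrite /source -catA.
    by rewrite E total_block.
  - exact: mapsM third first.
  - have E1 : maps g1 source (p ++ [:: e.+1; e.+3; e.+3; e.+2] ++ q).
      by move: g1m; rewrite -!catA.
    exact: mapsM E1 (mapsM second g3m).
pose c1 := (h1 * g * h1^-1 * g^-1)%g; pose c3 := (h3 * g * h3^-1 * g^-1)%g.
have ggE : (c3 * (g * g) * c1 * g = g * g)%g.
  by rewrite [RHS]gg g3E g1E /c1 /c3 !mulgA !mulgVK.
have -> : g = (((g * g)^-1 * c3 * (g * g)^-1^-1) * c1)^-1%g.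
  apply/esym/mulg1_eq; clearbody c1 c3; move: (g * g)%g ggE => b bE.
  by apply: (mulgI b); rewrite mulg1 invgK -!mulgA mulVKg !mulgA.
apply: commutator_productV; apply: commutator_productM; last exact: cF.
apply: derJ; last exact: cF.
by apply: trivial_nearV; exact: trivial_nearM.
Qed.

Lemma null_catl a u v : null u v -> null (a ++ u) (a ++ v).
Proof. by move=> /(null_cat a [::]); rewrite !cats0. Qed.

Lemma null_catr b u v : null u v -> null (u ++ b) (v ++ b).
Proof. exact: (null_cat [::] b). Qed.

(** In terms of halves and quarters of the larger arc, two halves followed by two
    quarters are to be exchanged: the quarters jump over one half, then over the
    other one. *)
Lemma null_swap1 e : null [:: e; e.+1] [:: e.+1; e].
Proof.
apply: (proj2 (null_split (u1 := [::]) (v1 := [::]) R _ _ _ _ erefl)).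
apply: (proj2 (null_split (u1 := [:: e.+1; e.+1]) (v1 := [:: e.+2; e.+2]) R _ _ _ _ erefl)).
apply: null_trans (null_catl [:: e.+1] (null_basic e)) _.
exact: (null_catr [:: e.+1] (null_basic e)).
Qed.

(** With x = 2^-a and y = 2^-b / 2, the widths x, y, y become x/2, x/2, 2 y.  This
    step of the rearrangement preserves both the number of arcs and the total
    width; by induction on a - b, it is a basic move followed by the same
    exchange with y/2 for y. *)
Lemma null_exchange a b : (b < a)%N -> null [:: a; b.+1; b.+1] [:: a.+1; a.+1; b].
Proof.
move=> /subnK; move: (a - b.+1)%N => j; elim: j a b => [|j IH] a b ab.
  have {ab} -> : a = b.+1 by lia.
  exact: (proj1 (null_split (u1 := [::]) (v1 := [::]) R _ _ _ _ erefl) (null_swap1 b)).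
apply: (proj2 (null_split (u1 := [:: a; b.+1]) (v1 := [:: a.+1; a.+1]) R _ _ _ _ erefl)).
apply: null_trans (null_catl [:: a] (null_basic b)) _.
by apply: (null_catr [:: b.+1] (IH a b.+1 _)); lia.
Qed.

Lemma null_swap_le a j : null [:: a; (a + j)%N] [:: (a + j)%N; a].
Proof.
elim: j a => [|j IH] a; first by rewrite addn0; exact: null_refl.
rewrite addnS; apply: (proj2 (null_split (u1 := [::]) (v1 := [::]) R _ _ _ _ erefl)) => /=.
have := IH a.+1; rewrite addSn => sw.
apply: null_trans (null_catl [:: a.+1] sw) _.
apply: null_trans (null_catr [:: a.+1] sw) _.
by apply: null_exchange; rewrite ltnS leq_addr.
Qed.

Lemma null_swap a b : null [:: a; b] [:: b; a].
Proof.
have [ab|/ltnW ba] := leqP a b; first by rewrite -(subnKC ab); exact: null_swap_le.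
by apply: null_sym; rewrite -(subnKC ba); exact: null_swap_le.
Qed.

Lemma null_perm u v : perm_eq u v -> null u v.
Proof.
elim: u v => [|e u IH] v uv.
  by move: uv; rewrite perm_sym => /perm_nilP ->; exact: null_refl.
have /path.splitPr uv' : e \in v by rewrite -(perm_mem uv) mem_head.
case: uv' uv => v1 v2 uv.
have {}uv : perm_eq u (v1 ++ v2).
  by rewrite -(perm_cons e); apply: perm_trans uv _; rewrite -cat1s perm_catCA.
apply: null_trans (null_catl [:: e] (IH _ uv)) _.
elim: v1 {uv} => [|f v1 IH1] /=; first exact: null_refl.
apply: null_trans (null_catr (v1 ++ v2) (null_swap e f)) _.
exact: (null_catl [:: f] IH1).
Qed.

(** The total width in units of 2^-m, as an integer. *)
Definition units m u : nat := \sum_(e <- u) 2 ^ (m - e).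

Lemma total_units m u : all (fun e => e <= m)%N u -> total u = (units m u)%:R * width m.
Proof.
elim: u => [|e u IH] /=; first by rewrite total_nil /units big_nil mul0r.
move=> /andP[em /IH uE]; rewrite total_cons uE /units big_cons natrD mulrDl.
have mE : 2 ^+ m = 2 ^+ (m - e) * 2 ^+ e :> R by rewrite -exprD subnK.
have wE n : width n = 2 ^- n by [].
congr (_ + _); rewrite !wE natrX mE invfM.
by rewrite mulVKf// expf_eq0 pnatr_eq0 andbF.
Qed.

Lemma units_eq m u v : all (fun e => e <= m)%N u -> all (fun e => e <= m)%N v ->
  total u = total v -> units m u = units m v.
Proof.
move=> um vm; rewrite (total_units um) (total_units vm).
move=> /(mulIf (lt0r_neq0 (width_gt0 R m)))/eqP.
by rewrite eqr_nat => /eqP.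
Qed.

Lemma units_nseq m n e : units m (nseq n e) = (n * 2 ^ (m - e))%N.
Proof. by rewrite /units big_nseq iter_addn_0 mulnC. Qed.

Lemma leq_sum_mem u (F F' : nat -> nat) : (forall e, e \in u -> F e <= F' e)%N ->
  (\sum_(e <- u) F e <= \sum_(e <- u) F' e)%N.
Proof. by move=> FF; rewrite !big_seq; apply: leq_sum. Qed.

(** The sum of the squares of the widths, in units of 4^-M. *)
Definition energy M u : nat := \sum_(e <- u) 4 ^ (M - e).

Lemma energy_exchange M m b x : (b < m.-1)%N -> (m <= M)%N ->
  (4 ^ (M - m.-1) + (4 ^ (M - b.+1) + (4 ^ (M - b.+1) + x)) <
   4 ^ (M - m) + (4 ^ (M - m) + (4 ^ (M - b) + x)))%N.
Proof.
move=> bm mM.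
have -> : (M - m.-1 = (M - m).+1)%N by lia.
have -> : (M - b = (M - b.+1).+1)%N by lia.
have h3 : (4 ^ (M - m).+1 <= 4 ^ (M - b.+1))%N by rewrite leq_exp2l//; lia.
have h4 : (0 < 4 ^ (M - m))%N by rewrite expn_gt0.
by move: h3 h4; rewrite !expnS; lia.
Qed.

(** If v is not uniform, two of its shortest arcs can be merged while an arc
    longer than the average is cut, at constant size and total width; the sum of
    the squares of the widths decreases. *)
Lemma null_uniform M a v : (a <= M)%N -> all (fun e => e <= M)%N v ->
  total v = total (nseq (size v) a) -> null (nseq (size v) a) v.
Proof.
have [N] := ubnP (energy M v); elim: N v => // N IH v; rewrite ltnS => vN aM vM va.
have [av|] := boolP (all (pred1 a) v).
  by rewrite -(all_pred1P _ _ av); exact: null_refl.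
rewrite -has_predC => /hasP[c cv /= ca].
have nM : all (fun e => e <= M)%N (nseq (size v) a) by rewrite all_nseq aM orbT.
have := units_eq vM nM va; rewrite units_nseq => uv.
pose mu := \max_(e <- v) e.
have vmu e : e \in v -> (e <= mu)%N by move=> ev; exact: leq_bigmax_seq.
have muv : mu \in v.
  rewrite /mu; case: v cv {IH vN vM va ca nM uv mu vmu} => // d v _.
  elim: v d => [|d' v IH'] d; first by rewrite big_seq1 mem_head.
  rewrite big_cons; have := IH' d'; set m := \max_(_ <- _) _.
  by rewrite /maxn; case: ifP => _; rewrite !in_cons ?eqxx// => ->; rewrite orbT.
have sum_const d : (\sum_(e <- v) 2 ^ (M - d) = size v * 2 ^ (M - d))%N.
  by rewrite big_const_seq count_predT iter_addn_0 mulnC.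
have amu : (a < mu)%N.
  rewrite ltnNge; apply/negP => mua.
  have : (units M v > size v * 2 ^ (M - a))%N; last by rewrite uv ltnn.
  rewrite -sum_const /units !(big_rem c cv) /=.
  have cle : (c <= mu)%N by exact: vmu.
  apply: leq_ltn_trans (_ : _ <= 2 ^ (M - a) + \sum_(e <- rem c v) 2 ^ (M - e))%N _.
    rewrite leq_add2l; apply: leq_sum_mem => e /mem_rem ev.
    by rewrite leq_exp2l// leq_sub2l// (leq_trans (vmu _ ev)).
  rewrite ltn_add2r ltn_exp2l//.
  have : (c <= M)%N by exact: (allP vM).
  by move: ca; lia.
have [b bv ba] : exists2 b, b \in v & (b < a)%N.
  apply/hasP; rewrite -[has _ _]negbK -all_predC; apply/negP => /allP ab.
  have : (units M v < size v * 2 ^ (M - a))%N; last by rewrite uv ltnn.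
  rewrite -sum_const /units !(big_rem mu muv) /=.
  apply: (@leq_trans (2 ^ (M - a) + \sum_(e <- rem mu v) 2 ^ (M - e))%N).
    rewrite ltn_add2r ltn_exp2l//.
    have : (mu <= M)%N by exact: (allP vM).
    by move: amu; lia.
  rewrite leq_add2l; apply: leq_sum_mem => e /mem_rem ev.
  rewrite leq_exp2l// leq_sub2l//.
  by have := ab e ev; rewrite /= -leqNgt.
have vmuP : all (fun e => e <= mu)%N v by apply/allP.
have nmu : all (fun e => e <= mu)%N (nseq (size v) a) by rewrite all_nseq (ltnW amu) orbT.
have := units_eq vmuP nmu va; rewrite units_nseq => uvmu.
(* The number of arcs of minimal width is even, because the total width is a
   multiple of twice the minimal width. *)
have mu2 : mu \in rem mu v.
  apply: contraT => mur; have : odd (units mu v).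
    rewrite /units (big_rem mu muv) /= subnn expn0 oddD /=.
    rewrite big_seq (eq_bigr (fun e => 2 * 2 ^ (mu - e).-1)%N); last first.
      move=> e er; have ev := mem_rem er; rewrite -expnS prednK// subn_gt0 ltn_neqAle vmu// andbT.
      by apply: contraNneq mur => emu; rewrite -{1}emu.
    by rewrite -big_distrr /= mul2n odd_double.
  by rewrite uvmu oddM oddX /= subn_eq0 leqNgt amu andbF.
have b2 : b \in rem mu (rem mu v).
  have bmu : b != mu by rewrite ltn_eqF// (ltn_trans ba).
  have rb x : b \in x -> b \in rem mu x.
    move=> bx; have [mx|mx] := boolP (mu \in x); last by rewrite rem_id.
    by have := perm_mem (perm_to_rem mx) b; rewrite bx in_cons (negPf bmu).
  exact: (rb _ (rb _ bv)).
pose w := rem b (rem mu (rem mu v)).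
have pv : perm_eq v [:: mu, mu, b & w].
  apply: perm_trans (perm_to_rem muv) _; rewrite perm_cons.
  apply: perm_trans (perm_to_rem mu2) _; rewrite perm_cons.
  exact: perm_to_rem.
pose v' := [:: mu.-1, b.+1, b.+1 & w].
have mu0 : (0 < mu)%N by exact: leq_ltn_trans (leq0n a) amu.
have bmu : (b < mu.-1)%N by rewrite -ltnS prednK//; exact: leq_ltn_trans ba amu.
have muM : (mu <= M)%N by exact: (allP vM).
have v'v : null v' v.
  apply: null_trans _ (null_sym (null_perm pv)).
  by have := null_catr w (null_exchange bmu); rewrite prednK.
have sv : size v' = size v by case: v'v.
have tv : total v' = total v by case: v'v.
apply: null_trans v'v; rewrite -sv; apply: IH => //.
- by apply: leq_trans vN; rewrite /energy (perm_big _ pv) /= !big_cons; exact: energy_exchange.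
- have : all (fun e => e <= M)%N [:: mu, mu, b & w] by rewrite -(perm_all _ pv).
  move=> /= /and4P[_ _ _ ->]; rewrite (leq_trans (leq_pred _) muM)/=.
  by rewrite (leq_trans bmu)// (leq_trans (leq_pred _)).
- by rewrite tv sv.
Qed.

Lemma null_refines u r v : refines u r -> size u = size v ->
  exists v', [/\ size r = size v', total v' = total v & null r v' -> null u v].
Proof.
move=> ur; elim: ur v => [p|p1 e p2 q _ IH] v uv; first by exists v; split.
have [v1 [f [v2 [vE pv1]]]] : exists v1 f v2, v = v1 ++ f :: v2 /\ size p1 = size v1.
  have s1 : (size p1 < size v)%N by rewrite -uv size_cat /= addnS ltnS leq_addr.
  exists (take (size p1) v), (nth 0%N v (size p1)), (drop (size p1).+1 v).
  by rewrite -drop_nth// cat_take_drop size_takel// ltnW.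
have [|v' [qv' tv' nv']] := IH (v1 ++ [:: f.+1, f.+1 & v2]).
  by move: uv; rewrite vE !size_cat /=; lia.
exists v'; split=> //.
  rewrite tv' vE; apply/esym.
  exact: (refines_total R (refines_split (refines_refl _))).
by move=> /nv' h; rewrite vE; apply: (proj2 (null_split R _ _ _ _ pv1)).
Qed.

Lemma all_null u v : size u = size v -> total u = total v -> null u v.
Proof.
move=> uv tuv; have [K uK] := bounded_exponents u.
have [n un _] := refines_nseq (uK 0%N); rewrite addn0 in un.
have [v' [nv' tv' nuv]] := null_refines un uv; apply: nuv.
rewrite size_nseq in nv'; have [K' vK'] := bounded_exponents v'.
rewrite nv'; apply: (@null_uniform (K' + K)%N); [exact: leq_addl|exact: vK'|].
by rewrite -nv' tv' -tuv (refines_total R un).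
Qed.

End Rearrangements.

(** * Affine pieces of elements of T *)

Section PiecesOfElements.
Variable R : realType.
Local Notation circle := (circle R).
Local Notation pi := (\pi_circle : R -> circle).
Local Notation T := (thompsonT R).
Implicit Types (f : circle -> circle) (g : T) (a b c x y t : R).

(** The integer (2^k - 2^k') z + c - c' varies continuously with z, so it is
    constant. *)
Lemma slope_unique y (k k' : int) c c' :
  (\forall z \near y, pi (2 ^ k * z + c) = pi (2 ^ k' * z + c')) ->
  k = k' /\ c - c' \is a Num.int.
Proof.
move=> kk'; pose d : R := 2 ^ k - 2 ^ k'.
have near_small : \forall z \near y, `|d * (z - y)| < 1.
  have cz : d * (z - y) @[z --> y] --> (0 : R).
    rewrite -(mulr0 d) -(subrr y); apply: cvgMr; apply: cvgB; first exact: cvg_id.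
    exact: cvg_cst.
  by have /cvgr0Pnorm_lt/(_ 1 ltr01) := cz.
have : \forall z \near y, d * (z - y) = 0.
  have /eq_circle y0 := nbhs_singleton kk'.
  apply: filterS2 kk' near_small => z /eq_circle z0.
  rewrite ltr_norml => /small_int; apply.
  rewrite (_ : d * (z - y) = 2 ^ k * z + c - (2 ^ k' * z + c') -
    (2 ^ k * y + c - (2 ^ k' * y + c'))); last by rewrite /d; ring.
  exact: rpredB.
move=> /nbhs_ballP[e /= e0 /(_ (y + e / 2))].
have e2 : 0 < e / 2 by rewrite divr_gt0.
rewrite /ball /= opprD addrA subrr sub0r normrN gtr0_norm// => /(_ _)/wrap[]; first by lra.
rewrite addrC addrA addNr add0r => /eqP; rewrite mulf_eq0 (gt_eqF e2) orbF subr_eq0 => /eqP E.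
have kE : k = k' by apply: (@ieexprIz R 2) => //; rewrite gt_eqF// ltr1n.
split=> //; have /eq_circle := nbhs_singleton kk'.
by rewrite E (_ : _ + c - _ = c - c'); last by ring.
Qed.

(** The affine germs of f along an open interval agree: the points with a given
    germ form an open and closed subset. *)
Lemma affine_between f a b : a < b ->
  (forall x, a < x < b ->
    exists (k : int) c, \forall y \near x, f (pi y) = pi (2 ^ k * y + c)) ->
  exists (k : int) c, forall x, a < x < b -> f (pi x) = pi (2 ^ k * x + c).
Proof.
move=> ab loc; have [|k [c kc]] := loc ((a + b) / 2); first by apply/andP; split; lra.
exists k, c; pose C := [set y | f (pi y) = pi (2 ^ k * y + c)]°.
pose A : set R := `]a, b[%classic.
have connA : connected A by apply/connected_intervalP; exact: interval_is_interval.
have AC : A `&` C = A.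
  apply: connA.
  - by exists ((a + b) / 2); split=> //; rewrite /A /= in_itv /=; apply/andP; split; lra.
  - by exists C => //; exact: open_interior.
  - exists (closure C); first exact: closed_closure.
    apply/seteqP; split=> x [Ax Cx]; split=> //; first exact: subset_closure.
    have [|k' [c' kc']] := loc x; first by move: Ax; rewrite /A /= in_itv.
    have [|z [Cz kz]] := Cx [set y | f (pi y) = pi (2 ^ k' * y + c')]°.
      by apply: nbhs_interior.
    have [|kE /intrP[m cE]] := @slope_unique z k' k c' c.
      have Cz' : \forall y \near z, f (pi y) = pi (2 ^ k * y + c) := Cz.
      have kz' : \forall y \near z, f (pi y) = pi (2 ^ k' * y + c') := kz.
      by apply: filterS2 Cz' kz' => y -> ->.
    apply: filterS kc' => y /= ->.
    by rewrite kE -(subrK c c') cE addrCA addrC piDint.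
move=> x xab; have : (A `&` C) x by rewrite AC /A /= in_itv.
by move=> [_ /interior_subset].
Qed.

(** The circle is Hausdorff. *)
Lemma agree_adherent (F G : R -> circle) x : continuous F -> continuous G ->
  (forall e, 0 < e -> exists2 y, `|x - y| < e & F y = G y) -> F x = G x.
Proof.
move=> Fc Gc FG; apply/eqP/negP => /negP FGx.
have := @circle_hausdorff R; rewrite open_hausdorff => /(_ _ _ FGx).
move=> [[U V] /= [/set_mem Ux /set_mem Vx] [oU oV UV]].
have nU : \forall y \near x, U (F y) by apply: (Fc x); exact: open_nbhs_nbhs.
have nV : \forall y \near x, V (G y) by apply: (Gc x); exact: open_nbhs_nbhs.
have : \forall y \near x, U (F y) /\ V (G y) by exact: filterI.
move=> /nbhs_ballP[e /= e0 eUV].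
have [y xy Fy] := FG e e0; have [Uy Vy] := eUV y xy.
suff : set0 (F y) by [].
by rewrite -(eqP UV); split=> //; rewrite Fy.
Qed.

(** The formula extends to the end points by continuity: points of the open
    interval close to x are found on the segment from x to the midpoint. *)
Lemma affine_between_closed f a b : continuous f -> a < b ->
  (forall x, a < x < b ->
    exists (k : int) c, \forall y \near x, f (pi y) = pi (2 ^ k * y + c)) ->
  exists (k : int) c, forall x, a <= x <= b -> f (pi x) = pi (2 ^ k * x + c).
Proof.
move=> fc ab /(affine_between ab)[k [c kc]]; exists k, c => x /andP[ax xb].
apply: (@agree_adherent (f \o pi) (fun x => pi (2 ^ k * x + c))).
- by move=> y; apply: continuous_comp; [exact: continuous_pi|exact: fc].
- move=> y; apply: continuous_comp; last exact: continuous_pi.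
  by move=> P /= nP; exact: affine_near nP.
- move=> e e0; pose m := (a + b) / 2; pose s := e / (e + (b - a)).
  have eba : 0 < e + (b - a) by lra.
  have s0 : 0 < s by rewrite divr_gt0.
  have s1 : s < 1 by rewrite ltr_pdivrMr// mul1r; lra.
  have sE : s * (b - a) = e * (1 - s) by rewrite /s; field; rewrite gt_eqF.
  exists (x + s * (m - x)).
    rewrite opprD addrA subrr sub0r normrN normrM (gtr0_norm s0).
    apply: (@le_lt_trans _ _ (s * (b - a))).
      rewrite ler_pM2l// ler_norml; apply/andP; rewrite /m; split; lra.
    by rewrite sE; nra.
  by rewrite /= kc// /m; apply/andP; split; nra.
Qed.

(** An arc of width 2^-N without breakpoints goes to an arc of width 2^-e: the
    slope is a power of 2, and the image arc has length at most 1 because g is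
    injective. *)
Lemma affine_piece g a b (N : nat) :
  (forall x, a < x < a + width R N -> exists (k : int) c,
     \forall y \near x, thompson_act g (pi y) = pi (2 ^ k * y + c)) ->
  thompson_act g (pi a) = pi b -> (0 < N)%N ->
  exists e, forall s, 0 <= s <= 1 ->
    thompson_act g (pi (a + s * width R N)) = pi (b + s * width R e).
Proof.
move=> loc gab N0; have w0 := width_gt0 R N.
have w1 : width R N < 1.
  by rewrite invf_lt1 ?exprn_gt0// exprn_egt1 ?ltr1n// -lt0n.
have [|k [c kc]] := affine_between_closed (@thompson_continuous R g) _ loc.
  by rewrite ltrDl.
have p0 : 0 < 2 ^ k :> R by exact: exprz_gt0.
have bE s : 0 <= s <= 1 ->
    thompson_act g (pi (a + s * width R N)) = pi (b + s * (2 ^ k * width R N)).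
  move=> /andP[s0 s1]; rewrite kc; last first.
    by rewrite lerDl mulr_ge0 ?(ltW w0)//= lerD2l ler_piMl// ltW.
  have := kc a; rewrite lexx lerDl (ltW w0) gab => /(_ isT)/eq_pi_int[m ->].
  by rewrite -(piDint _ m); congr pi; ring.
have kw1 : 2 ^ k * width R N <= 1.
  rewrite leNgt; apply/negP => kw; have kw0 := lt_trans ltr01 kw.
  have s0 : 0 < (2 ^ k * width R N)^-1 by rewrite invr_gt0.
  have s1 : (2 ^ k * width R N)^-1 < 1 by rewrite invf_lt1.
  have := bE _ (introT andP (conj (ltW s0) (ltW s1))).
  rewrite mulVf ?gt_eqF// -[1]mulr1z piDint -gab => /(can_inj (thompson_actK g)).
  move=> /eq_circle; rewrite addrC addKr => /small_int E.
  have sw0 : 0 < (2 ^ k * width R N)^-1 * width R N by rewrite mulr_gt0.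
  have sw1 : (2 ^ k * width R N)^-1 * width R N < 1.
    by rewrite (lt_trans _ w1)// gtr_pMl.
  by move: (sw0); rewrite E ?ltxx// sw1 andbT (lt_trans _ sw0)// oppr_lt0.
have kwE : 2 ^ k * width R N = 2 ^ (k - N%:Z) :> R.
  by rewrite /width expfzDr ?pnatr_eq0// -exprnN.
exists `|k - N%:Z|%N => s /bE ->; congr pi; congr (_ + s * _).
move: kw1; rewrite kwE; case: (k - N%:Z) => [[|n]|n] //.
  by rewrite /width /= expr0 invr1.
by rewrite leNgt -exprnP exprn_egt1// ltr1n.
Qed.

End PiecesOfElements.

(** * From elements to subdivisions *)

Section Subdivisions.
Variable R : realType.
Local Notation circle := (circle R).
Local Notation pi := (\pi_circle : R -> circle).
Local Notation T := (thompsonT R).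
Local Notation width := (width R).
Local Notation total := (total R).
Implicit Types (f : circle -> circle) (g : T) (a b c x y t : R) (u v : seq nat).

Lemma affine_pieces g (N n : nat) a b : (0 < N)%N ->
  (forall i x, (i < n)%N -> a + i%:R * width N < x < a + i.+1%:R * width N ->
     exists (k : int) c, \forall y \near x, thompson_act g (pi y) = pi (2 ^ k * y + c)) ->
  thompson_act g (pi a) = pi b ->
  exists v, affine_on (thompson_act g) a b (nseq n N) v.
Proof.
move=> N0; elim: n a b => [|n IH] a b loc gab; first by exists [::].
have [|e he] := affine_piece _ gab N0.
  by move=> x hx; apply: (loc 0%N x) => //; rewrite mul0r addr0 mul1r.
have [||v hv] := IH (a + width N) (b + width e).
- move=> i x lin hx; apply: (loc i.+1 x) => //.
  by move: hx => /andP; rewrite -!natr1 => -[h1 h2]; apply/andP; split; lra.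
- by rewrite -[width N]mul1r he ?ler01 ?lexx// mul1r.
by exists (e :: v).
Qed.

Lemma affine_on_end f a b u v : affine_on f a b u v -> f (pi a) = pi b ->
  f (pi (a + total u)) = pi (b + total v).
Proof.
elim: u v a b => [|e u IH] [|e' v] //= a b; first by rewrite total_nil !addr0.
move=> [fe fu] _; rewrite !total_cons !addrA; apply: IH fu _.
by rewrite -[width e]mul1r fe ?ler01 ?lexx// mul1r.
Qed.

Lemma affine_on_image f a b u v y : affine_on f a b u v -> f (pi a) = pi b ->
  b <= y <= b + total v -> exists2 t, a <= t <= a + total u & f (pi t) = pi y.
Proof.
elim: u v a b => [|e u IH] [|e' v] //= a b.
  rewrite !total_nil !addr0 => _ fab y01; exists a; first by rewrite lexx.
  by have -> : y = b by apply/eqP; rewrite eq_le andbC.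
move=> [fe fu] _ /andP[by1]; rewrite !total_cons !addrA => y2.
have w0 := width_gt0 R e; have w0' := width_gt0 R e'; have t0 := total_ge0 R u.
have [ye|ye] := lerP y (b + width e').
  have s0 : 0 <= (y - b) / width e' by rewrite divr_ge0 ?(ltW w0')// subr_ge0.
  have s1 : (y - b) / width e' <= 1 by rewrite ler_pdivrMr// mul1r; lra.
  exists (a + (y - b) / width e' * width e).
    have h0 : 0 <= (y - b) / width e' * width e by rewrite mulr_ge0// ltW.
    have h1 : (y - b) / width e' * width e <= width e by rewrite ler_piMl// ltW.
    by apply/andP; split; lra.
  by rewrite fe ?s0// divfK ?gt_eqF// addrC subrK.
have [||t /andP[t1 t2] ft] := IH _ _ _ fu.
- by rewrite -[width e]mul1r fe ?ler01 ?lexx// mul1r.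
- by rewrite (ltW ye).
by exists t => //; rewrite t2 andbT; lra.
Qed.

Lemma dyadic_common_denominator (B : seq R) : (forall b, b \in B -> dyadic b) ->
  exists N, forall M b, (N <= M)%N -> b \in B -> b * 2 ^+ M \is a Num.int.
Proof.
elim: B => [|b B IH] dB; first by exists 0%N.
have [|N hN] := IH; first by move=> c cB; apply: dB; rewrite in_cons cB orbT.
have [m [n bE]] := dB b (mem_head _ _); exists (maxn n N) => M c.
rewrite geq_max in_cons => /andP[nM NM] /predU1P[->|]; last exact: hN.
rewrite bE -(subnKC nM) exprD mulrA divfK ?expf_neq0 ?pnatr_eq0//.
by rewrite rpredM ?intr_int ?rpredX// natr_int.
Qed.

(** The grid of mesh 2^-N with N so large that every breakpoint is on it and
    that g is the identity on the two arcs next to the base point. *)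
Lemma subdivision g : trivial_near (@thompson_act R) (pi 0) g ->
  exists (N : nat) u v, [/\ total ([:: N] ++ u ++ [:: N]) = 1,
    total ([:: N] ++ v ++ [:: N]) = 1 &
    maps g ([:: N] ++ u ++ [:: N]) ([:: N] ++ v ++ [:: N])].
Proof.
move=> gF; have /set_mem[_ [B [dB gB]] _] := valP g.
have [N1 hN1] := @dyadic_common_denominator B (fun b bB => proj1 (dB b bB)).
have : \forall t \near (0 : R), thompson_act g (pi t) = pi t.
  by have := @continuous_pi R 0 _ gF.
move=> /nbhs_ballP[e /= e0 ge]; pose N2 := Num.bound e^-1.
have N2e : width N2 < e.
  have ne : e^-1 < 2 ^+ N2 by apply: upper_nthrootP.
  by rewrite -[ltRHS]invrK ltf_pV2// posrE ?invr_gt0// exprn_gt0.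
pose N := maxn N2 N1.+1; have N0 : (0 < N)%N by rewrite leq_max orbT.
have w0 := width_gt0 R N.
have Ne : width N < e.
  apply: le_lt_trans N2e; rewrite lef_pV2 ?posrE ?exprn_gt0//.
  by rewrite ler_weXn2l ?ler1n// leq_maxl.
have gid t : -width N <= t <= width N -> thompson_act g (pi t) = pi t.
  move=> /andP[t1 t2]; apply: ge; rewrite /ball /= sub0r normrN ltr_norml.
  by apply/andP; split; lra.
have wN : (2 ^ N)%N%:R * width N = 1 by rewrite natrX mulfV// expf_neq0// pnatr_eq0.
pose n := (2 ^ N - 2)%N; have nE : (2 ^ N = n + 2)%N.
  by rewrite subnK// -{1}(expn1 2) leq_exp2l.
have tn : total (nseq n N) = 1 - width N - width N.
  rewrite /total big_nseq -!/(iter _ _ _) iter_addr addr0 -mulr_natl.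
  by move: wN; rewrite nE natrD mulrDl => wN; lra.
have w2 : width N <= 1 / 2.
  rewrite -(prednK N0) /width exprS invfM mul1r ler_piMr ?invr_ge0//.
  by rewrite invf_le1 ?exprn_gt0// exprn_ege1// ler1n.
have [||v gv] := @affine_pieces g N n (width N) (width N) N0.
- move=> i x lin /andP[x1 x2]; apply: gB; apply/negP => /mapP[b bB /eq_circle xb].
  have : x * 2 ^+ N \is a Num.int.
    rewrite -(subrK b x) mulrDl rpredD//; last first.
      by apply: hN1 => //; rewrite (leq_trans (leqnSn _))// leq_maxr.
    by rewrite rpredM// rpredX// natr_int.
  move=> /intrP[m xm].
  have p0 : 0 < 2 ^+ N :> R by rewrite exprn_gt0.
  have wp : width N * 2 ^+ N = 1 by rewrite mulVf// gt_eqF.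
  have wpE j : j%:R = j%:R * width N * 2 ^+ N :> R by rewrite -mulrA wp mulr1.
  have : i.+1%:R < m%:~R :> R.
    rewrite -xm (wpE i.+1) ltr_pM2r//.
    by rewrite -natr1 mulrDl mul1r addrC.
  have : m%:~R < i.+2%:R :> R.
    rewrite -xm (wpE i.+2) ltr_pM2r//.
    by rewrite -natr1 mulrDl mul1r addrC.
  rewrite -[i.+2%:R]/(i.+2%:Z%:~R) -[i.+1%:R]/(i.+1%:Z%:~R) !ltr_int; clear; lia.
- by apply: gid; apply/andP; split; lra.
have gw : thompson_act g (pi (width N)) = pi (width N).
  by apply: gid; apply/andP; split; lra.
have tv0 := total_ge0 R v.
have tv : total v = 1 - width N - width N.
  have := affine_on_end gv gw; rewrite tn.
  rewrite (_ : width N + _ = - width N + 1%:~R); last by rewrite mulr1z; ring.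
  rewrite piDint gid; last by apply/andP; split; lra.
  move=> /esym/eq_pi_int[m vm]; have m0 : 0 < m.
    by rewrite -(ltr_int R); lra.
  suff m1 : m < 2 by have mE : m = 1 by [clear -m0 m1; lia]; move: vm; rewrite mE mulr1z; lra.
  (* Otherwise the image covers the circle once more and meets g 0 = 0 again. *)
  rewrite ltNge; apply/negP => m2; have {}m2 : 2 <= m%:~R :> R by rewrite -(ler_int R) in m2.
  have [|t /andP[t1 t2]] := affine_on_image (y := 1) gv gw.
    by apply/andP; split; lra.
  rewrite -[in RHS](add0r 1) -[in RHS](mulr1z 1) piDint -(gid 0); last by apply/andP; split; lra.
  move=> /(can_inj (thompson_actK g))/pi_inj01; rewrite lexx ltr01 tn in t2 * => tE.
  by have : t = 0; [apply: tE => //; apply/andP; split|]; lra.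
exists N, (nseq n N), v.
have tE (r : seq nat) : total r = 1 - width N - width N -> total ([:: N] ++ r ++ [:: N]) = 1.
  by move=> rE; rewrite !total_cat rE /total !big_cons !big_nil; ring.
split; [exact: tE|exact: tE|].
have uv := affine_on_size gv.
rewrite /maps /=; split.
  move=> s /andP[s0 s1]; rewrite !add0r; apply: gid.
  have h0 : 0 <= s * width N by rewrite mulr_ge0// ltW.
  have h1 : s * width N <= width N by rewrite ler_piMl// ltW.
  by apply/andP; split; lra.
rewrite !add0r affine_on_cat//; split=> //=; split=> // s /andP[s0 s1].
rewrite tn tv (_ : width N + _ + s * _ = - ((1 - s) * width N) + 1%:~R); last by rewrite mulr1z; ring.
rewrite piDint; apply: gid.
have h0 : 0 <= (1 - s) * width N by rewrite mulr_ge0 ?subr_ge0// ltW.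
have h1 : (1 - s) * width N <= width N by rewrite ler_piMl ?(ltW w0)//; lra.
by apply/andP; split; lra.
Qed.

(** The subdivisions extracted from g agree on the two arcs next to the base
    point; what lies between them is rearranged by null moves. *)
Lemma trivial_near_perfect g : trivial_near (@thompson_act R) (pi 0) g ->
  commutator_product (trivial_near (@thompson_act R) (pi 0)) g.
Proof.
move=> /subdivision[N [u [v [tu tv guv]]]].
have [||_ _ nuv] := @all_null R u v.
- by have /affine_on_size := guv; rewrite !size_cat => /addnI/addIn.
- by move: tv; rewrite -tu !total_cat => /addrI/addIr.
exact: nuv guv.
Qed.

Lemma thompson_extremely_proximal :
  extremely_proximal_action (@thompson_act R) (pi 0).
Proof.
split.
- exact: thompson_actM.
- exact: thompson_act1.
- exact: thompson_faithful.
- exact: thompson_continuous.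
- exact: circle_hausdorff.
- exact: circle_no_isolated.
- exact: thompson_proximal.
- exact: trivial_near_perfect.
Qed.

End Subdivisions.

Theorem theorem1p3 (R : realType) :
  exists! I : set (ell2 R (thompsonT R) -> ell2 R (thompsonT R)),
    maximal_ideal (reduced_Cstar R (thompsonT R)) I.
Proof. exact: unique_maximal_ideal_of_action (@thompson_extremely_proximal R). Qed.
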